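(* Let $M$ be a closed, connected, orientable smooth manifold. Every globally hypoelliptic (GH) smooth vector field $X$ on $M$ is $C^\infty$-stable, and hence it is $C^\infty$-cohomology free (CF).
   Context: Let $n=\dim M$. $C^\infty(M)$ is the Fréchet space of smooth complex-valued functions on $M$, and $\mathcal{D}'_n(M)$ is its dual space (distributions, viewed as currents of degree $n$ and dimension $0$). The space $\Omega^n(M)$ of smooth (complex-valued) $n$-forms is regarded as a subspace of $\mathcal{D}'_n(M)$: after fixing an orientation, $\eta\in\Omega^n(M)$ defines the distribution $f\mapsto\int_M f\eta$. The Lie derivative $\mathcal{L}_X$ acts on $C^\infty(M)$ by $f\mapsto Xf$ and on $\mathcal{D}'_n(M)$ by duality, $(\mathcal{L}_XU)(f)=-U(Xf)$, extending the usual Lie derivative of smooth $n$-forms. $X$ is globally hypoelliptic (GH) if, for any $U\in\mathcal{D}'_n(M)$, $\mathcal{L}_XU\in\Omega^n(M)$ implies $U\in\Omega^n(M)$. $X$ is $C^\infty$-stable if the operator $\mathcal{L}_X:C^\infty(M)\to C^\infty(M)$ has closed range. $X$ is $C^\infty$-cohomology free (CF) if for every $f\in C^\infty(M)$ there exist a constant $c(f)\in\mathbb{C}$ and $u\in C^\infty(M)$ such that $Xu=f-c(f)$. *)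

(* Defs.v *)
From HB Require Import structures.
From mathcomp Require Import all_boot all_order all_algebra.
From mathcomp Require Import all_classical all_reals all_analysis.
From mathcomp Require Import complex.

Set Implicit Arguments.
Unset Strict Implicit.
Unset Printing Implicit Defensive.

Import Order.TTheory GRing.Theory Num.Theory.
Import numFieldNormedType.Exports.

Local Open Scope classical_set_scope.
Local Open Scope ring_scope.
Local Open Scope complex_scope.

(* [Re] and [Im] would denote the generic operations of [numClosedFieldType],
   which are valued in [R[i]]. *)
Local Notation Re := complex.Re.
Local Notation Im := complex.Im.

Section SmoothOn.
Variables (R : realType) (n : nat).
Implicit Types (g h : 'rV[R]_n -> R) (A : set 'rV[R]_n) (s : seq 'I_n).

(* Iterated partial derivatives; the head of [s] is differentiated last. *)
Fixpoint partials s g : 'rV[R]_n -> R :=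
  if s is i :: s' then fun x => 'D_(delta_mx 0 i) (partials s' g) x else g.

(* Meant for open [A]. Asking every iterated partial derivative to be (Frechet)
   differentiable is the same as asking all of them to exist and be
   continuous. *)
Definition smooth_on A g := forall s x, A x -> differentiable (partials s g) x.

Definition csmooth_on A (g : 'rV[R]_n -> R[i]) :=
  smooth_on A (fun x => Re (g x)) /\ smooth_on A (fun x => Im (g x)).

Definition cpartials s (g : 'rV[R]_n -> R[i]) (x : 'rV[R]_n) : R[i] :=
  partials s (fun y => Re (g y)) x +i* partials s (fun y => Im (g y)) x.

Definition smooth_map_on m A (t : 'rV[R]_n -> 'rV[R]_m) :=
  forall j, smooth_on A (fun x => t x 0 j).

Lemma near_eq_differentiable (W : normedModType R) (f g : 'rV[R]_n -> W) x :
  (\near x, f x = g x) -> differentiable f x -> differentiable g x.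
Proof.
move=> fg df.
have fgx : f x = g x := nbhs_singleton fg.
have gE : g \o shift x = cst (g x) + 'd f x +o_ 0 id.
  have fE := diff_locally df.
  apply/eqaddoP => e e0.
  have /eqaddoP/(_ e e0) := fE.
  have fg0 : \forall y \near 0, f (y + x) = g (y + x).
    by move: fg; rewrite (near_shift 0 x); apply: filterS => y /=; rewrite subr0.
  apply: filterS2 fg0 => y yfg.
  rewrite /GRing.add /GRing.opp /= /cst /=.
  by rewrite yfg fgx.
apply/diff_locallyP; split.
  by rewrite (@diff_unique _ _ _ g ('d f x)) //; exact: diff_continuous.
by rewrite (@diff_unique _ _ _ g ('d f x)) //; exact: diff_continuous.
Qed.

Definition ksmooth_on k A g :=
  forall s, (size s <= k)%N -> forall x, A x -> differentiable (partials s g) x.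

Lemma smooth_onE A g : smooth_on A g <-> forall k, ksmooth_on k A g.
Proof.
by split=> [sg k s _ x Ax|sg s x Ax]; [exact: sg | exact: (sg (size s) s)].
Qed.

Lemma partials_rcons s i g :
  partials (rcons s i) g = partials s (fun x => 'D_(delta_mx 0 i) g x).
Proof. by elim: s => //= j s ->. Qed.

Lemma ksmooth_onS k A g :
  ksmooth_on k.+1 A g <->
  (forall x, A x -> differentiable g x) /\
  (forall i, ksmooth_on k A (fun x => 'D_(delta_mx 0 i) g x)).
Proof.
split=> [sg|[dg sg] s].
  split=> [|i s sk]; first exact: (sg [::]).
  by rewrite -partials_rcons; apply: sg; rewrite size_rcons.
case/lastP: s => [_|s i]; first exact: dg.
by rewrite size_rcons ltnS partials_rcons; exact: sg.
Qed.

Lemma ksmooth_on0 A g :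
  ksmooth_on 0 A g <-> (forall x, A x -> differentiable g x).
Proof.
split=> [sg|dg s]; first exact: (sg [::]).
by rewrite leqn0 => /nilP ->.
Qed.

Lemma ksmooth_onW k A g : ksmooth_on k.+1 A g -> ksmooth_on k A g.
Proof. by move=> sg s sk; apply: sg; rewrite ltnW. Qed.

Lemma ksmooth_on_diff k A g x : ksmooth_on k A g -> A x -> differentiable g x.
Proof. by move=> /(_ [::]); exact. Qed.

Section Open.
Variables (A : set 'rV[R]_n) (oA : open A).

Lemma near_open (P : 'rV[R]_n -> Prop) x :
  (forall y, A y -> P y) -> A x -> \near x, P x.
Proof.
by move=> AP Ax; apply: filterS (open_nbhs_nbhs (conj oA Ax)) => y /AP.
Qed.

Lemma ksmooth_on_eq k g h : (forall x, A x -> g x = h x) ->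
  ksmooth_on k A g -> ksmooth_on k A h.
Proof.
elim: k => [|k IH] in g h *.
  move=> gh /ksmooth_on0 sg; apply/ksmooth_on0 => x Ax.
  by apply: near_eq_differentiable (sg _ Ax); exact: near_open.
move=> gh /ksmooth_onS[dg sg]; apply/ksmooth_onS; split=> [x Ax|i].
  by apply: near_eq_differentiable (dg _ Ax); exact: near_open.
apply: IH (sg i) => x Ax; apply: near_eq_derive; exact: near_open.
Qed.

Lemma ksmooth_on_cst k c : ksmooth_on k A (fun=> c).
Proof.
elim: k => [|k IH] in c *; first by apply/ksmooth_on0 => x _.
apply/ksmooth_onS; split=> [x _|i] //.
by apply: ksmooth_on_eq (IH 0) => x _; rewrite derive_cst.
Qed.

Lemma ksmooth_onD k g h : ksmooth_on k A g -> ksmooth_on k A h ->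
  ksmooth_on k A (fun x => g x + h x).
Proof.
elim: k => [|k IH] in g h *.
  move=> /ksmooth_on0 sg /ksmooth_on0 sh; apply/ksmooth_on0 => x Ax.
  by apply: differentiableD; [exact: sg | exact: sh].
move=> /ksmooth_onS[dg sg] /ksmooth_onS[dh sh]; apply/ksmooth_onS.
split=> [x Ax|i]; first by apply: differentiableD; [exact: dg | exact: dh].
apply: ksmooth_on_eq (IH _ _ (sg i) (sh i)) => x Ax.
by rewrite -deriveD //; apply: diff_derivable; [exact: dg | exact: dh].
Qed.

Lemma ksmooth_onM k g h : ksmooth_on k A g -> ksmooth_on k A h ->
  ksmooth_on k A (fun x => g x * h x).
Proof.
elim: k => [|k IH] in g h *.
  move=> /ksmooth_on0 sg /ksmooth_on0 sh; apply/ksmooth_on0 => x Ax.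
  by apply: differentiableM; [exact: sg | exact: sh].
move=> sg1 sh1; have /ksmooth_onS[dg sg] := sg1.
have /ksmooth_onS[dh sh] := sh1; apply/ksmooth_onS.
split=> [x Ax|i]; first by apply: differentiableM; [exact: dg | exact: dh].
have sgh := ksmooth_onD (IH _ _ (ksmooth_onW sg1) (sh i))
  (IH _ _ (ksmooth_onW sh1) (sg i)).
apply: ksmooth_on_eq sgh => x Ax.
by rewrite deriveM //; apply: diff_derivable; [exact: dg | exact: dh].
Qed.

Lemma smooth_on_eq g h : (forall x, A x -> g x = h x) ->
  smooth_on A g -> smooth_on A h.
Proof.
by move=> gh /smooth_onE sg; apply/smooth_onE => k; exact: ksmooth_on_eq (sg k).
Qed.

Lemma smooth_on_cst c : smooth_on A (fun=> c).
Proof. by apply/smooth_onE => k; exact: ksmooth_on_cst. Qed.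

Lemma smooth_onD g h : smooth_on A g -> smooth_on A h ->
  smooth_on A (fun x => g x + h x).
Proof.
move=> /smooth_onE sg /smooth_onE sh; apply/smooth_onE => k.
exact: ksmooth_onD.
Qed.

Lemma smooth_onM g h : smooth_on A g -> smooth_on A h ->
  smooth_on A (fun x => g x * h x).
Proof.
move=> /smooth_onE sg /smooth_onE sh; apply/smooth_onE => k.
exact: ksmooth_onM.
Qed.

Lemma smooth_onB g h : smooth_on A g -> smooth_on A h ->
  smooth_on A (fun x => g x - h x).
Proof.
move=> sg sh; apply: smooth_onD => //.
apply: (@smooth_on_eq (fun x => -1 * h x)) => [x _|]; first by rewrite mulN1r.
by apply: smooth_onM => //; exact: smooth_on_cst.
Qed.

Lemma smooth_on_sum (I : Type) (r : seq I) (F : I -> 'rV[R]_n -> R) :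
  (forall i, smooth_on A (F i)) -> smooth_on A (fun x => \sum_(i <- r) F i x).
Proof.
move=> sF; elim: r => [|i r IH].
  apply: smooth_on_eq (smooth_on_cst 0) => x _; by rewrite big_nil.
by apply: smooth_on_eq (smooth_onD (sF i) IH) => x _; rewrite big_cons.
Qed.

Lemma smooth_on_derive i g : smooth_on A g ->
  smooth_on A (fun x => 'D_(delta_mx 0 i) g x).
Proof. by move=> sg s; rewrite -partials_rcons; exact: sg. Qed.

Lemma csmooth_onM (g h : 'rV[R]_n -> R[i]) :
  csmooth_on A g -> csmooth_on A h -> csmooth_on A (fun x => g x * h x).
Proof.
move=> [gr gi] [hr hi]; split.
  apply: smooth_on_eq (smooth_onB (smooth_onM gr hr) (smooth_onM gi hi)) => x _.
  by case: (g x) (h x) => a b [c d].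
apply: smooth_on_eq (smooth_onD (smooth_onM gr hi) (smooth_onM gi hr)) => x _.
by case: (g x) (h x) => a b [c d].
Qed.

Lemma csmooth_onD (g h : 'rV[R]_n -> R[i]) :
  csmooth_on A g -> csmooth_on A h -> csmooth_on A (fun x => g x + h x).
Proof.
move=> [gr gi] [hr hi]; split.
  by apply: smooth_on_eq (smooth_onD gr hr) => x _; case: (g x) (h x) => a b [].
by apply: smooth_on_eq (smooth_onD gi hi) => x _; case: (g x) (h x) => a b [].
Qed.

Lemma csmooth_on_cst c : csmooth_on A (fun=> c).
Proof. by split; exact: smooth_on_cst. Qed.

End Open.

Lemma differentiable_rV m (t : 'rV[R]_n -> 'rV[R]_m) x :
  (forall j, differentiable (fun y => t y 0 j) x) -> differentiable t x.
Proof.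
move=> dt.
have -> : t = \sum_(j < m)
    (fun y => (t y 0 j : R^o) *: (delta_mx 0 j : 'rV[R]_m)).
  by apply/funext => y; rewrite [LHS]row_sum_delta fct_sumE.
by apply: differentiable_sum => j; apply: differentiableZl.
Qed.

Lemma derive_sum_partials g x v : differentiable g x ->
  'D_v g x = \sum_(i < n) v 0 i * 'D_(delta_mx 0 i) g x.
Proof.
move=> dg; rewrite deriveE // {1}(row_sum_delta v) linear_sum.
by apply: eq_bigr => i _; rewrite linearZ deriveE.
Qed.

End SmoothOn.

(* Only the values of [cfun] on [cdom], and of [cinv] on the image of [cdom],
   are meaningful. *)
Record chart (R : realType) (n : nat) (T : topologicalType) := Chart {
  cdom : set T;
  cfun : T -> 'rV[R]_n;
  cinv : 'rV[R]_n -> T;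
  cdom_open : open cdom;
  cimg_open : open (cfun @` cdom);
  cfunK : forall p, cdom p -> cinv (cfun p) = p;
  cfun_continuous : forall p, cdom p -> {for p, continuous cfun};
  cinv_continuous : forall p, cdom p -> {for cfun p, continuous cinv} }.

Arguments cdom_open {R n T} c : rename.
Arguments cimg_open {R n T} c : rename.
Arguments cfunK {R n T} c [p] : rename.
Arguments cfun_continuous {R n T} c [p] : rename.
Arguments cinv_continuous {R n T} c [p] : rename.

Definition cimg R n (T : topologicalType) (c : chart R n T) : set 'rV[R]_n :=
  cfun c @` cdom c.

Lemma open_cimg R n (T : topologicalType) (c : chart R n T) : open (cimg c).
Proof. exact: cimg_open. Qed.

Arguments open_cimg {R n T} c.

Definition transition R n (T : topologicalType) (c c' : chart R n T) :
  'rV[R]_n -> 'rV[R]_n := cfun c' \o cinv c.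

Definition compatible R n (T : topologicalType) (c c' : chart R n T) :=
  smooth_map_on (cfun c @` (cdom c `&` cdom c')) (transition c c') /\
  smooth_map_on (cfun c' @` (cdom c `&` cdom c')) (transition c' c).

Record smoothManifold (R : realType) (n : nat) := SmoothManifold {
  mpoint :> topologicalType;
  atlas : set (chart R n mpoint);
  m_hausdorff : hausdorff_space mpoint;
  m_second_countable : @second_countable mpoint;
  atlas_cover : forall p : mpoint, exists2 c, atlas c & cdom c p;
  atlas_compatible : forall c c', atlas c -> atlas c' -> compatible c c';
  atlas_maximal : forall c,
    (forall c', atlas c' -> compatible c c') -> atlas c }.

Arguments atlas {R n} M : rename.

Section Manifold.
Variables (R : realType) (n : nat) (M : smoothManifold R n).
Local Notation chart := (chart R n M).
Implicit Types (c : chart) (p : M) (s : seq 'I_n).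

Definition chart_at p : chart := s2val (cid2 (atlas_cover p)).

Lemma chart_at_atlas p : atlas M (chart_at p).
Proof. exact: (s2valP (cid2 (atlas_cover p))). Qed.

Lemma chart_at_dom p : cdom (chart_at p) p.
Proof. exact: (s2valP' (cid2 (atlas_cover p))). Qed.

Definition rsmooth (g : M -> R) :=
  forall c, atlas M c -> smooth_on (cimg c) (fun x => g (cinv c x)).

(* [M -> R[i]^o] rather than [M -> R[i]], so that the pointwise [R[i]]-module
   structure is available. *)
Definition csmooth (f : M -> R[i]^o) :=
  forall c, atlas M c -> csmooth_on (cimg c) (fun x => f (cinv c x)).

Definition csmooth_pred : {pred M -> R[i]^o} := fun f => `[< csmooth f >].

Lemma csmooth_submod_closed : submod_closed csmooth_pred.
Proof.
split=> [|a f g /asboolP sf /asboolP sg]; apply/asboolP => c ac.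
  exact: (csmooth_on_cst (open_cimg c) 0).
have oc := open_cimg c; apply: (csmooth_onD oc _ (sg _ ac)).
exact: (csmooth_onM oc (csmooth_on_cst oc a) (sf _ ac)).
Qed.

HB.instance Definition _ :=
  GRing.isSubmodClosed.Build R[i] (M -> R[i]^o) csmooth_pred
    csmooth_submod_closed.

Record smoothfun := SmoothFun {
  smoothfun_fun :> M -> R[i]^o;
  _ : smoothfun_fun \in csmooth_pred }.

HB.instance Definition _ := [isSub for smoothfun_fun].
HB.instance Definition _ := [Choice of smoothfun by <:].
HB.instance Definition _ := [SubChoice_isSubLmodule of smoothfun by <:].

Lemma smoothfunP (f : smoothfun) : csmooth f.
Proof. exact/asboolP/(valP f). Qed.

(* The locally convex topology of uniform convergence of all derivatives on
   compact subsets of charts: it is generated by the following sets, i.e. by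
   the translates of the balls of the seminorms
   [h |-> sup_(x in K) |(d^s (h \o cinv c)) x|]. *)
Definition Cinf_ball (f : smoothfun) c (K : set 'rV[R]_n) s (e : R) :
  set smoothfun :=
  [set g | forall x, K x ->
    `|cpartials s (fun y => (g - f) (cinv c y)) x| < e%:C].

Definition Cinf_balls : set (set smoothfun) :=
  [set B | exists f c K s e, [/\ atlas M c, compact K, K `<=` cimg c,
     0 < e & B = Cinf_ball f c K s e]].

HB.instance Definition _ :=
  isSubBaseTopological.Build smoothfun Cinf_balls id.

(* A real vector field, given by its components in all charts. With the row
   vector convention of [jacobian], [v *m jacobian t x] is the image of [v] by
   the differential of [t] at [x]. *)
Record vectorField := VectorField {
  vf_coord : chart -> M -> 'rV[R]_n;
  vf_smooth : forall c, atlas M c ->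
    smooth_map_on (cimg c) (fun x => vf_coord c (cinv c x));
  vf_change : forall c c' p, atlas M c -> atlas M c' ->
    cdom c p -> cdom c' p ->
    vf_coord c' p = vf_coord c p *m jacobian (transition c c') (cfun c p) }.

(* A smooth complex-valued n-form, which reads
   [nf_coord c * dx_1 /\ ... /\ dx_n] in the chart [c]. *)
Record nform := NForm {
  nf_coord : chart -> M -> R[i];
  nf_smooth : forall c, atlas M c ->
    csmooth_on (cimg c) (fun x => nf_coord c (cinv c x));
  nf_change : forall c c' p, atlas M c -> atlas M c' ->
    cdom c p -> cdom c' p ->
    nf_coord c p =
      (\det (jacobian (transition c c') (cfun c p)))%:C * nf_coord c' p }.

Section ScaleForm.
Variables (f : smoothfun) (w : nform).

Let scale_coord c p : R[i] := f p * nf_coord w c p.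

Fact scale_smooth c : atlas M c ->
  csmooth_on (cimg c) (fun x => scale_coord c (cinv c x)).
Proof.
move=> ac.
exact: (csmooth_onM (open_cimg c) (smoothfunP f ac) (nf_smooth w ac)).
Qed.

Fact scale_change c c' p : atlas M c -> atlas M c' -> cdom c p -> cdom c' p ->
  scale_coord c p =
    (\det (jacobian (transition c c') (cfun c p)))%:C * scale_coord c' p.
Proof.
by move=> ac ac' cp c'p; rewrite /scale_coord (nf_change w ac ac') // mulrCA.
Qed.

Definition nf_scale := NForm scale_smooth scale_change.

End ScaleForm.

(* An orientation: a covering family of charts with positive transition
   Jacobians. *)
Record orientation := Orientation {
  ocharts : set chart;
  ocharts_atlas : ocharts `<=` atlas M;
  ocharts_cover : forall p, exists2 c, ocharts c & cdom c p;
  ocharts_pos : forall c c' p, ocharts c -> ocharts c' ->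
    cdom c p -> cdom c' p ->
    0 < \det (jacobian (transition c c') (cfun c p)) }.

(* Finite partitions of unity, sufficient on compact manifolds. *)
Record partitionOfUnity (O : orientation) := PartitionOfUnity {
  pu_size : nat;
  pu_chart : 'I_pu_size -> chart;
  pu_fun : 'I_pu_size -> M -> R;
  pu_chartP : forall k, ocharts O (pu_chart k);
  pu_smooth : forall k, rsmooth (pu_fun k);
  pu_ge0 : forall k p, 0 <= pu_fun k p;
  pu_supp : forall k, closure [set p | pu_fun k p != 0] `<=` cdom (pu_chart k);
  pu_sum : forall p, \sum_(k < pu_size) pu_fun k p = 1 }.

End Manifold.

Arguments pu_chart {R n M O} P k : rename.
Arguments pu_fun {R n M O} P k p : rename.

(* Lebesgue integral over R^n, as an iterated integral; it is only applied to
   continuous functions with compact support. *)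
Fixpoint integral_rV (R : realType) (n : nat) : ('rV[R]_n -> R) -> R :=
  if n is n'.+1 then
    fun g => \int[lebesgue_measure]_t
      integral_rV (fun x : 'rV[R]_n' => g (row_mx (t%:M : 'rV[R]_1) x))
  else fun g => g 0.

Section Integral.
Variables (R : realType) (n : nat) (M : smoothManifold R n).
Implicit Types (O : orientation M) (w : nform M).

(* The integral of [h dx_1 ... dx_n] over the image of the chart [c]. *)
Definition chart_integral (c : chart R n M) (h : M -> R[i]) : R[i] :=
  let hx (x : 'rV[R]_n) := if x \in cimg c then h (cinv c x) else 0 in
  integral_rV (fun x => Re (hx x)) +i* integral_rV (fun x => Im (hx x)).

Definition pu_integral O (P : partitionOfUnity O) w : R[i] :=
  \sum_(k < pu_size P) chart_integral (pu_chart P k)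
    (fun p => (pu_fun P k p)%:C * nf_coord w (pu_chart P k) p).

(* The integral of an n-form over the compact oriented manifold [M], computed
   with a partition of unity, on which it does not depend. *)
Definition nf_integral O w : R[i] :=
  xget 0 [set v | exists P : partitionOfUnity O, v = pu_integral P w].

End Integral.

Section LieDerivative.
Variables (R : realType) (n : nat) (M : smoothManifold R n).
Variable X : vectorField M.
Implicit Types (c : chart R n M) (f : smoothfun M) (U : smoothfun M -> R[i]).

(* Directional derivative at [p] along [X p], read in the chart [c]. *)
Definition lie_in c (g : M -> R) (p : M) : R :=
  'D_(vf_coord X c p) (fun x => g (cinv c x)) (cfun c p).

Definition lie_fun f : M -> R[i]^o := fun p =>
  lie_in (chart_at p) (fun q => Re (f q)) p +i*
  lie_in (chart_at p) (fun q => Im (f q)) p.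

Lemma transition_differentiable c c' p : atlas M c -> atlas M c' ->
  cdom c p -> cdom c' p -> differentiable (transition c c') (cfun c p).
Proof.
move=> ac ac' cp c'p; apply: differentiable_rV => j.
have [+ _] := atlas_compatible ac ac'.
by move=> /(_ j [::]); apply; exists p.
Qed.

Lemma lie_in_chart c c' (g : M -> R) p : rsmooth g ->
  atlas M c -> atlas M c' -> cdom c p -> cdom c' p ->
  lie_in c g p = lie_in c' g p.
Proof.
move=> sg ac ac' cp c'p; rewrite /lie_in.
have dt := transition_differentiable ac ac' cp c'p.
have tp : transition c c' (cfun c p) = cfun c' p.
  by rewrite /transition /= cfunK.
have dg' : differentiable (fun x => g (cinv c' x)) (transition c c' (cfun c p)).
  by rewrite tp; apply: (sg _ ac' [::]); exists p.
have ggE : \forall y \near cfun c p, g (cinv c y) =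
    ((fun x => g (cinv c' x)) \o transition c c') y.
  have c'n : nbhs (cinv c (cfun c p)) (cdom c').
    rewrite cfunK //; apply: open_nbhs_nbhs; split=> //; exact: cdom_open.
  have : \forall y \near cfun c p, cdom c' (cinv c y).
    exact: (cinv_continuous c cp _ c'n).
  by apply: filterS => y c'y; rewrite /transition /= cfunK.
rewrite (near_eq_derive _ ggE) deriveE; last exact: differentiable_comp.
rewrite diff_comp //= tp deriveE -?tp // (vf_change X ac ac' cp c'p).
by rewrite /jacobian mul_rV_lin1.
Qed.

Lemma smooth_on_lie (g : M -> R) c : rsmooth g -> atlas M c ->
  smooth_on (cimg c) (fun x => lie_in (chart_at (cinv c x)) g (cinv c x)).
Proof.
move=> sg ac; have oc := open_cimg c.
have sS : smooth_on (cimg c) (fun x => \sum_(i < n)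
    vf_coord X c (cinv c x) 0 i *
    'D_(delta_mx 0 i) (fun y => g (cinv c y)) x).
  apply: smooth_on_sum => // i; apply: smooth_onM => //.
    exact: (vf_smooth X ac).
  exact: smooth_on_derive (sg c ac).
apply: smooth_on_eq sS => // _ [p cp <-]; rewrite cfunK //.
rewrite (lie_in_chart sg (chart_at_atlas p) ac (chart_at_dom p) cp).
rewrite /lie_in derive_sum_partials //.
by apply: (sg c ac [::]); exists p.
Qed.

Lemma csmooth_lie f : lie_fun f \in @csmooth_pred R n M.
Proof.
apply/asboolP => c ac; split; apply: smooth_on_lie => // c' ac'.
  by have [] := smoothfunP f ac'.
by have [] := smoothfunP f ac'.
Qed.

Definition lie f : smoothfun M := SmoothFun (csmooth_lie f).

Definition lie_dual U : smoothfun M -> R[i] := fun f => - U (lie f).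

(* [U] is the functional [f |-> \int_M f w] of some smooth n-form [w]. *)
Definition is_nform (O : orientation M) U :=
  exists w : nform M, forall f, U f = nf_integral O (nf_scale f w).

(* The distributions are the continuous linear functionals [U]. *)
Definition globally_hypoelliptic (O : orientation M) :=
  forall U : {linear smoothfun M -> R[i]^o}, continuous U ->
    is_nform O (lie_dual U) -> is_nform O U.

Definition Cinf_stable := closed (range lie).

Definition Cinf_cohomology_free :=
  forall f : smoothfun M, exists (c : R[i]) (u : smoothfun M),
    forall p, lie u p = f p - c.

End LieDerivative.

(* Main.v *)
(* A maximum of [u] is a zero of [Xu], so by the Hahn-Banach theorem [X] has an
   invariant functional [mu], which is given by a smooth density by global
   hypoellipticity. If the density vanished somewhere, the boundary of its zero
   set would carry an invariant functional as well, again with a smooth density;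
   as this boundary has no interior, that density would be zero. So [mu] has a
   positive density, and global hypoellipticity says that a continuous
   functional [l] with [l (Xv) = - mu (h v)] for a smooth [h] is [mu (u .)] for
   a smooth [u].
   A gliding hump argument draws compactness from this: smooth functions [G]
   bounded by [1] and with [XG] bounded in C^oo are equi-Lipschitz at each
   point, as otherwise some series [\sum_j a_j G_j] with [|a_j| = 3^-j] would
   fail to be Lipschitz, whereas [u = \sum_j a_j G_j] for
   [l = \sum_j a_j mu (G_j .)].
   It follows that only the constants are killed by [X], and that
   [|mu (f g)| <= C ||Xg||_k] for some [C] and [k] when [mu f = 0]: for
   normalized counterexamples [G_k] with [mu G_k = 0], a limit of the
   functionals [mu (G_k .)] is [mu (u .)] with [Xu = 0], hence zero, which is
   incompatible with equicontinuity. Finally, by the Hahn-Banach theorem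
   [Xg |-> - mu (f g)] extends to a continuous functional [mu (u .)], and
   [Xu = f]. *)

From HB Require Import structures.
From mathcomp Require Import all_boot all_order all_algebra.
From mathcomp Require Import all_classical all_reals all_analysis.
From mathcomp Require Import complex.
From mathcomp Require Import perm measurable_realfun ring lra.
Require Import Defs.

Set Implicit Arguments.
Unset Strict Implicit.
Unset Printing Implicit Defensive.

Import Order.TTheory GRing.Theory Num.Theory.
Import numFieldNormedType.Exports.

Local Open Scope classical_set_scope.
Local Open Scope ring_scope.

(** * Continuous functions with compact support on the line *)

(** The usual way from hypoellipticity to estimates is the closed graph theorem on Frechet spaces;
    the gliding hump takes its place. Its ratios are coupled: coefficients [3^-j] against quotients
    of size [4^j] leave [(4/3)^j], and the tail of the series, half of the term before it, stays
    below that term even after the loss [4/3] of an almost maximizer. Positivity of the invariant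
    density turns forms into functions: the real part of any smooth n-form is a smooth multiple of
    it, so hypoellipticity becomes a statement on pairings [mu (u .)], and integrals leave the
    argument. Before that, a change of variables is needed to localize integrals in one chart and to
    read invariance as a divergence equation. Two standard tools are bypassed. No flow is
    integrated: a segment in a chart has the right first derivative, enough for maximum arguments.
    No partition of unity is constructed: without one the integral takes its default value [0],
    which a functional with value [1] on the constant [1] excludes. Functionals are real, for the
    sake of order and Hahn-Banach, and complexified to invoke the hypothesis. *)

Section CompactlySupported.
Variable R : realType.

(** Bounded support stands for compact support: a bound on the norm passes to slices and to
    compositions with linear isomorphisms without any topology. *)
Definition cc (V : normedModType R) (g : V -> R) :=
  continuous g /\ exists B, forall x, B < `|x| -> g x = 0.

Lemma cc_ccD (V : normedModType R) (g h : V -> R) :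
  cc g -> cc h -> cc (fun x => g x + h x).
Proof.
move=> [cg [B gB]] [ch [C hC]]; split; first by move=> x; exact: (cvgD (cg x) (ch x)).
exists (Num.max B C) => x; rewrite gt_max => /andP[xB xC].
by rewrite gB // hC // addr0.
Qed.

Lemma cc_Ml (V : normedModType R) (g h : V -> R) :
  continuous g -> cc h -> cc (fun x => g x * h x).
Proof.
move=> cg [ch [C hC]]; split; first by move=> x; exact: (cvgM (cg x) (ch x)).
by exists C => x xC; rewrite hC // mulr0.
Qed.

Lemma cc_Mr (V : normedModType R) (g h : V -> R) :
  cc g -> continuous h -> cc (fun x => g x * h x).
Proof.
move=> cg ch; rewrite (_ : (fun x => _) = (fun x => h x * g x)).
  exact: cc_Ml.
by apply/funext => x; rewrite mulrC.
Qed.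

Lemma cc_Z (V : normedModType R) c (g : V -> R) :
  cc g -> cc (fun x => c * g x).
Proof. by apply: cc_Ml => x; exact: cvg_cst. Qed.

Lemma cc_B (V : normedModType R) (g h : V -> R) :
  cc g -> cc h -> cc (fun x => g x - h x).
Proof.
move=> cg ch; rewrite (_ : (fun x => _) = (fun x => g x + -1 * h x)).
  by apply: cc_ccD => //; exact: cc_Z.
by apply/funext => x; rewrite mulN1r.
Qed.

Lemma cc_0 (V : normedModType R) : cc (fun _ : V => 0 : R).
Proof. by split=> [x|]; [exact: cvg_cst | exists 0]. Qed.

Lemma cc_sum (V : normedModType R) (I : Type) (r : seq I) (g : I -> V -> R) :
  (forall i, cc (g i)) -> cc (fun x => \sum_(i <- r) g i x).
Proof.
move=> cg; elim: r => [|i r IH].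
  rewrite (_ : (fun x => _) = fun=> 0); first exact: cc_0.
  by apply/funext => x; rewrite big_nil.
rewrite (_ : (fun x => _) = fun x => g i x + \sum_(j <- r) g j x).
  exact: cc_ccD.
by apply/funext => x; rewrite big_cons.
Qed.

Lemma cc_norm (V : normedModType R) (g : V -> R) : cc g -> cc (fun x => `|g x|).
Proof.
move=> [cg [B gB]]; split=> [x|]; first by apply: cvg_norm; exact: cg.
by exists B => x xB; rewrite gB // normr0.
Qed.

Local Notation mu := (@lebesgue_measure R).

Lemma cc_itv (g : R -> R) B : (forall x, B < `|x| -> g x = 0) ->
  \int[mu]_t g t = \int[mu]_(t in `[- B, B]) g t.
Proof.
move=> gB; rewrite Rintegral_mkcond [RHS]Rintegral_mkcond; congr Rintegral.
apply/funext => t; rewrite /patch /= in_setT.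
case: ifPn => //; rewrite notin_setE /= in_itv /= -ler_norml => /negP.
by rewrite -ltNge => /gB.
Qed.

Lemma cc_integrable (g : R -> R) : cc g -> mu.-integrable setT (EFin \o g).
Proof.
move=> [cg [B gB]].
have I1 : mu.-integrable `[- B, B] (EFin \o g).
  apply: continuous_compact_integrable; first exact: segment_compact.
  exact: continuous_subspaceT.
have := I1; rewrite integrable_mkcond; last exact: measurable_itv.
apply: eq_integrable => //= x _.
rewrite /patch; case: ifPn => //; rewrite notin_setE /= in_itv /= -ler_norml.
by move=> /negP; rewrite -ltNge => /gB ->.
Qed.

Lemma Rint_ccD (g h : R -> R) : cc g -> cc h ->
  \int[mu]_t (g t + h t) = \int[mu]_t g t + \int[mu]_t h t.
Proof. by move=> cg ch; apply: RintegralD => //; exact: cc_integrable. Qed.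

Lemma Rint_ccZ c (g : R -> R) : cc g ->
  \int[mu]_t (c * g t) = c * \int[mu]_t g t.
Proof. by move=> cg; apply: RintegralZl => //; exact: cc_integrable. Qed.

Lemma Rint_bound (g : R -> R) B e : continuous g ->
  0 <= B -> (forall x, B < `|x| -> g x = 0) ->
  (forall x, `|g x| <= e) -> `|\int[mu]_t g t| <= e * (2 * B).
Proof.
move=> cg B0 gB ge.
have I1 : mu.-integrable `[- B, B] (EFin \o g).
  apply: continuous_compact_integrable; first exact: segment_compact.
  exact: continuous_subspaceT.
rewrite (cc_itv gB).
apply: le_trans (le_normr_Rintegral _ I1) _ => //.
apply: (@le_trans _ _ (\int[mu]_(t in `[- B, B]) e)).
  apply: le_Rintegral => //; first exact: (integrable_norm I1).
  apply: continuous_compact_integrable; first exact: segment_compact.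
  by apply: continuous_subspaceT => x; exact: cvg_cst.
rewrite Rintegral_cst //= lebesgue_measure_itv /= lte_fin.
case: ltP => [_|B0'] /=; first by rewrite opprK; lra.
by rewrite mulr0 mulr_ge0 //; [exact: le_trans (ge 0) | lra].
Qed.

End CompactlySupported.

(** * Uniform continuity and integrals depending on a parameter *)

Section UniformContinuity.
Variable R : realType.

Lemma unif_on_compact (V W : normedModType R) (K : set V) (g : V -> W) e :
  compact K -> (forall x, K x -> {for x, continuous g}) -> 0 < e ->
  exists2 d, 0 < d & forall x y, K x -> `|x - y| < d -> `|g x - g y| < e.
Proof.
move=> /compact_near_coveringP cK cg e0.
pose P (d : R) x := forall y, `|x - y| < d -> `|g x - g y| < e.
have : \forall d \near 0^'+, forall x, K x -> P d x.
  apply: cK => x Kx.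
  have /cvgrPdist_lt /(_ (e / 2)) := cg x Kx.
  rewrite divr_gt0 // => /(_ isT) /nbhs_ballP[r r0 rP].
  exists (ball x (r / 2), [set d | d < r / 2]).
    split; first by apply: nbhsx_ballx; rewrite divr_gt0.
    by apply: nbhs_right_lt; rewrite divr_gt0.
  move=> [x' d] [/= + dr] y x'y; rewrite -!ball_normE /= in rP * => xx'.
  have x'r : `|x - x'| < r by have := normr_ge0 (x - x'); lra.
  have yr : `|x - y| < r by have := ler_distD x' x y; lra.
  have gx' := rP _ x'r; have gy := rP _ yr.
  by have := ler_distD (g x) (g x') (g y); rewrite [`|g x' - g x|]distrC; lra.
move=> dP; near (0 : R)^'+ => d.
exists d => // x y Kx; move: x Kx y.
by near: d.
Unshelve. all: by end_near. Qed.

(** The Heine-Borel property. It is kept abstract because inductions on the dimension enlarge the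
    parameter space from [V] to [V * R], and products preserve it. *)
Definition proper (V : normedModType R) :=
  forall B, compact [set x : V | `|x| <= B].

Lemma proper_R : proper R.
Proof.
move=> B; have -> : [set x : R | `|x| <= B] = `[- B, B]%classic.
  by apply/funext => x; rewrite /= in_itv /= ler_norml.
exact: segment_compact.
Qed.

Lemma proper_rV n : proper 'rV[R]_n.
Proof.
move=> B; apply: bounded_closed_compact.
  exists B; split; first exact: num_real.
  by move=> M BM x /= xB; apply: le_trans xB (ltW BM).
apply: (@preimage_closed _ _ (fun x : 'rV[R]_n => `|x|) [set r | r <= B]).
  by move=> x _; exact: norm_continuous.
exact: closed_le.
Qed.

Lemma proper_prod (V W : normedModType R) :
  proper V -> proper W -> proper (V * W)%type.
Proof.
move=> pV pW B; have -> : [set x : V * W | `|x| <= B] =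
    [set x | `|x| <= B] `*` [set x | `|x| <= B].
  by apply/seteqP; split=> -[x y]; rewrite /= prod_normE /= ge_max => /andP.
exact: compact_setX.
Qed.

Lemma cc_unif (V : normedModType R) (g : V -> R) e : proper V -> cc g ->
  0 < e -> exists2 d, 0 < d & forall x y, `|x - y| < d -> `|g x - g y| < e.
Proof.
move=> pV [cg [B gB]] e0.
(* The margin [1] matches the cap on the distance: when [|x| > B + 1] both points lie outside the
   support. *)
have [d d0 dP] := unif_on_compact (pV (B + 1)) (fun x _ => cg x) e0.
exists (Num.min d 1); first by rewrite lt_min d0 /=.
move=> x y; rewrite lt_min => /andP[xyd xy1].
have [xB|xB] := leP `|x| (B + 1); first exact: dP.
rewrite !gB ?subrr ?normr0 //; last by lra.
by have := ler_distD y x 0; rewrite !subr0; lra.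
Qed.

(** The growth condition is a quantitative properness of [phi]: preimages of bounded sets are
    bounded, hence so is the support of the composite. *)
Lemma cc_comp (V W : normedModType R) (g : W -> R) (phi : V -> W) C D :
  cc g -> continuous phi -> (forall x, `|x| <= C + D * `|phi x|) -> 0 <= D ->
  cc (fun x => g (phi x)).
Proof.
move=> [cg [B gB]] cphi phiP D0; split.
  by move=> x; exact: (continuous_comp (cphi x) (cg (phi x))).
exists (C + D * B) => x xB; apply: gB; rewrite ltNge; apply/negP => phiB.
have := phiP x; rewrite leNgt => /negP; apply; apply: le_lt_trans xB.
by rewrite lerD2l ler_wpM2l.
Qed.

Lemma cc_slice (V W : normedModType R) (g : V * W -> R) x : cc g ->
  cc (fun y => g (x, y)).
Proof.
move=> cg; apply: (@cc_comp _ _ g (fun y => (x, y)) 0 1) => // [y|y].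
  exact: (cvg_pair (cvg_cst x) cvg_id).
by rewrite add0r mul1r prod_normE /= le_max lexx orbT.
Qed.

Lemma cc_slice2 (V W : normedModType R) (g : V * W -> R) y : cc g ->
  cc (fun x => g (x, y)).
Proof.
move=> cg; apply: (@cc_comp _ _ g (fun x => (x, y)) 0 1) => // [x|x].
  exact: (cvg_pair cvg_id (cvg_cst y)).
by rewrite add0r mul1r prod_normE /= le_max lexx.
Qed.

(** Uniform continuity replaces dominated convergence: two nearby slices differ by at most
    [e / (4 * B)] on an interval of length [2 * B], off which both vanish. *)
Lemma Rint_cc (V : normedModType R) (f : V * R -> R) : proper V -> cc f ->
  cc (fun x => \int[@lebesgue_measure R]_t f (x, t)).
Proof.
move=> pV cf; have [_ [B0 fB0]] := cf.
pose B := `|B0| + 1.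
have B_gt0 : 0 < B by rewrite /B; have := normr_ge0 B0; lra.
have fB z : B < `|z| -> f z = 0.
  by move=> Bz; apply: fB0; have := ler_norm B0; rewrite /B in Bz; lra.
split; last first.
  exists B => x xB; rewrite (_ : (fun t => _) = cst 0).
    by rewrite Rintegral_cst //= mul0r.
  by apply/funext => t; rewrite fB // prod_normE /= lt_max xB.
move=> x; apply/cvgrPdist_lt => e e0.
have e1 : 0 < e / (4 * B) by rewrite divr_gt0 // mulr_gt0.
have [d d0 dP] := cc_unif (proper_prod pV proper_R) cf e1.
apply/nbhs_ballP; exists d => //= y; rewrite -ball_normE /= => xy.
have cx z : cc (fun t => f (z, t)) by exact: cc_slice.
rewrite -RintegralB; [| by [] | exact: (cc_integrable (cx _)) | exact: (cc_integrable
  (cx _))].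
have [cB _] := cc_B (cx x) (cx y).
apply: (@le_lt_trans _ _ (e / (4 * B) * (2 * B))).
  apply: (Rint_bound cB) => [|t tB|t]; first exact: ltW.
    by rewrite !fB ?subrr // prod_normE /= lt_max tB orbT.
  apply: ltW; apply: dP; rewrite prod_normE /= subrr normr0 gt_max xy /=.
  exact: d0.
rewrite (_ : e / (4 * B) * (2 * B) = e / 2); first by lra.
by field; rewrite gt_eqF.
Qed.

End UniformContinuity.

(** * Affine substitution, Fubini's theorem and positivity on the line *)

Section OneDimensional.
Variable R : realType.
Local Notation mu := (@lebesgue_measure R).

Lemma Rint_itv (g : R -> R) x y : (forall t, ~~ (t \in `[x, y]) -> g t = 0) ->
  \int[mu]_t g t = \int[mu]_(t in `[x, y]) g t.
Proof.
move=> g0; rewrite Rintegral_mkcond [RHS]Rintegral_mkcond; congr Rintegral.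
apply/funext => t; rewrite /patch /= in_setT.
case: ifPn => //; rewrite notin_setE /= => /negP tx; exact: g0.
Qed.

Lemma is_derive_affine (a b z : R) : is_derive z 1 (fun t : R => a * t + b) a.
Proof.
have := is_deriveD (is_deriveZ a (is_derive_id z (1 : R))) (is_derive_cst b z 1).
by rewrite addr0 [_ *: _]mulr1.
Qed.

Lemma affine_derive1 (a b : R) : derive1 (fun t : R => a * t + b) = cst a.
Proof.
apply/funext => z; rewrite derive1E; exact: (@derive_val _ _ _ _ _ _ _
  (is_derive_affine a b z)).
Qed.

Lemma Rint_affine (g : R -> R) (a b : R) : cc g -> 0 < a ->
  \int[mu]_t g t = a * \int[mu]_t g (a * t + b).
Proof.
move=> [cg [B0 gB0]] a0.
pose B := `|B0| + 1.
have gB x : B <= `|x| -> g x = 0.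
  by move=> Bx; apply: gB0; apply: lt_le_trans Bx; have := ler_norm B0; rewrite /B; lra.
have B1 : 0 < B by rewrite /B; have := normr_ge0 B0; lra.
pose F t := a * t + b.
(* The preimages of [- B] and [B]: the substitution takes place on segments, off which both
   integrands vanish. *)
pose x := (- B - b) / a; pose y := (B - b) / a.
have Fx : F x = - B by rewrite /F /x mulrCA divff ?gt_eqF // mulr1; lra.
have Fy : F y = B by rewrite /F /y mulrCA divff ?gt_eqF // mulr1; lra.
have xy : x <= y by rewrite /x /y ler_pM2r ?invr_gt0 //; lra.
have cF : continuous F.
  move=> t; apply: continuousD; last exact: cvg_cst.
  by apply: continuousM; [exact: cvg_cst | exact: cvg_id].
have cgF : continuous (g \o F).
  by move=> t; apply: continuous_comp; [exact: cF | exact: cg].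
have homF : {homo F : u v / u < v} by move=> u v uv; rewrite /F ltrD2r ltr_pM2l.
rewrite (@Rint_itv g (F x) (F y)); last first.
  by move=> t; rewrite Fx Fy in_itv /= -ler_norml -ltNge => /ltW /gB.
rewrite (@Rint_itv (g \o F) x y); last first.
  move=> t tx; apply: gB.
  have /negP : ~~ (- B < F t < B).
    apply: contra tx => /andP[]; rewrite -Fx -Fy in_itv /= /F.
    by rewrite !ltrD2r !ltr_pM2l // => /ltW -> /ltW ->.
  by rewrite -ltr_norml => /negP; rewrite -leNgt.
have I1 : mu.-integrable `[x, y] (EFin \o (g \o F)).
  apply: continuous_compact_integrable; first exact: segment_compact.
  exact: continuous_subspaceT.
rewrite -RintegralZl //; congr fine.
rewrite (@integration_by_substitution_increasing R F g x y xy).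
- by apply: eq_integral => t _; rewrite /= !fctE affine_derive1 /= mulrC.
- by move=> u v _ _; exact: homF.
- by rewrite affine_derive1 => t _; exact: cvg_cst.
- by rewrite affine_derive1; exact: is_cvg_cst.
- by rewrite affine_derive1; exact: is_cvg_cst.
- split.
  + by move=> t _; exact: (@ex_derive _ _ _ _ _ _ _ (is_derive_affine a b t)).
  + by apply: cvg_at_right_filter; exact: cF.
  + by apply: cvg_at_left_filter; exact: cF.
- exact: continuous_subspaceT.
Qed.

Lemma Rint_opp (g : R -> R) : cc g -> \int[mu]_t g t = \int[mu]_t g (- t).
Proof.
move=> [cg [B gB]].
have gB' x : `|B| < `|x| -> g x = 0.
  by move=> Bx; apply: gB; apply: le_lt_trans Bx; exact: ler_norm.
rewrite (cc_itv gB') (@cc_itv _ (fun t => g (- t)) `|B|); last first.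
  by move=> x Bx; apply: gB'; rewrite normrN.
congr fine; rewrite -[X in `[_, X]]opprK integration_by_substitution_oppr ?opprK //.
  by rewrite ge0_cp.
exact: continuous_subspaceT.
Qed.

Lemma Rint_scale (g : R -> R) (a b : R) : cc g -> a != 0 ->
  `|a| * \int[mu]_t g (a * t + b) = \int[mu]_t g t.
Proof.
move=> cg; rewrite neq_lt => /orP[a0|a0]; last first.
  by rewrite gtr0_norm // (Rint_affine b cg a0).
rewrite ltr0_norm // (Rint_opp cg).
have cg' : cc (fun t => g (- t)).
  move: cg => [cg [B gB]]; split.
    by move=> t; apply: continuous_comp; [exact: opp_continuous | exact: cg].
  by exists B => x Bx; apply: gB; rewrite normrN.
rewrite (@Rint_affine _ (- a) (- b) cg'); last by rewrite oppr_gt0.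
by congr *%R; congr Rintegral; apply/funext => t; congr g; ring.
Qed.

(** The product sigma-algebra is generated by rectangles, so an open set is exhibited as a countable
    union of boxes with rational centres and radii [1/(m+1)]. *)
Lemma open_measurable2 (U : set (R * R)) : open U ->
  measurable (U : set (measurableTypeR R * measurableTypeR R)).
Proof.
move=> oU.
pose B (q : rat * rat * nat) : set (measurableTypeR R * measurableTypeR R) :=
  ball (ratr q.1.1 : R) q.2.+1%:R^-1 `*` ball (ratr q.1.2 : R) q.2.+1%:R^-1.
rewrite (_ : U = \bigcup_(q in [set q | B q `<=` U]) B q).
  rewrite bigcup_mkcond; apply: countable_bigcupT_measurable.
    exact: countableP.
  move=> q; case: ifP => _; last exact: measurable0.
  by apply: measurableX; apply: open_measurable; exact: ball_open.
apply/seteqP; split => [[x y] Uxy|z [q /=]]; last by apply.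
have /nbhs_ballP[e e0 eU] : nbhs (x, y) U by exact: open_nbhs_nbhs.
have [m me] : exists m : nat, m.+1%:R^-1 < e / 2.
  by have [m _ me] := near_infty_natSinv_lt (PosNum (divr_gt0 e0 (@ltr0n R 2)));
    exists m; exact: (me m (leqnn m)).
pose d m : R := m.+1%:R^-1.
have m0 : 0 < d m by rewrite invr_gt0.
rewrite -[m.+1%:R^-1]/(d m) in me.
have [q] : exists q : rat, ratr q \in `](x - d m), (x + d m)[.
  by apply: rat_in_itvoo; lra.
have [r] : exists r : rat, ratr r \in `](y - d m), (y + d m)[.
  by apply: rat_in_itvoo; lra.
rewrite !in_itv /= => /andP[r1 r2] /andP[q1 q2].
have qx : `|x - ratr q| < d m by rewrite ltr_norml; apply/andP; split; lra.
have ry : `|y - ratr r| < d m by rewrite ltr_norml; apply/andP; split; lra.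
have tri (a b c : R) : `|a - b| < d m -> `|b - c| < d m -> `|a - c| < e.
  by move=> ab bc; apply: le_lt_trans (ler_distD b a c) _; lra.
exists ((q, r), m) => /=.
  by move=> [x' y'] [/= qx' ry']; apply: eU; split; [exact: tri qx qx' | exact: tri ry ry'].
by split; rewrite /= /ball /= distrC.
Qed.

Lemma continuous_measurable2 (f : R * R -> R) : continuous f ->
  measurable_fun setT (f : measurableTypeR R * measurableTypeR R -> measurableTypeR R).
Proof.
move=> /continuousP cf; apply: (measurability _ (RGenOpens.measurableE R)).
move=> _ [_ [a [b ->] <-]]; rewrite setTI; apply: open_measurable2.
exact/cf/interval_open.
Qed.

Lemma Rint_fubini (f : R * R -> R) : cc f ->
  \int[mu]_x \int[mu]_y f (x, y) = \int[mu]_y \int[mu]_x f (x, y).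
Proof.
move=> cf; have [/continuous_measurable2 mf _] := cf.
pose F (z : measurableTypeR R * measurableTypeR R) : \bar R := (f z)%:E.
have mF : measurable_fun setT F by exact/measurable_EFinP.
have finE (g : R -> R) : cc g -> (\int[mu]_y (g y)%:E = (\int[mu]_y g y)%R%:E)%E.
  move=> cg; rewrite /Rintegral fineK //; apply: integrable_fin_num => //.
  exact: cc_integrable.
have E1 x : (\int[mu]_y (f (x, y))%:E = (\int[mu]_y f (x, y))%R%:E)%E.
  by apply: finE; exact: cc_slice.
have E2 y : (\int[mu]_x (f (x, y))%:E = (\int[mu]_x f (x, y))%R%:E)%E.
  by apply: finE; exact: cc_slice2.
(* Tonelli's criterion: the inner integrals of [|f|] form again a [cc] function, whose integral is
   finite. *)
have IF : (mu \x mu)%E.-integrable setT F.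
  apply: (iffRL (@integrable12ltyP _ _ _ _ R mu mu F mF)).
  have GE x : (\int[mu]_y `|F (x, y)| = (\int[mu]_y `|f (x, y)|)%R%:E)%E.
    by apply: finE; apply: cc_norm; exact: cc_slice.
  under eq_integral do rewrite GE.
  by have := integrable_lty measurableT (cc_integrable (Rint_cc (@proper_R R) (cc_norm
    cf))); apply.
have := Fubini IF; rewrite /F /=.
under eq_integral do rewrite E1.
under [X in _ = X -> _]eq_integral do rewrite E2.
by rewrite /Rintegral => ->.
Qed.

Lemma Rint_gt0 (g : R -> R) x : cc g -> (forall t, 0 <= g t) -> 0 < g x ->
  0 < \int[mu]_t g t.
Proof.
move=> cg g0 gx.
have : \forall t \near x, g x / 2 < g t.
  have [cg1 _] := cg; have /cvgr_gt := cg1 x; apply.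
  by rewrite ltr_pdivrMr // ltr_pMr // ltr1n.
move=> /nbhs_ballP[r /= r0 rP].
have d0 : 0 < r / 2 by rewrite divr_gt0.
pose D := `[x - r / 2, x + r / 2]%classic.
pose c := g x / 2.
have finE : (\int[mu]_y (g y)%:E = (\int[mu]_y g y)%R%:E)%E.
  by rewrite /Rintegral fineK //; apply: integrable_fin_num => //; exact: cc_integrable.
rewrite -lte_fin -finE.
have mg : measurable_fun setT (EFin \o g).
  by apply/measurable_EFinP; apply: continuous_measurable_fun; have [] := cg.
apply: (@lt_le_trans _ _ (\int[mu]_(t in D) c%:E)%E).
  rewrite /D integral_cst //= lebesgue_measure_itv /= lte_fin.
  rewrite ifT; last by lra.
  by rewrite -EFinD -EFinM lte_fin; apply: mulr_gt0; [rewrite /c divr_gt0|lra].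
apply: (@le_trans _ _ (\int[mu]_(t in D) (g t)%:E)%E).
  have mD : measurable (D : set (measurableTypeR R)) by exact: measurable_itv.
  apply: ge0_le_integral => //=.
  - by move=> t _; rewrite lee_fin ltW // /c divr_gt0.
  - exact: measurable_funTS.
  - move=> t; rewrite /D /= in_itv /= => /andP[t1 t2]; rewrite lee_fin ltW //; apply: rP.
    by rewrite -ball_normE /= ltr_norml; apply/andP; split; lra.
apply: ge0_subset_integral => //=; first exact: measurable_itv.
by move=> t _; rewrite lee_fin.
Qed.

End OneDimensional.

(** * The iterated integral on R^n *)

Section RowVectorIntegral.
Variable R : realType.
Local Notation mu := (@lebesgue_measure R).
Local Notation I := (@integral_rV R).

Lemma rV_norm_le n (x : 'rV[R]_n) e : 0 <= e ->
  (`|x| <= e) = [forall j, `|x 0 j| <= e].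
Proof.
move=> e0; rewrite [`|x|]mx_normrE; apply/bigmax_leP/forallP => [[_ h] j|h].
  exact: (h (0, j)).
by split=> // -[i j] _ /=; rewrite (ord1 i).
Qed.

Lemma rV_coord_le n (x : 'rV[R]_n) j : `|x 0 j| <= `|x|.
Proof.
by have := rV_norm_le x (normr_ge0 x); rewrite lexx => /esym /forallP.
Qed.

(** The coordinates as [integral_rV] peels them off. For the sup norms this is an isometry, so
    continuity and bounded support transfer at once. *)
Definition emb n (z : R * 'rV[R]_n) : 'rV[R]_n.+1 :=
  row_mx (z.1%:M : 'rV_1) z.2.

Lemma emb_lshift n (z : R * 'rV[R]_n) : emb z 0 ord0 = z.1.
Proof.
have E : (z.1%:M : 'M[R]_1) 0 0 = z.1 by rewrite mxE.
rewrite -[RHS]E -(row_mxEl (z.1%:M : 'rV_1) z.2).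
by congr (row_mx _ _ _ _); exact/val_inj.
Qed.

Lemma emb_lift n (z : R * 'rV[R]_n) j : emb z 0 (lift ord0 j) = z.2 0 j.
Proof.
rewrite -(row_mxEr (z.1%:M : 'rV_1) z.2).
by congr (row_mx _ _ _ _); exact/val_inj.
Qed.

Lemma emb_sub n (z w : R * 'rV[R]_n) : emb z - emb w = emb (z - w).
Proof.
apply/rowP => j; rewrite [LHS]mxE [(- emb w) _ _]mxE.
by case: (unliftP ord0 j) => [i|] ->; rewrite ?emb_lift ?emb_lshift // !mxE.
Qed.

Lemma emb_surj n (x : 'rV[R]_n.+1) : {z | x = emb z}.
Proof.
exists (x 0 ord0, \row_j x 0 (lift ord0 j)); apply/rowP => j.
by case: (unliftP ord0 j) => [i|] ->; rewrite ?emb_lift ?emb_lshift ?mxE.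
Qed.

Lemma norm_emb n (z : R * 'rV[R]_n) : `|emb z| = `|z|.
Proof.
apply/eqP; rewrite eq_le prod_normE; apply/andP; split.
  rewrite rV_norm_le; last by rewrite le_max normr_ge0.
  apply/forallP => j; case: (unliftP ord0 j) => [i|] ->.
    by rewrite emb_lift le_max rV_coord_le orbT.
  by rewrite emb_lshift le_max lexx.
rewrite ge_max -{1}emb_lshift rV_coord_le rV_norm_le //=.
by apply/forallP => j; rewrite -emb_lift rV_coord_le.
Qed.

Lemma continuous_at_normP (V W : normedModType R) (f : V -> W) x :
  {for x, continuous f} <-> forall e, 0 < e ->
    exists2 d, 0 < d & forall y, `|x - y| < d -> `|f x - f y| < e.
Proof.
split=> [cf e e0|fe].
  have /cvgrPdist_lt/(_ _ e0)/nbhs_ballP[d /= d0 dP] := cf.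
  by exists d => // y xy; apply: dP; rewrite -ball_normE.
apply/cvgrPdist_lt => e /fe[d d0 dP]; apply/nbhs_ballP; exists d => // y.
by rewrite -ball_normE; exact: dP.
Qed.

Lemma open_normP (V : normedModType R) (A : set V) x : open A -> A x ->
  exists2 d, 0 < d & forall y, `|y - x| < d -> A y.
Proof.
move=> oA Ax; have /nbhs_ballP[d /= d0 dP] := open_nbhs_nbhs (conj oA Ax).
by exists d => // y yx; apply: dP; rewrite -ball_normE /= distrC.
Qed.

Lemma lipschitz_continuous (V W : normedModType R) (f : V -> W) C :
  (forall x y, `|f x - f y| <= C * `|x - y|) -> continuous f.
Proof.
move=> fC x; apply/cvgrPdist_lt => e e0.
have C0 : 0 < `|C| + 1 by have := normr_ge0 C; lra.
apply/nbhs_ballP; exists (e / (`|C| + 1)); first by rewrite /= divr_gt0.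
move=> y; rewrite -ball_normE /= ltr_pdivlMr // => xy.
apply: le_lt_trans (fC _ _) _; apply: le_lt_trans xy; rewrite mulrC.
by apply: ler_wpM2l => //; have := ler_norm C; lra.
Qed.

Lemma isometry_continuous (V W : normedModType R) (f : V -> W) :
  (forall x y, `|f x - f y| = `|x - y|) -> continuous f.
Proof.
by move=> fi; apply: (@lipschitz_continuous _ _ f 1) => x y; rewrite mul1r fi.
Qed.

Lemma continuous_pairl (V W : normedModType R) (w : W) :
  continuous (fun v : V => (v, w)).
Proof. by move=> v; exact: (cvg_pair cvg_id (cvg_cst w)). Qed.

Lemma continuous_emb n : continuous (@emb n).
Proof. by apply: isometry_continuous => x y; rewrite emb_sub norm_emb. Qed.

Lemma I_S n (g : 'rV[R]_n.+1 -> R) :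
  I g = \int[mu]_t I (fun x => g (emb (t, x))).
Proof. by []. Qed.

Lemma cc_emb (V : normedModType R) n (g : V * 'rV[R]_n.+1 -> R) : cc g ->
  cc (fun z : (V * R) * 'rV[R]_n => g (z.1.1, emb (z.1.2, z.2))).
Proof.
move=> cg; apply: (@cc_comp _ _ _ g
  (fun z : (V * R) * 'rV[R]_n => (z.1.1, emb (z.1.2, z.2))) 0 1) => // [|z].
  apply: isometry_continuous => x y.
  by rewrite !prod_normE /= emb_sub norm_emb prod_normE /= maxA.
by rewrite add0r mul1r !prod_normE /= norm_emb prod_normE /= maxA.
Qed.

(** The parameter space varies in the induction: one coordinate of the row vector moves into it, and
    [Rint_cc] integrates that coordinate last. *)
Lemma I_cc n (V : normedModType R) (g : V * 'rV[R]_n -> R) : proper V ->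
  cc g -> cc (fun x => I (fun y => g (x, y))).
Proof.
elim: n V g => [|n IH] V g pV cg; first exact: (cc_slice2 _ cg).
apply: (@Rint_cc _ _ (fun z : V * R => I (fun y => g (z.1, emb (z.2, y))))) => //.
apply: (IH _ _ _ (cc_emb cg)); exact: proper_prod pV (@proper_R R).
Qed.

Lemma cc_emb1 n (g : 'rV[R]_n.+1 -> R) : cc g ->
  cc (fun z => g (emb z)).
Proof.
move=> cg; apply: (@cc_comp _ _ _ g (@emb n) 0 1) => // [|z].
  exact: continuous_emb.
by rewrite add0r mul1r norm_emb.
Qed.

Lemma I_slice_cc n (g : 'rV[R]_n.+1 -> R) : cc g ->
  cc (fun t => I (fun x => g (emb (t, x)))).
Proof. by move=> cg; exact: (I_cc (@proper_R R) (cc_emb1 cg)). Qed.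

Lemma cc_slice_emb n (g : 'rV[R]_n.+1 -> R) t : cc g ->
  cc (fun x => g (emb (t, x))).
Proof. by move=> cg; exact: (cc_slice t (cc_emb1 cg)). Qed.

Lemma I_D n (g h : 'rV[R]_n -> R) : cc g -> cc h ->
  I (fun x => g x + h x) = I g + I h.
Proof.
elim: n g h => [//|n IH] g h cg ch; rewrite !I_S.
rewrite -Rint_ccD; [|exact: I_slice_cc|exact: I_slice_cc].
by congr Rintegral; apply/funext => t; apply: IH; exact: cc_slice_emb.
Qed.

Lemma I_Z n c (g : 'rV[R]_n -> R) : cc g -> I (fun x => c * g x) = c * I g.
Proof.
elim: n g => [//|n IH] g cg; rewrite !I_S -Rint_ccZ; last exact: I_slice_cc.
by congr Rintegral; apply/funext => t; apply: IH; exact: cc_slice_emb.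
Qed.

Lemma I_ge0 n (g : 'rV[R]_n -> R) : (forall x, 0 <= g x) -> 0 <= I g.
Proof.
elim: n g => [g g0|n IH g g0]; first exact: g0.
by rewrite I_S; apply: Rintegral_ge0 => t _; apply: IH.
Qed.

Lemma I_B n (g h : 'rV[R]_n -> R) : cc g -> cc h ->
  I (fun x => g x - h x) = I g - I h.
Proof.
move=> cg ch; rewrite -mulN1r -I_Z // -I_D //; last exact: cc_Z.
by congr integral_rV; apply/funext => x; rewrite mulN1r.
Qed.

Lemma I_0 n : I (fun _ : 'rV[R]_n => 0) = 0.
Proof.
have := @I_Z n 0 (fun=> 0) (cc_0 _); rewrite [RHS]mul0r => E; rewrite -[RHS]E.
by congr integral_rV; apply/funext => x; rewrite mul0r.
Qed.

Lemma I_sum n (J : Type) (r : seq J) (g : J -> 'rV[R]_n -> R) :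
  (forall j, cc (g j)) ->
  I (fun x => \sum_(j <- r) g j x) = \sum_(j <- r) I (g j).
Proof.
move=> cg; elim: r => [|j r IH].
  rewrite big_nil -[RHS](I_0 n); congr integral_rV.
  by apply/funext => x; rewrite big_nil.
rewrite big_cons -IH -I_D //; last exact: cc_sum.
by congr integral_rV; apply/funext => x; rewrite big_cons.
Qed.

Lemma I_gt0 n (g : 'rV[R]_n -> R) x : cc g -> (forall y, 0 <= g y) ->
  0 < g x -> 0 < I g.
Proof.
elim: n g x => [|n IH] g x cg g0 gx.
  by rewrite /= (_ : 0 = x) //; apply/rowP => -[].
have [[t y] xE] := emb_surj x; rewrite {}xE in gx.
rewrite I_S; apply: (@Rint_gt0 _ _ t (I_slice_cc cg)) => [s|].
  exact: I_ge0.
by apply: (IH _ y) => //; exact: cc_slice_emb.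
Qed.

Lemma I_bound n (g : 'rV[R]_n -> R) B e : cc g -> 0 <= B ->
  (forall x, B < `|x| -> g x = 0) -> (forall x, `|g x| <= e) ->
  `|I g| <= e * (2 * B) ^+ n.
Proof.
move=> cg B0; elim: n g cg => [|n IH] g cg gB ge; first by rewrite expr0 mulr1; exact: ge.
rewrite I_S exprSr mulrA; apply: Rint_bound => //.
- by have [] := I_slice_cc cg.
- move=> t tB; rewrite (_ : (fun x => _) = fun=> 0) ?I_0 //.
  by apply/funext => x; rewrite gB // norm_emb prod_normE lt_max tB.
- move=> t; apply: IH => [|x xB|x]; first exact: cc_slice_emb.
    by rewrite gB // norm_emb prod_normE lt_max xB orbT.
  exact: ge.
Qed.

(** Fubini's theorem on the line is applied to the integral over the remaining coordinates, which is
    a [cc] function of the two scalars. *)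
Lemma I_Rint n (g : 'rV[R]_n * R -> R) : cc g ->
  I (fun x => \int[mu]_t g (x, t)) = \int[mu]_t I (fun x => g (x, t)).
Proof.
elim: n g => [//|n IH] g cg; rewrite I_S.
pose h (z : (R * R) * 'rV[R]_n) := g (emb (z.1.1, z.2), z.1.2).
have ch : cc h.
  apply: (@cc_comp _ _ _ g (fun z : (R * R) * 'rV[R]_n =>
    (emb (z.1.1, z.2), z.1.2)) 0 1) => //.
    apply: isometry_continuous => x y.
    by rewrite !prod_normE /= emb_sub norm_emb prod_normE /= maxAC.
  by move=> z; rewrite add0r mul1r !prod_normE /= norm_emb prod_normE /= maxAC.
have pRR := proper_prod (@proper_R R) (@proper_R R).
transitivity (\int[mu]_s \int[mu]_t I (fun x => h ((s, t), x))).
  congr Rintegral; apply/funext => s.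
  apply: (IH (fun z => h ((s, z.2), z.1))).
  apply: (@cc_comp _ _ _ h (fun z : 'rV[R]_n * R => ((s, z.2), z.1)) 0 1) => //.
    by move=> [x t]; exact: (cvg_pair (cvg_pair (cvg_cst s) cvg_snd) cvg_fst).
  move=> [x t]; rewrite add0r mul1r !prod_normE /=.
  by rewrite ge_max !le_max !lexx /= !orbT.
by rewrite (Rint_fubini (I_cc pRR ch)).
Qed.

Lemma I_fubini n m (g : 'rV[R]_n * 'rV[R]_m -> R) : cc g ->
  I (fun x => I (fun y => g (x, y))) = I (fun y => I (fun x => g (x, y))).
Proof.
elim: m g => [//|m IH] g cg.
have ch := cc_emb cg.
rewrite [RHS]I_S -[LHS]/(I (fun x => \int[mu]_t I (fun y => g (x, emb (t, y))))).
rewrite (I_Rint (I_cc (proper_prod (@proper_rV R n) (@proper_R R)) ch)) /=.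
congr Rintegral; apply/funext => t; apply: (IH (fun z => g (z.1, emb (t, z.2)))).
apply: (@cc_comp _ _ _ _ (fun z : 'rV[R]_n * 'rV[R]_m => ((z.1, t), z.2)) 0 1 ch) => //.
  by move=> [x y]; exact: (cvg_pair (cvg_pair cvg_fst (cvg_cst t)) cvg_snd).
move=> [x y]; rewrite add0r mul1r !prod_normE /=.
by rewrite ge_max !le_max !lexx /= !orbT.
Qed.

Lemma I_shift n (g : 'rV[R]_n -> R) b : cc g -> I (fun x => g (x + b)) = I g.
Proof.
elim: n g b => [|n IH] g b cg; first by rewrite /= (_ : 0 + b = 0) //; apply/rowP => -[].
have [[s c] ->] := emb_surj b; rewrite !I_S.
rewrite -[RHS](@Rint_scale _ _ 1 s) ?oner_eq0 //; last exact: I_slice_cc.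
rewrite normr1 mul1r; congr Rintegral; apply/funext => t; rewrite mul1r.
rewrite -[RHS](IH _ c); last exact: cc_slice_emb.
congr integral_rV; apply/funext => x; congr g; apply/rowP => j.
by rewrite mxE; case: (unliftP ord0 j) => [i|] ->; rewrite ?emb_lift ?emb_lshift //= mxE.
Qed.

End RowVectorIntegral.

(** * Linear changes of variables *)

Section LinearChangeOfVariables.
Variable R : realType.
Local Notation mu := (@lebesgue_measure R).
Local Notation I := (@integral_rV R).

Definition mx_bound n m (A : 'M[R]_(n, m)) : R := \sum_i \sum_j `|A i j|.

Lemma mx_bound_ge0 n m (A : 'M[R]_(n, m)) : 0 <= mx_bound A.
Proof. by apply: sumr_ge0 => i _; apply: sumr_ge0. Qed.

Lemma mulmx_norm_le n m (A : 'M[R]_(n, m)) (x : 'rV[R]_n) :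
  `|x *m A| <= mx_bound A * `|x|.
Proof.
rewrite rV_norm_le; last by rewrite mulr_ge0 // mx_bound_ge0.
apply/forallP => j; rewrite mxE /mx_bound mulr_suml.
apply: le_trans (ler_norm_sum _ _ _) _; apply: ler_sum => i _.
rewrite normrM mulrC ler_pM // ?rV_coord_le //.
by rewrite (bigD1 j) //= lerDl sumr_ge0.
Qed.

Lemma continuous_mulmxr n m (A : 'M[R]_(n, m)) :
  continuous (fun x : 'rV[R]_n => x *m A).
Proof.
apply: (@lipschitz_continuous _ _ _ _ (mx_bound A)) => x y.
by rewrite -mulmxBl; exact: mulmx_norm_le.
Qed.

Lemma unitmx_norm_le n (A : 'M[R]_n) (x : 'rV[R]_n) : A \in unitmx ->
  `|x| <= mx_bound (invmx A) * `|x *m A|.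
Proof. by move=> uA; rewrite -{1}(mulmxK uA x); exact: mulmx_norm_le. Qed.

Lemma cc_mulmx n (A : 'M[R]_n) (g : 'rV[R]_n -> R) : A \in unitmx -> cc g ->
  cc (fun x => g (x *m A)).
Proof.
move=> uA cg; apply: (cc_comp (C := 0) (D := mx_bound (invmx A)) cg).
- exact: continuous_mulmxr.
- by move=> x; rewrite add0r; exact: unitmx_norm_le.
- exact: mx_bound_ge0.
Qed.

(** The formula as a property of the matrix, stable under products and inverses of invertible
    matrices, so that Gaussian elimination reduces it to block-triangular matrices and a
    transposition. *)
Definition linear_cov n (A : 'M[R]_n) := forall g : 'rV[R]_n -> R, cc g ->
  `|\det A| * I (fun x => g (x *m A)) = I g.

Lemma linear_cov_mul n (A B : 'M[R]_n) : B \in unitmx ->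
  linear_cov A -> linear_cov B -> linear_cov (A *m B).
Proof.
move=> uB qA qB g cg; rewrite det_mulmx normrM mulrAC -[RHS](qB _ cg) mulrC.
congr *%R; rewrite -(qA _ (cc_mulmx uB cg)); congr (_ * _).
by congr integral_rV; apply/funext => x; rewrite mulmxA.
Qed.

Lemma linear_cov_inv n (A : 'M[R]_n) : A \in unitmx ->
  linear_cov A -> linear_cov (invmx A).
Proof.
move=> uA qA g cg.
have uA' : invmx A \in unitmx by rewrite unitmx_inv.
rewrite -(qA _ (cc_mulmx uA' cg)) mulrA -normrM -det_mulmx mulVmx // det1.
rewrite normr1 mul1r; congr integral_rV; apply/funext => x.
by rewrite mulmxK.
Qed.

Lemma linear_cov_cancel n (A B : 'M[R]_n) : B \in unitmx -> A \in unitmx ->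
  linear_cov B -> linear_cov (B *m A) -> linear_cov A.
Proof.
move=> uB uA qB qBA; rewrite -(mulKmx uB A); apply: linear_cov_mul => //.
  by rewrite unitmx_mul uB.
exact: linear_cov_inv.
Qed.

Lemma emb_block n (t a : R) (x b : 'rV[R]_n) (A : 'M[R]_n) :
  emb (t, x) *m block_mx a%:M b 0 A = emb (a * t, x *m A + t *: b).
Proof.
rewrite /emb [LHS](@mul_row_block _ 1 1 n 1 n) /= mulmx0 addr0 -scalar_mxM mulrC.
by rewrite mul_scalar_mx addrC.
Qed.

Lemma unitmx_block n (a : R) (b : 'rV[R]_n) (A : 'M[R]_n) :
  ((block_mx a%:M b 0 A : 'M[R]_(1 + n)) \in unitmx) = (a != 0) && (A \in unitmx).
Proof.
by rewrite unitmxE det_ublock det_scalar1 unitrM unitfE -unitmxE.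
Qed.

(** Integration in [x] comes first: translation invariance absorbs the shift [t *: b], the
    assumption handles [A], and scaling of [t] handles [a]. *)
Lemma linear_cov_block n (a : R) (b : 'rV[R]_n) (A : 'M[R]_n) : a != 0 ->
  A \in unitmx -> linear_cov A ->
  linear_cov (block_mx a%:M b 0 A : 'M[R]_(1 + n)).
Proof.
move=> a0 uA qA g cg.
rewrite det_ublock det_scalar1 normrM.
rewrite [I g]I_S -(Rint_scale 0 (I_slice_cc cg) a0) -mulrA; congr (_ * _).
have cF : cc (fun t : R => I (fun x => g (emb (t, x) *m block_mx a%:M b 0 A))).
  apply: (@I_slice_cc _ _ (fun x => g (x *m (block_mx a%:M b 0 A : 'M[R]_(1 + n))))).
  apply: cc_mulmx => //.
  by have := unitmx_block a b A; rewrite a0 uA; apply.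
rewrite I_S -Rint_ccZ //; congr Rintegral; apply/funext => t; rewrite addr0.
rewrite -[RHS](I_shift (t *: b) (cc_slice_emb _ cg)).
rewrite -[RHS]qA; last first.
  apply: (cc_comp (phi := fun x => x + t *: b) (C := `|t *: b|) (D := 1) (cc_slice_emb
    (a * t) cg)) => //.
    by apply: isometry_continuous => x y; congr `|_|; rewrite opprD addrACA subrr addr0.
  move=> x; rewrite mul1r; have := ler_distD (- (t *: b)) x 0.
  by rewrite opprK !subr0 normrN addrC.
congr (_ * _); congr integral_rV; apply/funext => x.
by rewrite emb_block.
Qed.

(** This is Fubini's theorem for the first two coordinates. *)
Lemma linear_cov_swap n :
  linear_cov (tperm_mx ord0 (lift ord0 ord0) : 'M[R]_n.+2).
Proof.
move=> g cg; rewrite det_perm normr_sign mul1r.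
have swap s t (x : 'rV[R]_n) :
    emb (s, emb (t, x)) *m tperm_mx ord0 (lift ord0 ord0) = emb (t, emb (s, x)).
  rewrite -xcolE; apply/rowP => j; rewrite [LHS]mxE.
  case: (unliftP ord0 j) => [i|] ->; last by rewrite tpermL emb_lift !emb_lshift.
  case: (unliftP ord0 i) => [k|] ->; last by rewrite tpermR emb_lift !emb_lshift.
  by rewrite tpermD // !emb_lift.
have pRR := proper_prod (@proper_R R) (@proper_R R).
pose h (z : R * R) := I (fun x => g (emb (z.1, emb (z.2, x)))).
have ch : cc h := I_cc pRR (cc_emb (cc_emb1 cg)).
rewrite -[RHS]/(\int[mu]_s \int[mu]_t h (s, t)) (Rint_fubini ch).
rewrite -[LHS]/(\int[mu]_s \int[mu]_t I (fun x =>
  g (emb (s, emb (t, x)) *m tperm_mx ord0 (lift ord0 ord0)))).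
congr Rintegral; apply/funext => s; congr Rintegral; apply/funext => t.
by congr integral_rV; apply/funext => x; rewrite swap.
Qed.

(** A nonzero column has rank one, so its elimination form is the first basis vector up to the unit
    [row_ebase c 0 0], which is divided out. *)
Lemma col_to_delta n (c : 'cV[R]_n.+1) : c != 0 ->
  exists2 E : 'M[R]_n.+1, E \in unitmx & E *m c = delta_mx ord0 ord0.
Proof.
move=> c0.
have rc : \rank c = 1%N.
  by apply/eqP; rewrite eqn_leq rank_leq_col lt0n mxrank_eq0.
have u1 := col_ebase_unit c; have u2 := row_ebase_unit c.
pose r := row_ebase c 0 0.
have r0 : r != 0.
  by move: u2; rewrite unitmxE det_mx11 unitfE.
exists (r^-1 *: invmx (col_ebase c)).
  rewrite unitmxE detZ unitrM unitrX ?unitfE ?invr_eq0 //=.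
  by rewrite -unitfE -unitmxE unitmx_inv.
rewrite -{2}(mulmx_ebase c) -scalemxAl -!mulmxA mulKmx // rc.
rewrite [row_ebase c]mx11_scalar -/r mul_mx_scalar scalerA mulVf // scale1r.
by apply/matrixP => i j; rewrite !mxE (ord1 j); case: (unliftP ord0 i) => [k|] ->.
Qed.

Lemma block_mx0 n (A : 'M[R]_(1 + n)) : A \in unitmx -> dlsubmx A = 0 ->
  [/\ A = block_mx (A 0 0)%:M (ursubmx A) 0 (drsubmx A), A 0 0 != 0 &
      drsubmx A \in unitmx].
Proof.
move=> uA A0.
have AE : A = block_mx (A 0 0)%:M (ursubmx A) 0 (drsubmx A).
  rewrite -[LHS]submxK A0 [ulsubmx A]mx11_scalar; congr block_mx; congr _%:M.
  by rewrite !mxE; congr (A _ _); exact/val_inj.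
by move: uA; rewrite {1}AE unitmx_block => /andP[].
Qed.

(** When the lower left column is nonzero, [B1] turns it into the first basis vector, [B2] uses it
    to clear the corner entry, and [W] exchanges the first two rows. The first column has become the
    first basis vector, and the block case applies. *)
Lemma linear_covP n (A : 'M[R]_n) : A \in unitmx -> linear_cov A.
Proof.
elim: n A => [|n IH] A uA.
  move=> g cg; rewrite det_mx00 normr1 mul1r /=; congr g.
  by apply/rowP => -[].
have block_case (B : 'M[R]_(1 + n)) : B \in unitmx -> dlsubmx B = 0 -> linear_cov B.
  move=> uB B0; have [BE B00 uB'] := block_mx0 uB B0; rewrite BE.
  exact: (linear_cov_block _ B00 uB' (IH _ uB')).
(* In dimension one the lower left block is empty, and there is no second row to exchange. *)
case: n IH A uA block_case => [|n] IH A uA block_case.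
  by apply: block_case => //; apply/matrixP => -[].
have [A0|A0] := eqVneq (dlsubmx (A : 'M[R]_(1 + n.+1))) 0; first exact: block_case.
have [E uE EA] := col_to_delta A0.
pose B1 : 'M[R]_(1 + n.+1) := block_mx 1%:M 0 0 E.
pose a := A 0 0.
pose B2 : 'M[R]_(1 + n.+1) := block_mx 1%:M (- a *: delta_mx 0 0) 0 1%:M.
pose W : 'M[R]_(1 + n.+1) := tperm_mx ord0 (lift ord0 ord0).
have uB1 : B1 \in unitmx by have := unitmx_block 1 0 E; rewrite oner_neq0 uE; apply.
have uB2 : B2 \in unitmx by have := unitmx_block 1 (- a *: delta_mx 0 0) 1%:M;
  rewrite oner_neq0 => ->; exact: unitmx1.
have uW : W \in unitmx by exact: unitmx_perm.
have one0 : (1 : R) != 0 by exact: oner_neq0.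
have q1 : linear_cov B1 by apply: linear_cov_block => //; exact: IH.
have q2 : linear_cov B2.
  by apply: linear_cov_block => //; [exact: unitmx1 | apply: IH; exact: unitmx1].
apply: (linear_cov_cancel uB1 uA q1).
have u1 : B1 *m A \in unitmx by rewrite unitmx_mul uB1.
apply: (linear_cov_cancel uB2 u1 q2).
have u2 : B2 *m (B1 *m A) \in unitmx by rewrite unitmx_mul uB2.
apply: (linear_cov_cancel uW u2 (@linear_cov_swap n)).
apply: block_case; first by rewrite unitmx_mul uW.
pose A1 : 'M[R]_(1 + n.+1) := B1 *m A; pose A2 : 'M[R]_(1 + n.+1) := B2 *m A1.
have A1E : A1 = block_mx (ulsubmx (A : 'M[R]_(1 + n.+1)))
    (ursubmx (A : 'M[R]_(1 + n.+1))) (delta_mx 0 0)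
    (E *m drsubmx (A : 'M[R]_(1 + n.+1))).
  have AE := esym (@submxK _ 1 n.+1 1 n.+1 A).
  rewrite /A1 /B1 {1}AE [LHS](@mulmx_block _ 1 n.+1 1 n.+1 1 n.+1).
  by rewrite !(mul0mx, mul1mx, add0r, addr0) EA.
have A2E : A2 = block_mx 0 (ursubmx A2) (delta_mx 0 0) (drsubmx A2).
  rewrite -[LHS]submxK; congr block_mx; rewrite /A2 A1E /B2 (@mulmx_block _ 1 n.+1 1
    n.+1 1 n.+1).
    rewrite block_mxKul mul1mx -scalemxAl mul_delta_mx.
    apply/matrixP => i j; rewrite !mxE (ord1 i) (ord1 j) /= /a.
    have -> : @lshift 1 n.+1 0 = ord0 by exact/val_inj.
    by rewrite ?mulr1 ?mul1r ?mulNr ?mulr1 ?mul1r subrr.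
  by rewrite block_mxKdl mul0mx add0r mul1mx.
rewrite -[B2 *m (B1 *m A)]/A2 /W -[tperm_mx _ _ *m _](xrowE ord0 (lift ord0 ord0) A2).
apply/colP => i; rewrite [LHS]mxE [RHS]mxE.
have xrE k l : xrow ord0 (lift ord0 ord0) A2 k l =
  A2 (tperm ord0 (lift ord0 ord0) k) l by rewrite mxE.
transitivity (A2 (tperm ord0 (lift ord0 ord0) (rshift 1 i)) (lshift n.+1 0)).
  by rewrite [LHS]mxE; exact: xrE.
case: (unliftP ord0 i) => [k|] ->.
  by rewrite tpermD // A2E block_mxEdl mxE.
have -> : @rshift 1 n.+1 ord0 = lift ord0 ord0 by exact/val_inj.
rewrite tpermR (_ : ord0 = @lshift 1 n.+1 0); last exact/val_inj.
by rewrite A2E block_mxEul mxE.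
Qed.

End LinearChangeOfVariables.

(** * Change of variables *)

Section ChangeOfVariables.
Variable R : realType.
Local Notation I := (@integral_rV R).

(** Off [A], continuity comes from the complement of [K], open because compact sets are closed, on
    which [f] vanishes. *)
Lemma cc_extend (V : normedModType R) (A K : set V) (f : V -> R) :
  open A -> compact K -> K `<=` A ->
  (forall x, A x -> {for x, continuous f}) -> (forall x, ~ K x -> f x = 0) ->
  cc f.
Proof.
move=> oA cK KA cf f0; split; last first.
  have [B [_ KB]] := compact_bounded cK.
  exists (B + 1) => x xB; apply: f0 => Kx.
  by have := KB (B + 1); rewrite ltrDl => /(_ ltr01 x Kx) /=; rewrite leNgt xB.
move=> x; have [Ax|nAx] := pselect (A x); first exact: cf.
have clK : closed K by apply: compact_closed cK; exact: norm_hausdorff.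
have nKx : ~ K x by move=> /KA.
have nK : \forall y \near x, 0 = f y.
  apply: filterS (open_nbhs_nbhs (conj (closed_openC clK) nKx)) => y /= Ky.
  by rewrite f0.
rewrite /prop_for /continuous_at f0 //.
by apply: (cvg_trans (near_eq_cvg nK)); exact: cvg_cst.
Qed.

(** The mollifier. Its regularity enters through the Lipschitz constant [1], and its integral is
    carried along instead of being normalized. *)
Definition tent n (x : 'rV[R]_n) : R := Num.max 0 (1 - `|x|).

Lemma tent_ge0 n (x : 'rV[R]_n) : 0 <= tent x.
Proof. by rewrite le_max lexx. Qed.

Lemma tent_le1 n (x : 'rV[R]_n) : tent x <= 1.
Proof. by rewrite ge_max ler01 /=; have := normr_ge0 x; lra. Qed.

Lemma tent_eq0 n (x : 'rV[R]_n) : 1 <= `|x| -> tent x = 0.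
Proof. by move=> x1; apply/max_idPl; lra. Qed.

Lemma tentN n (x : 'rV[R]_n) : tent (- x) = tent x.
Proof. by rewrite /tent normrN. Qed.

Lemma tent_lip n (x y : 'rV[R]_n) : `|tent x - tent y| <= `|x - y|.
Proof.
have h : `| `|x| - `|y| | <= `|x - y| by exact: ler_dist_dist.
move: h; rewrite /tent !ler_norml => /andP[h1 h2].
by case: (leP 0 (1 - `|x|)) => hx; case: (leP 0 (1 - `|y|)) => hy;
  rewrite ?(max_r hx) ?(max_l (ltW hx)) ?(max_r hy) ?(max_l (ltW hy));
  apply/andP; split; lra.
Qed.

Lemma continuous_tent n : continuous (@tent n).
Proof.
by apply: (@lipschitz_continuous _ _ _ _ 1) => x y; rewrite mul1r tent_lip.
Qed.

Lemma cc_tent n : cc (@tent n).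
Proof.
by split; [exact: continuous_tent | exists 1 => x /ltW /tent_eq0].
Qed.

Lemma I_tent_gt0 n : 0 < I (@tent n).
Proof.
apply: (I_gt0 (x := 0)); [exact: cc_tent | exact: tent_ge0 |].
by rewrite /tent normr0 subr0 lt_max ltr01 orbT.
Qed.

Lemma I_scale_shift n (g : 'rV[R]_n -> R) e b : cc g -> 0 < e ->
  I g = e ^+ n * I (fun x => g (b + e *: x)).
Proof.
move=> cg e0; have u : (e%:M : 'M[R]_n) \in unitmx.
  by rewrite unitmxE det_scalar unitrX // unitfE gt_eqF.
rewrite -(I_shift b cg) -(linear_covP u); last first.
  apply: (cc_comp (phi := fun x => x + b) (C := `|b|) (D := 1) cg) => //.
    by apply: isometry_continuous => x y; congr `|_|; rewrite opprD addrACA subrr addr0.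
  move=> x; rewrite mul1r; have := ler_distD (- b) x 0.
  by rewrite opprK !subr0 normrN addrC.
rewrite det_scalar ger0_norm ?exprn_ge0 ?ltW //; congr (_ * _).
by congr integral_rV; apply/funext => x; rewrite mul_mx_scalar addrC.
Qed.

(** Strict differentiability: both points move. Once [J y0] is invertible, this gives a Lipschitz
    bound for the local inverse of [T]. *)
Definition strong_diff n (A : set 'rV[R]_n) (T : 'rV[R]_n -> 'rV[R]_n)
    (J : 'rV[R]_n -> 'M[R]_n) :=
  forall y0 d, A y0 -> 0 < d -> exists2 r, 0 < r &
    forall y y', `|y - y0| < r -> `|y' - y0| < r ->
      `|T y - T y' - (y - y') *m J y0| <= d * `|y - y'|.

Section Diffeo.
Variables (n : nat) (A B : set 'rV[R]_n) (T S : 'rV[R]_n -> 'rV[R]_n).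
Variable J : 'rV[R]_n -> 'M[R]_n.
Hypotheses (oA : open A) (oB : open B).
Hypothesis TK : forall y, A y -> B (T y) /\ S (T y) = y.
Hypothesis SK : forall z, B z -> A (S z) /\ T (S z) = z.
Hypothesis Scont : forall z, B z -> {for z, continuous S}.
Hypothesis Tdiff : strong_diff A T J.
Hypothesis Junit : forall y, A y -> J y \in unitmx.
Hypothesis Jcont : forall y, A y -> {for y, continuous (fun y => \det (J y))}.

Let ind (f : 'rV[R]_n -> R) y := if y \in A then f y else 0.
Let jac y := `|\det (J y)|.

Lemma strong_diff_continuous y : A y -> {for y, continuous T}.
Proof.
move=> Ay; have [r r0 rP] := Tdiff Ay ltr01.
apply/continuous_at_normP => e e0.
have c0 : 0 < mx_bound (J y) + 1 by have := mx_bound_ge0 (J y); lra.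
exists (Num.min r (e / (mx_bound (J y) + 1))); first by rewrite lt_min r0 divr_gt0.
move=> y'; rewrite lt_min => /andP[yr].
rewrite ltr_pdivlMr // mulrC => ye; apply: le_lt_trans ye.
have := rP y y'; rewrite subrr normr0 r0 distrC yr => /(_ isT isT).
have := mulmx_norm_le (J y) (y - y').
have := ler_normD (T y - T y' - (y - y') *m J y) ((y - y') *m J y).
by rewrite subrK; lra.
Qed.

Lemma strong_diff_local y0 d : A y0 -> 0 < d -> exists2 r, 0 < r &
  forall y, `|y - y0| < r -> [/\ A y, `|jac y - jac y0| <= d &
    forall y', `|y' - y0| < r -> `|T y - T y' - (y - y') *m J y0| <= d * `|y - y'|].
Proof.
move=> Ay0 d0; have [r r0 rP] := Tdiff Ay0 d0.
have /continuous_at_normP/(_ _ d0)[r1 r10 r1P] := Jcont Ay0.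
have [r2 r20 r2P] := open_normP oA Ay0.
exists (Num.min r (Num.min r1 r2)); first by rewrite !lt_min r0 r10.
move=> y; rewrite !lt_min => /and3P[yr yr1 yr2]; split.
- exact: r2P.
- apply: le_trans (ler_dist_dist _ _) _; rewrite distrC ltW //.
  by apply: r1P; rewrite distrC.
- by move=> y'; rewrite !lt_min => /andP[y'r _]; exact: rP.
Qed.

(** With [y = S z + e *: eta] the integrand becomes close to [|det A0| * tent (eta *m A0)], whose
    integral is that of [tent] by the linear case. The double [near] makes this uniform over compact
    sets; the premise [cc] is discharged where it is used, for [z] in the compact support and [e]
    small. *)
Lemma mollified_kernel z0 d : B z0 -> 0 < d ->
  \forall z \near z0 & e \near 0^'+,
    cc (ind (fun y => jac y * tent (e^-1 *: (T y - z)))) ->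
    `|e ^- n * I (ind (fun y => jac y * tent (e^-1 *: (T y - z)))) - I (@tent n)|
      <= d.
Proof.
move=> Bz0 d0; have [Ay0 Ty0] := SK Bz0.
set y0 := S z0 in Ay0 Ty0 *; pose A0 := J y0; have uA0 := Junit Ay0.
(* [K] bounds the inverse of the differential and [L = 2 * K] the local inverse of [T]: a
   linearization error of at most [1 / (2 * K)] uses up half of the estimate. *)
pose K := mx_bound (invmx A0) + 1; pose L := 2 * K.
have K0 : 0 < K by have := mx_bound_ge0 (invmx A0); rewrite /K; lra.
have L0 : 0 < L by rewrite /L; lra.
have KP (v : 'rV[R]_n) : `|v| <= K * `|v *m A0|.
  apply: le_trans (unitmx_norm_le v uA0) _; apply: ler_wpM2r => //.
  by rewrite /K lerDl.
pose j0 := jac y0; have j0_ge0 : 0 <= j0 by exact: normr_ge0.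
pose Cst := (j0 + 1) * L + 1.
have Cst0 : 0 < Cst by rewrite /Cst ltr_wpDl // mulr_ge0 ?ltW //; lra.
pose V := (2 * L) ^+ n; have V0 : 0 < V by apply: exprn_gt0; lra.
pose d1 := Num.min (2 * K)^-1 (Num.min 1 (d / (Cst * V))).
have d10 : 0 < d1.
  by rewrite !lt_min invr_gt0 ltr01 divr_gt0 ?mulr_gt0.
have d1K : d1 <= L^-1 by rewrite ge_min lexx.
have d11 : d1 <= 1 by rewrite !ge_min lexx orbT.
have d1d : d1 * Cst * V <= d.
  by rewrite -mulrA -ler_pdivlMr ?mulr_gt0 // !ge_min lexx !orbT.
have [r r0 rP] := strong_diff_local Ay0 d10.
have inv y y' : `|y - y0| < r -> `|y' - y0| < r -> `|y - y'| <= L * `|T y - T y'|.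
  move=> yr y'r; have [_ _ /(_ _ y'r)] := rP _ yr.
  set v := y - y'; set w := T y - T y'.
  have := KP v; have := ler_normD (v *m A0 - w) w; rewrite subrK [`|_ *m _ - w|]distrC.
  move=> h1 h2 h3.
  have h4 : d1 * `|v| <= L^-1 * `|v| by apply: ler_wpM2r.
  have h5 : `|v *m A0| <= `|w| + L^-1 * `|v| by rewrite /A0 in h1 *; lra.
  have : `|v| <= K * (`|w| + L^-1 * `|v|) by apply: le_trans h2 _; rewrite ler_pM2l.
  rewrite mulrDr mulrA (_ : K / L = 2^-1); last by rewrite /L; field; rewrite gt_eqF.
  by rewrite /L; lra.
have [rho rho0 rhoP] : exists2 rho, 0 < rho &
    forall z, `|z - z0| < rho -> B z /\ `|S z - y0| < r / 2.
  have r20 : 0 < r / 2 by lra.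
  have /continuous_at_normP/(_ _ r20)[r1 r10 r1P] := Scont Bz0.
  have [r2 r2_0 r2P] := open_normP oB Bz0.
  exists (Num.min r1 r2); first by rewrite lt_min r10.
  move=> z; rewrite lt_min => /andP[z1 z2]; split.
    exact: r2P.
  by rewrite distrC; apply: r1P; rewrite distrC.
exists (ball z0 (rho / 2), [set e | 0 < e /\ (e < rho / 2 /\ e < r / (2 * L))]).
  split=> /=; first by apply: nbhsx_ballx; lra.
  apply: filterI; first exact: nbhs_right_gt.
  by apply: filterI; apply: nbhs_right_lt; rewrite ?divr_gt0 //; lra.
move=> [z e] /= [+ [e0 [erho er]]]; rewrite -ball_normE /= distrC => zz0 ccf.
set f := ind _ in ccf *.
have eL : e * L < r / 2 by move: er; rewrite invfM mulrA ltr_pdivlMr.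
have [Bz Sz] : B z /\ `|S z - y0| < r / 2 by apply: rhoP; lra.
have [ASz TSz] := SK Bz.
rewrite (I_scale_shift (S z) ccf e0) mulrA mulVf; last by rewrite expf_neq0 // gt_eqF.
rewrite mul1r -(linear_covP uA0 (@cc_tent n)) -I_Z; last exact: (cc_mulmx uA0 (@cc_tent n)).
pose g eta := f (S z + e *: eta).
have ccg : cc g.
  apply: (cc_comp (phi := fun x => S z + e *: x) (C := `|S z| / e) (D := e^-1) ccf) => //.
  - apply: (@lipschitz_continuous _ _ _ _ e) => x y.
    by rewrite opprD addrACA subrr add0r -scalerBr normrZ gtr0_norm.
  - move=> x; rewrite mulrC -mulrDr mulrC ler_pdivlMr //.
    have := ler_normB (S z + e *: x) (S z);
      rewrite [X in `|X - _|]addrC addrK normrZ gtr0_norm //.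
    by rewrite mulrC; lra.
  - by rewrite invr_ge0 ltW.
have cct := cc_Z j0 (cc_mulmx uA0 (@cc_tent n)).
rewrite -(I_B ccg cct).
(* Both profiles live in [|eta| <= L]: if [T y] is within [e] of [z], then [y] is within [L * e] of
   [S z]. *)
have out eta : L < `|eta| -> g eta = 0 /\ tent (eta *m A0) = 0.
  move=> eta_L; split.
    rewrite /g /f /ind; case: ifPn => //; rewrite inE => Ay.
    set y := S z + _ in Ay *.
    rewrite tent_eq0 ?mulr0 // leNgt; apply/negP => hlt.
    have Tyz : `|T y - z| < e.
      by move: hlt; rewrite normrZ gtr0_norm ?invr_gt0 // mulrC ltr_pdivrMr // mul1r.
    have [_ ST] := TK Ay.
    have [_ yr] : B (T y) /\ `|S (T y) - y0| < r / 2.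
      by apply: rhoP; have := ler_distD z (T y) z0; lra.
    rewrite ST in yr.
    have := inv y (S z); rewrite TSz => /(_ _ _)/[dup].
    have yr' : `|y - y0| < r by lra.
    have Szr : `|S z - y0| < r by lra.
    move=> /(_ yr' Szr) h _.
    have : `|y - S z| = e * `|eta|.
      by rewrite /y [S z + _]addrC addrK normrZ gtr0_norm.
    have : L * `|T y - z| < L * e by rewrite ltr_pM2l.
    have : e * L < e * `|eta| by rewrite ltr_pM2l.
    lra.
  apply: tent_eq0; rewrite -(ler_pM2l K0) mulr1; apply: le_trans (KP eta).
  by rewrite /L in eta_L; lra.
apply: le_trans d1d; rewrite -/V; apply: I_bound.
- exact: cc_B.
- exact: ltW.
- by move=> x /out[-> ->]; rewrite mulr0 subrr.
move=> eta; have [etaL|/out[-> ->]] := leP `|eta| L; last first.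
  by rewrite mulr0 subrr normr0 mulr_ge0 // ltW.
have yr : `|S z + e *: eta - y0| < r.
  have := ler_normD (S z - y0) (e *: eta); rewrite addrAC normrZ gtr0_norm // => h.
  have : e * `|eta| <= e * L by rewrite ler_pM2l.
  lra.
have Szr : `|S z - y0| < r by lra.
have [Ay jy /(_ _ Szr)] := rP _ yr.
rewrite TSz /g /f /ind mem_set //; set y := S z + _ in Ay jy yr *.
rewrite (_ : y - S z = e *: eta); last by rewrite /y [S z + _]addrC addrK.
rewrite normrZ gtr0_norm // -scalemxAl => hT.
have ht : `|tent (e^-1 *: (T y - z)) - tent (eta *m A0)| <= d1 * L.
  apply: le_trans (tent_lip _ _) _.
  have -> : e^-1 *: (T y - z) - eta *m A0 = e^-1 *: (T y - z - e *: (eta *m A0)).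
    by rewrite [RHS]scalerBr scalerA mulVf ?gt_eqF // scale1r.
  rewrite normrZ gtr0_norm ?invr_gt0 // mulrC ler_pdivrMr //.
  apply: le_trans hT _; rewrite mulrCA mulrC ler_pM2r // ler_pM2l //.
set a := tent _ in ht *; set b := tent _ in ht *.
have a0 : 0 <= a by exact: tent_ge0.
have a1 : a <= 1 by exact: tent_le1.
rewrite (_ : _ - _ = (jac y - j0) * a + j0 * (a - b)); last by ring.
apply: le_trans (ler_normD _ _) _; rewrite !normrM (ger0_norm a0) (ger0_norm j0_ge0).
have h1 : `|jac y - j0| * a <= d1 * 1 by apply: ler_pM.
have h2 : j0 * `|a - b| <= j0 * (d1 * L) by apply: ler_wpM2l.
have h3 : 0 <= d1 * L by rewrite mulr_ge0 ?ltW.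
by rewrite /Cst; lra.
Qed.

Lemma jac_continuous y : A y -> {for y, continuous jac}.
Proof. by move=> Ay; exact: (cvg_norm (Jcont Ay)). Qed.

Lemma ind_near (f : 'rV[R]_n -> R) y : A y -> {for y, continuous f} ->
  {for y, continuous (ind f)}.
Proof.
move=> Ay cf; have fE : \forall x \near y, f x = ind f x.
  apply: filterS (open_nbhs_nbhs (conj oA Ay)) => x Ax.
  by rewrite /ind mem_set.
rewrite /prop_for /continuous_at -(nbhs_singleton fE).
exact: cvg_trans (near_eq_cvg fE) cf.
Qed.

(** The kernel spreads the support of [h] by [e]. For all [e <= e0] everything stays over one
    compact set, the image by [S] of the closed [e0]-neighbourhood of [C]. *)
Lemma compact_collar (C : set 'rV[R]_n) : compact C -> C `<=` B ->
  exists e0, [/\ 0 < e0, compact (S @` [set w | exists2 z, C z & `|w - z| <= e0]),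
    S @` [set w | exists2 z, C z & `|w - z| <= e0] `<=` A &
    [set w | exists2 z, C z & `|w - z| <= e0] `<=` B].
Proof.
move=> cC CB.
have [e0 e00 e0P] : exists2 e0, 0 < e0 &
    forall z w, C z -> `|w - z| <= e0 -> B w.
  pose P (e : R) (z : 'rV[R]_n) := forall w, `|w - z| <= e -> B w.
  have : \forall e \near 0^'+, forall z, C z -> P e z.
    move/compact_near_coveringP : (cC); apply => z Cz.
    have [d d0 dP] := open_normP oB (CB _ Cz).
    exists (ball z (d / 2), [set e | e < d / 2]).
      by split=> /=; [apply: nbhsx_ballx|apply: nbhs_right_lt]; lra.
    move=> [z' e] /= [+ ed] w wz'; rewrite -ball_normE /= distrC => zz'.
    by apply: dP; have := ler_distD z' w z; lra.
  move=> eP; near (0 : R)^'+ => e; exists e => // z w Cz; move: z Cz w.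
  by near: e.
have C1B : [set w | exists2 z, C z & `|w - z| <= e0] `<=` B.
  by move=> w [z Cz wz]; exact: e0P wz.
exists e0; split => //; last by move=> _ [w /C1B /SK[? _] <-].
apply: continuous_compact.
  apply: continuous_in_subspaceT => w; rewrite inE => /C1B; exact: Scont.
rewrite (_ : [set w | _] = (fun z : 'rV[R]_n * 'rV[R]_n => z.1 + z.2) @`
    (C `*` [set x | `|x| <= e0])).
  apply: continuous_compact; last by apply: compact_setX => //; exact: proper_rV.
  by apply: continuous_subspaceT => z; exact: (cvgD cvg_fst cvg_snd).
apply/seteqP; split=> [w [z Cz wz]|_ [[z x] [/= Cz xe] <-]].
  by exists (z, w - z) => //=; rewrite addrC subrK.
by exists z => //=; rewrite addrAC subrr add0r.
Unshelve. all: by end_near. Qed.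

(* With [k_e (y, z) = |det (J y)| tent ((T y - z) / e)], Fubini's theorem gives
   [\int_y \int_z k_e h (z) = \int_z h (z) \int_y k_e]; after division by [e ^ n]
   and by the integral of [tent], both sides converge as [e] tends to [0]. *)
Section Mollify.
Variables (h : 'rV[R]_n -> R) (C : set 'rV[R]_n).
Hypotheses (hcont : continuous h) (cC : compact C) (CB : C `<=` B).
Hypothesis h0 : forall z, ~ C z -> h z = 0.

Let kernel e (p : 'rV[R]_n * 'rV[R]_n) :=
  ind (fun y => jac y * tent (e^-1 *: (T y - p.2))) p.1.

Let K e0 := S @` [set w | exists2 z, C z & `|w - z| <= e0].

Let kernel_cont e p : A p.1 -> {for p, continuous (kernel e)}.
Proof.
case: p => y z /= Ay.
pose f (p : 'rV[R]_n * 'rV[R]_n) := jac p.1 * tent (e^-1 *: (T p.1 - p.2)).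
have fE : \forall p \near (y, z), f p = kernel e p.
  have : \forall p \near (y, z), A p.1.
    exact: (cvg_fst (open_nbhs_nbhs (conj oA Ay))).
  by apply: filterS => p Ap; rewrite /kernel /ind mem_set.
rewrite /prop_for /continuous_at -(nbhs_singleton fE).
apply: (cvg_trans (near_eq_cvg fE)).
have c0 : {for (y, z), continuous (fst : 'rV[R]_n * 'rV[R]_n -> 'rV[R]_n)}.
  exact: cvg_fst.
have c1 : {for (y, z), continuous (fun p : 'rV[R]_n * 'rV[R]_n => jac p.1)}.
  exact: (continuous_comp c0 (jac_continuous Ay : {for (y, z).1, continuous jac})).
have c2 : {for (y, z), continuous (fun p : 'rV[R]_n * 'rV[R]_n => T p.1)}.
  exact: (continuous_comp c0 (strong_diff_continuous Ay : {for (y, z).1, continuous T})).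
have c3 : {for (y, z), continuous (fun p : 'rV[R]_n * 'rV[R]_n => e^-1 *: (T p.1 - p.2))}.
  exact: (cvgZr (cvgB c2 cvg_snd)).
exact: (cvgM c1 (continuous_comp c3 (@continuous_tent n _))).
Qed.

Let kernel0 e e0 y z : 0 < e -> e <= e0 -> C z -> ~ K e0 y -> kernel e (y, z) = 0.
Proof.
move=> e_gt0 ee0 Cz nKy; rewrite /kernel /ind /=; case: ifPn => //.
rewrite inE => Ay; rewrite tent_eq0 ?mulr0 // leNgt; apply/negP.
rewrite normrZ gtr0_norm ?invr_gt0 // mulrC ltr_pdivrMr // mul1r => Tyz.
apply: nKy; exists (T y); last by have [] := TK Ay.
by exists z => //; apply: ltW; exact: lt_le_trans ee0.
Qed.

Theorem integral_cov : I h = I (ind (fun y => h (T y) * jac y)).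
Proof.
have [e0 [e0_gt0 cK KA C1B]] := compact_collar cC CB.
rewrite -/(K e0) in cK KA.
have ch : cc h.
  by apply: (@cc_extend _ setT C) => //; [exact: openT | move=> x _; exact: hcont].
set k := ind _.
have ck : cc k.
  apply: (cc_extend oA cK KA) => [y Ay|y nKy].
    apply: ind_near => //.
    exact: (cvgM (continuous_comp (strong_diff_continuous Ay) (hcont (x := T y)))
      (jac_continuous Ay)).
  rewrite /k /ind; case: ifPn => //; rewrite inE => Ay.
  rewrite h0 ?mul0r // => CTy; apply: nKy; exists (T y); last by have [] := TK Ay.
  by exists (T y) => //; rewrite subrr normr0 ltW.
have cker e z : 0 < e -> e <= e0 -> C z -> cc (fun y => kernel e (y, z)).
  move=> e_gt0 ee0 Cz; apply: (cc_extend oA cK KA) => y; last exact: kernel0.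
  move=> Ay; have cE := @kernel_cont e (y, z) Ay.
  exact: (continuous_comp (@continuous_pairl _ _ _ z y) cE).
pose F e p := kernel e p * h p.2.
have cF e : 0 < e -> e <= e0 -> cc (F e).
  move=> e_gt0 ee0; apply: (@cc_extend _ (A `*` setT) (K e0 `*` C)).
  - rewrite (_ : _ `*` _ = fst @^-1` A); last by apply/seteqP; split=> -[y z] /=;
    [case | split].
    by apply: open_comp => // p _; exact: cvg_fst.
  - exact: compact_setX.
  - by move=> [y z] [/= /KA].
  - move=> [y z] [/= Ay _].
    have c1 : {for (y, z), continuous (snd : 'rV[R]_n * 'rV[R]_n -> 'rV[R]_n)}.
      exact: cvg_snd.
    have c2 := continuous_comp c1 (hcont (x := z) : {for (y, z).2, continuous h}).
    exact: (cvgM (@kernel_cont e (y, z) Ay) c2).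
  - move=> [y z] nyz; rewrite /F /=; have [Cz|/h0 ->] := pselect (C z); last by rewrite mulr0.
    by rewrite (kernel0 e_gt0 ee0 Cz) ?mul0r // => Ky; apply: nyz.
set m := I (@tent n); have m0 : 0 < m := I_tent_gt0 n.
have bounded (D : set 'rV[R]_n) : compact D -> exists2 b, 0 < b & forall x, D x -> `|x| <= b.
  move=> cD; have [b [_ bP]] := compact_bounded cD.
  exists (`|b| + 1); first by have := normr_ge0 b; lra.
  by move=> x Dx; apply: bP Dx; have := ler_norm b; lra.
have [bK bK0 bKP] := bounded _ cK; have [bC bC0 bCP] := bounded _ cC.
have bounded_cc (g : 'rV[R]_n -> R) : cc g -> exists2 b, 0 < b & forall x, `|g x| <= b.
  move=> [cg [b0 gb0]].
  have [b [_ bP]] := compact_bounded (continuous_compact (continuous_subspaceT cg)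
    (@proper_rV R n b0)).
  exists (`|b| + 1); first by have := normr_ge0 b; lra.
  move=> x; have [xb|/gb0 ->] := leP `|x| b0; last by rewrite normr0;
    have := normr_ge0 b; lra.
  apply: bP; first by have := ler_norm b; lra.
  by exists x.
have [bh bh0 bhP] := bounded_cc _ ch.
have [bJ bJ0 bJP] : exists2 b, 0 < b & forall y, K e0 y -> jac y <= b.
  have cjac : {within K e0, continuous jac}.
    by apply: continuous_in_subspaceT => y; rewrite inE => /KA; exact: jac_continuous.
  have [b [_ bP]] := compact_bounded (continuous_compact cjac cK).
  exists (`|b| + 1); first by have := normr_ge0 b; lra.
  move=> y Ky; have := bP (`|b| + 1); rewrite ltr_pwDr ?ler_norm // => /(_ isT (jac y)) /=.
  by rewrite ger0_norm ?normr_ge0 //; apply; exists y.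
suff main d : 0 < d -> `|m * I k - m * I h| <= d.
  apply/eqP; rewrite eq_sym -subr_eq0 -(mulrI_eq0 _ (lregP (lt0r_neq0 m0))) mulrBr.
  rewrite -normr_le0; apply/ler_addgt0Pr => d d0; rewrite add0r; exact: main.
move=> d0.
pose v := (2 : R) ^+ n; pose vK := (2 * bK) ^+ n; pose vC := (2 * bC) ^+ n.
have v0 : 0 < v by rewrite exprn_gt0.
have vK0 : 0 < vK by rewrite exprn_gt0 // mulr_gt0.
have vC0 : 0 < vC by rewrite exprn_gt0 // mulr_gt0.
(* [d1] and [d2] give each side half of [d], weighted by the sup norms and by the volumes of cubes
   containing the supports. *)
pose d1 := d / (2 * (bh * vC)); pose d2 := d / (2 * (bJ * v * vK)).
have d10 : 0 < d1 by rewrite divr_gt0 // !mulr_gt0.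
have d20 : 0 < d2 by rewrite divr_gt0 // !mulr_gt0.
have [r r0 rP] := cc_unif (@proper_rV R n) ch d20.
(* One [e] serves all [z] in [C], by the near-covering form of compactness. *)
have [e [e_gt0 ee0 er eP]] : exists e, [/\ 0 < e, e <= e0, e < r &
    forall z, C z -> `|e ^- n * I (fun y => kernel e (y, z)) - m| <= d1].
  pose P (e : R) (z : 'rV[R]_n) := cc (fun y => kernel e (y, z)) ->
    `|e ^- n * I (fun y => kernel e (y, z)) - m| <= d1.
  have : \forall e \near 0^'+, forall z, C z -> P e z.
    move/compact_near_coveringP : (cC); apply => z Cz.
    exact: (mollified_kernel (CB Cz) d10).
  move=> eP; near (0 : R)^'+ => e.
  have e_gt0 : 0 < e by [].
  have ee0 : e <= e0 by near: e; exact: (nbhs_right_le e0_gt0).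
  have er : e < r by near: e; exact: (nbhs_right_lt r0).
  exists e; split => // z Cz; have := cker e z e_gt0 ee0 Cz; move: z Cz.
  by near: e.
have cFe := cF e e_gt0 ee0.
have E1 : I (fun y => I (fun z => F e (y, z))) = I (fun z => I (fun y => F e (y, z))).
  exact: I_fubini.
have pV := @proper_rV R n.
have cI1 : cc (fun y => I (fun z => F e (y, z))) := I_cc pV cFe.
have cI2 : cc (fun z => I (fun y => F e (y, z))).
  apply: (I_cc (g := fun p => F e (p.2, p.1)) pV).
  apply: (cc_comp (phi := fun p : 'rV[R]_n * 'rV[R]_n =>
    (p.2, p.1)) (C := 0) (D := 1) cFe) => //.
    by apply: isometry_continuous => x y; rewrite !prod_normE /= maxC.
  by move=> x; rewrite add0r mul1r !prod_normE /= maxC.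
have en0 : 0 < e ^- n by rewrite invr_gt0 exprn_gt0.
(* For fixed [y] the integral in [z] is [jac y * e ^+ n] times a tent average of [h] over points
   within [e] of [T y], so the modulus of continuity of [h] decides. *)
have B1 : `|e ^- n * I (fun y => I (fun z => F e (y, z))) - m * I k| <= d / 2.
  rewrite -!I_Z // -I_B; [|exact: cc_Z|exact: cc_Z].
  rewrite (_ : d / 2 = bJ * (d2 * v) * vK); last first.
    by rewrite /d2; field; rewrite !gt_eqF // !mulr_gt0.
  have zero y : ~ K e0 y -> e ^- n * I (fun z => F e (y, z)) - m * k y = 0.
    move=> nKy; rewrite (_ : (fun z => F e (y, z)) = fun=> 0); last first.
      apply/funext => z; rewrite /F /=; have [Cz|/h0 ->] := pselect (C z);
        last by rewrite mulr0.
      by rewrite (kernel0 e_gt0 ee0 Cz) ?mul0r.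
    rewrite I_0 mulr0 /k /ind; case: ifPn => [|_]; last by rewrite mulr0 subrr.
    rewrite inE => Ay; rewrite h0 ?mul0r ?mulr0 ?subrr // => CTy; apply: nKy.
    by exists (T y); [exists (T y) => //; rewrite subrr normr0 ltW|have [] := TK Ay].
  apply: I_bound; [by apply: cc_B; exact: cc_Z|exact: ltW| |].
    by move=> y yK; apply: zero => /bKP; rewrite leNgt yK.
  move=> y; have [Ky|/zero ->] := pselect (K e0 y); last first.
    by rewrite normr0; apply: ltW; do 2?apply: mulr_gt0.
  have Ay := KA _ Ky.
  pose f (z : 'rV[R]_n) := tent (e^-1 *: (T y - z)) * h z.
  have cf : cc f.
    have cphi : continuous (fun z : 'rV[R]_n => e^-1 *: (T y - z)).
      apply: (@lipschitz_continuous _ _ _ _ e^-1) => x w.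
      rewrite -scalerBr opprB addrC addrA subrK normrZ gtr0_norm ?invr_gt0 //.
      by rewrite distrC.
    by apply: cc_Ml => // z; exact: (continuous_comp (cphi z) (@continuous_tent n _)).
  pose g (zeta : 'rV[R]_n) := tent zeta * h (T y + e *: zeta).
  have cg : cc g.
    have cphi : continuous (fun zeta : 'rV[R]_n => T y + e *: zeta).
      apply: (@lipschitz_continuous _ _ _ _ e) => u w.
      by rewrite opprD addrACA subrr add0r -scalerBr normrZ gtr0_norm.
    apply: cc_Mr; first exact: cc_tent.
    by move=> x; exact: (continuous_comp (cphi x) (hcont (x := T y + e *: x))).
  have IF : I (fun z => F e (y, z)) = jac y * (e ^+ n * I g).
    have -> : e ^+ n * I g = I f.
      rewrite (I_scale_shift (T y) cf e_gt0); congr (_ * _).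
      congr integral_rV; apply/funext => x; rewrite /f /g.
      by rewrite opprD addrA subrr add0r scalerN scalerA mulVf ?gt_eqF // scale1r tentN.
    rewrite -I_Z //; congr integral_rV; apply/funext => z.
    by rewrite /F /kernel /ind /= mem_set // mulrA.
  rewrite IF mulrCA [X in _ * X]mulrA mulVf; last by rewrite expf_neq0 // gt_eqF.
  rewrite mul1r /k /ind mem_set // [h _ * _]mulrC mulrCA -mulrBr [m * _]mulrC.
  rewrite -I_Z; last exact: cc_tent.
  rewrite -I_B //; last by apply: cc_Z; exact: cc_tent.
  rewrite normrM; apply: ler_pM => //; first by rewrite ger0_norm ?bJP // normr_ge0.
  rewrite (_ : v = (2 * 1) ^+ n); last by rewrite mulr1.
  apply: I_bound => // [|x x1|x].
  - by apply: cc_B => //; apply: cc_Z; exact: cc_tent.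
  - by rewrite /g tent_eq0 ?ltW // mul0r mulr0 subrr.
  rewrite /g [h (T y) * _]mulrC -mulrBr normrM.
  have [x1|/ltW/tent_eq0 ->] := leP `|x| 1; last by rewrite normr0 mul0r ltW.
  rewrite -[leRHS]mul1r; apply: ler_pM => //.
    by rewrite ger0_norm ?tent_ge0 // tent_le1.
  apply: ltW; apply: rP; rewrite addrC addKr normrZ gtr0_norm //.
  by apply: le_lt_trans er; rewrite -[leRHS]mulr1 ler_pM2l.
(* For fixed [z] the factor [h z] comes out, and the kernel integral divided by [e ^+ n] is [m] up
   to [d1]. *)
have B2 : `|e ^- n * I (fun z => I (fun y => F e (y, z))) - m * I h| <= d / 2.
  rewrite -!I_Z // -I_B; [|exact: cc_Z|exact: cc_Z].
  rewrite (_ : d / 2 = (bh * d1) * vC); last first.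
    by rewrite /d1; field; rewrite !gt_eqF // !mulr_gt0.
  apply: I_bound; [by apply: cc_B; exact: cc_Z|exact: ltW| |].
    move=> z zC; have nCz : ~ C z by move=> /bCP; rewrite leNgt zC.
    rewrite h0 // mulr0 subr0 (_ : (fun y => _) = fun=> 0) ?I_0 ?mulr0 //.
    by apply/funext => y; rewrite /F /= h0 // mulr0.
  move=> z; have [Cz|nCz] := pselect (C z); last first.
    rewrite h0 // mulr0 subr0 (_ : (fun y => _) = fun=> 0) ?I_0 ?mulr0 //.
      by rewrite normr0 mulr_ge0 ?ltW.
    by apply/funext => y; rewrite /F /= h0 // mulr0.
  rewrite (_ : I _ = h z * I (fun y => kernel e (y, z))); last first.
    rewrite -I_Z; last exact: cker.
    by congr integral_rV; apply/funext => y; rewrite /F mulrC.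
  rewrite mulrCA [m * _]mulrC -mulrBr normrM.
  by apply: ler_pM => //; exact: eP.
rewrite E1 in B1.
have := ler_distD (e ^- n * I (fun z => I (fun y => F e (y, z)))) (m * I k) (m * I h).
by rewrite [`|m * I k - e ^- n * _|]distrC; lra.
Unshelve. all: by end_near. Qed.

End Mollify.
End Diffeo.
End ChangeOfVariables.

(** * Differential calculus on R^n *)

Section Calculus.
Variable R : realType.

Lemma is_derive_line n (f : 'rV[R]_n -> R) (y v : 'rV[R]_n) (t : R) :
  differentiable f (y + t *: v) ->
  is_derive t (1 : R) (fun s => f (y + s *: v)) ('D_v f (y + t *: v)).
Proof.
move=> df; have dv : derivable f (y + t *: v) v by exact: diff_derivable.
have E : (fun h => h^-1 *: (((fun s => f (y + s *: v)) \o shift t) (h *: (1 : R)) -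
    f (y + t *: v))) =
  (fun h => h^-1 *: ((f \o shift (y + t *: v)) (h *: v) - f (y + t *: v))).
  apply/funext => h /=; congr (_ *: (f _ - _)).
  by rewrite [h *: 1]mulr1 scalerDl addrCA.
by apply: DeriveDef; rewrite /derivable /derive E.
Qed.

Lemma mvt_line n (f : 'rV[R]_n -> R) (y v : 'rV[R]_n) :
  (forall t, 0 <= t <= 1 -> differentiable f (y + t *: v)) ->
  exists2 t, 0 <= t <= 1 &
    f (y + v) - f y = \sum_i v 0 i * 'D_'e_i f (y + t *: v).
Proof.
move=> df.
have := @MVT R (fun t => f (y + t *: v)) (fun t => 'D_v f (y + t *: v)) 0 1 ltr01.
case.
- move=> t; rewrite in_itv /= => /andP[t0 t1]; apply: is_derive_line.
  by apply: df; rewrite !ltW.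
- apply: derivable_within_continuous => t; rewrite in_itv /= => t01.
  exact: (@ex_derive _ _ _ _ _ _ _ (is_derive_line (df t t01))).
move=> t; rewrite in_itv /= => /andP[t0 t1]; rewrite scale1r scale0r addr0 subr0 mulr1.
move=> ->; exists t; first by rewrite !ltW.
by apply: derive_sum_partials; apply: df; rewrite !ltW.
Qed.

(** Balls are convex, so the segment from [y'] to [y] stays where the gradient is within [d] of [c].
    Both points vary, as [strong_diff] requires. *)
Lemma mvt_ball n (f : 'rV[R]_n -> R) (c : 'I_n -> R) x0 r d :
  (forall y, `|y - x0| < r -> differentiable f y) ->
  (forall y, `|y - x0| < r -> \sum_i `|'D_'e_i f y - c i| <= d) ->
  forall y y', `|y - x0| < r -> `|y' - x0| < r ->
    `|f y - f y' - \sum_i (y - y') 0 i * c i| <= d * `|y - y'|.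
Proof.
move=> df cd y y' yr y'r; pose v := y - y'.
have seg t : 0 <= t <= 1 -> `|y' + t *: v - x0| < r.
  move=> /andP[t0 t1].
  rewrite (_ : _ - x0 = t *: (y - x0) + (1 - t) *: (y' - x0)); last first.
    rewrite /v !scalerBr !scalerBl !scale1r.
    by apply/rowP => j; rewrite !mxE; ring.
  apply: le_lt_trans (ler_normD _ _) _; rewrite !normrZ !ger0_norm ?subr_ge0 //.
  set m := Num.max `|y - x0| `|y' - x0|.
  apply: (@le_lt_trans _ _ m); last by rewrite gt_max yr.
  have h1 : t * `|y - x0| <= t * m by rewrite ler_wpM2l // le_max lexx.
  have h2 : (1 - t) * `|y' - x0| <= (1 - t) * m.
    by rewrite ler_wpM2l ?subr_ge0 // le_max lexx orbT.
  by rewrite (_ : m = t * m + (1 - t) * m); [exact: lerD | ring].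
have [t t01] := mvt_line (fun t t01 => df _ (seg t t01)).
have yE : y' + v = y by rewrite /v addrC subrK.
rewrite yE => ->; rewrite -sumrB.
apply: le_trans (ler_norm_sum _ _ _) _.
apply: (@le_trans _ _ (\sum_i `|'D_'e_i f (y' + t *: v) - c i| * `|v|)).
  apply: ler_sum => i _; rewrite -mulrBr normrM mulrC ler_wpM2l //.
  exact: rV_coord_le.
by rewrite -mulr_suml ler_wpM2r // cd // seg.
Qed.

Lemma differentiable_linear_approx (V W : normedModType R) (f : V -> W)
    (df : {linear V -> W}) x : continuous df ->
  (forall e, 0 < e -> exists2 d, 0 < d & forall y, `|y - x| < d ->
    `|f y - f x - df (y - x)| <= e * `|y - x|) ->
  differentiable f x /\ 'd f x = df :> (V -> W).
Proof.
move=> cdf fs.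
have E : f \o shift x = cst (f x) + df +o_ 0 id.
  apply/eqaddoP => e e0; have [d d0 dP] := fs _ e0.
  apply/nbhs_ballP; exists d => //= h; rewrite -ball_normE /= sub0r normrN => hd.
  have := dP (h + x); rewrite addrK => /(_ hd).
  by rewrite /GRing.add /GRing.opp /= /cst /= opprD addrA.
have dE := diff_unique cdf E.
split; last exact: dE.
by apply/diff_locallyP; split; rewrite dE.
Qed.

Lemma differentiable_strong n (f : 'rV[R]_n -> R) (c : 'I_n -> R) x :
  (forall e, 0 < e -> exists2 d, 0 < d & forall y, `|y - x| < d ->
    `|f y - f x - \sum_i (y - x) 0 i * c i| <= e * `|y - x|) ->
  differentiable f x /\ forall i, 'D_'e_i f x = c i.
Proof.
move=> fs.
pose L (y : 'rV[R]_n) : R := \sum_i y 0 i * c i.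
have Llin : linear (L : 'rV[R]_n -> R^o).
  move=> a u v; rewrite /L scaler_sumr -big_split /=; apply: eq_bigr => i _.
  by rewrite !mxE mulrDl; congr (_ + _); exact: (esym (mulrA _ _ _)).
pose LM := GRing.isLinear.Build _ _ _ _ _ Llin.
pose LL : {linear 'rV[R]_n -> R} := HB.pack (L : 'rV[R]_n -> R) LM.
have cL : continuous LL.
  apply: (@lipschitz_continuous _ _ _ _ (\sum_i `|c i|)) => y z.
  rewrite -linearB /= /L mulr_suml; apply: le_trans (ler_norm_sum _ _ _) _.
  by apply: ler_sum => i _; rewrite normrM mulrC ler_wpM2l // rV_coord_le.
have [df dE] := @differentiable_linear_approx _ _ f LL x cL fs.
split=> // i; rewrite deriveE // dE /= /L (bigD1 i) //= big1 => [|j ji].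
  by rewrite mxE !eqxx mul1r addr0.
by rewrite mxE (negbTE ji) andbF mul0r.
Qed.

Lemma derive_coord n (x v : 'rV[R]_n) j :
  'D_v (fun y : 'rV[R]_n => y 0 j : R) x = v 0 j.
Proof.
have E (w : 'rV[R]_n) : \sum_i w 0 i * (i == j)%:R = w 0 j.
  rewrite (bigD1 j) //= eqxx mulr1 big1 ?addr0 // => i /negbTE ->.
  by rewrite mulr0.
have [|df dE] := @differentiable_strong n (fun y => y 0 j) (fun i => (i == j)%:R) x.
  by move=> e e0; exists 1 => // y _; rewrite E !mxE subrr normr0 mulr_ge0 // ltW.
rewrite derive_sum_partials // -[RHS]E; apply: eq_bigr => i _.
by rewrite dE.
Qed.

Lemma diff_coord n m (T : 'rV[R]_n -> 'rV[R]_m) x v j : differentiable T x ->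
  'd T x v 0 j = 'D_v (fun x => T x 0 j) x.
Proof.
move=> dT; have dc := differentiable_coord (T x) 0 j.
rewrite deriveE; last exact: (differentiable_comp dT dc).
by rewrite (diff_comp dT dc) /= -[RHS]deriveE // derive_coord.
Qed.

Lemma jacobianE n (T : 'rV[R]_n -> 'rV[R]_n) x i j : differentiable T x ->
  jacobian T x i j = 'D_'e_i (fun x => T x 0 j) x.
Proof. by move=> dT; rewrite mxE diff_coord. Qed.

Lemma smooth_map_differentiable n m (A : set 'rV[R]_n)
    (T : 'rV[R]_n -> 'rV[R]_m) x :
  smooth_map_on A T -> A x -> differentiable T x.
Proof. by move=> sT Ax; apply: differentiable_rV => j; exact: (sT j [::]). Qed.

Lemma osc_partials n (A : set 'rV[R]_n) (f : 'rV[R]_n -> R) x0 d :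
  open A -> A x0 -> (forall y, A y -> differentiable f y) ->
  (forall i, {for x0, continuous (fun y => 'D_'e_i f y)}) -> 0 < d ->
  exists2 r, 0 < r & forall y, `|y - x0| < r ->
    A y /\ \sum_i `|'D_'e_i f y - 'D_'e_i f x0| <= d.
Proof.
move=> oA Ax0 df cf d0.
have [r1 r10 r1P] := open_normP oA Ax0.
(* [n.+1] in place of [n] keeps the quotient positive in dimension zero. *)
have dn0 : 0 < d / n.+1%:R by rewrite divr_gt0.
have [r2 r20 r2P] : exists2 r, 0 < r & forall y i, `|y - x0| < r ->
    `|'D_'e_i f y - 'D_'e_i f x0| < d / n.+1%:R.
  have /choice[r rP] i : exists r, 0 < r /\ forall y, `|y - x0| < r ->
      `|'D_'e_i f y - 'D_'e_i f x0| < d / n.+1%:R.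
    have /continuous_at_normP/(_ _ dn0)[r r0 rP] := cf i.
    by exists r; split=> // y; rewrite distrC => /rP; rewrite distrC.
  exists (\big[Num.min/1]_i r i).
    by elim/big_ind : _ => // [u v u0 v0|i _]; [rewrite lt_min u0 | case: (rP i)].
  move=> y i yr; apply: (rP i).2; apply: lt_le_trans yr _.
  exact: bigmin_le_cond.
exists (Num.min r1 r2); first by rewrite lt_min r10.
move=> y; rewrite lt_min => /andP[y1 y2]; split; first exact: r1P.
apply: (@le_trans _ _ (\sum_(i < n) d / n.+1%:R)).
  by apply: ler_sum => i _; rewrite ltW // r2P.
rewrite sumr_const card_ord -[leLHS]mulr_natr mulrAC ler_pdivrMr //.
by rewrite ler_pM2l // ler_nat.
Qed.

Lemma partials_continuous n (A : set 'rV[R]_n) (f : 'rV[R]_n -> R) s x :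
  smooth_on A f -> A x -> {for x, continuous (partials s f)}.
Proof. by move=> sf Ax; apply: differentiable_continuous; exact: sf. Qed.

Lemma smooth_strong_diff n (A : set 'rV[R]_n) (T : 'rV[R]_n -> 'rV[R]_n) :
  open A -> smooth_map_on A T -> strong_diff A T (jacobian T).
Proof.
move=> oA sT y0 d Ay0 d0.
have /choice[r rP] j : exists r, 0 < r /\ forall y y', `|y - y0| < r -> `|y' - y0| < r ->
    `|(T y - T y' - (y - y') *m jacobian T y0) 0 j| <= d * `|y - y'|.
  have dT y : A y -> differentiable (fun x => T x 0 j) y := sT j [::] y.
  have cT i : {for y0, continuous (fun y => 'D_'e_i (fun x => T x 0 j) y)}.
    exact: (partials_continuous (s := [:: i]) (sT j) Ay0).
  have [r r0 rP] := osc_partials oA Ay0 dT cT d0.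
  exists r; split=> // y y' yr y'r.
  have := mvt_ball (fun y yr => dT _ (rP y yr).1) (fun y yr => (rP y yr).2) yr y'r.
  rewrite !mxE; set s1 := \sum_i _; set s2 := \sum_i _; suff -> : s1 = s2 by [].
  apply: eq_bigr => i _; congr (_ * _).
  by rewrite jacobianE //; exact: smooth_map_differentiable sT Ay0.
exists (\big[Num.min/1]_j r j).
  by elim/big_ind : _ => // [u v u0 v0|i _]; [rewrite lt_min u0 | case: (rP i)].
move=> y y' yr y'r; rewrite rV_norm_le; last by rewrite mulr_ge0 // ltW.
apply/forallP => j; apply: (rP j).2.
  by apply: lt_le_trans yr _; exact: bigmin_le_cond.
by apply: lt_le_trans y'r _; exact: bigmin_le_cond.
Qed.

Lemma near_eq_continuous (V W : topologicalType) (f g : V -> W) x :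
  (\near x, f x = g x) -> {for x, continuous f} -> {for x, continuous g}.
Proof.
move=> fg cf; rewrite /prop_for /continuous_at -(nbhs_singleton fg).
exact: cvg_trans (near_eq_cvg fg) cf.
Qed.

Lemma continuous_at_sum (V : topologicalType) (I : Type) (r : seq I)
    (f : I -> V -> R) x : (forall i, {for x, continuous (f i)}) ->
  {for x, continuous (fun y => \sum_(i <- r) f i y)}.
Proof.
move=> cf; elim: r => [|i r IH].
  have -> : (fun y => \sum_(i <- [::]) f i y) = fun=> 0.
    by apply/funext => y; rewrite big_nil.
  exact: cvg_cst.
have -> : (fun y => \sum_(j <- i :: r) f j y) = fun y => f i y + \sum_(j <- r) f j y.
  by apply/funext => y; rewrite big_cons.
exact: (cvgD (cf i) IH).
Qed.

Lemma continuous_at_prod (V : topologicalType) (I : Type) (r : seq I)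
    (f : I -> V -> R) x : (forall i, {for x, continuous (f i)}) ->
  {for x, continuous (fun y => \prod_(i <- r) f i y)}.
Proof.
move=> cf; elim: r => [|i r IH].
  have -> : (fun y => \prod_(i <- [::]) f i y) = fun=> 1.
    by apply/funext => y; rewrite big_nil.
  exact: cvg_cst.
have -> : (fun y => \prod_(j <- i :: r) f j y) = fun y => f i y * \prod_(j <- r) f j y.
  by apply/funext => y; rewrite big_cons.
exact: (cvgM (cf i) IH).
Qed.

Lemma det_jacobian_continuous n (A : set 'rV[R]_n) (T : 'rV[R]_n -> 'rV[R]_n) x :
  open A -> smooth_map_on A T -> A x ->
  {for x, continuous (fun y => \det (jacobian T y))}.
Proof.
move=> oA sT Ax.
pose D (y : 'rV[R]_n) := \sum_(s : 'S_n) (-1) ^+ s *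
  \prod_i 'D_'e_i (fun x => T x 0 (s i)) y.
have DE : \forall y \near x, D y = \det (jacobian T y).
  apply: filterS (open_nbhs_nbhs (conj oA Ax)) => y Ay.
  apply: eq_bigr => s _; congr (_ * _); apply: eq_bigr => i _.
  by rewrite jacobianE //; exact: smooth_map_differentiable sT Ay.
apply: near_eq_continuous DE _; apply: continuous_at_sum => s.
have cp : {for x, continuous (fun y => \prod_i 'D_'e_i (fun x => T x 0 (s i)) y)}.
  apply: continuous_at_prod => i.
  exact: (partials_continuous (s := [:: i]) (sT (s i)) Ax).
exact: (cvgM (cvg_cst _) cp).
Qed.

End Calculus.

(** * Chain rule, inverses and bump functions *)

Section SmoothFunctions.
Variable R : realType.

Lemma ksmooth_on_sum n (A : set 'rV[R]_n) k (I : Type) (r : seq I)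
    (F : I -> 'rV[R]_n -> R) : open A ->
  (forall i, ksmooth_on k A (F i)) ->
  ksmooth_on k A (fun x => \sum_(i <- r) F i x).
Proof.
move=> oA sF; elim: r => [|i r IH].
  by apply: (ksmooth_on_eq oA _ (@ksmooth_on_cst _ _ _ oA k 0)) => x _; rewrite big_nil.
by apply: (ksmooth_on_eq oA _ (ksmooth_onD oA (sF i) IH)) => x _; rewrite big_cons.
Qed.

Lemma derive_comp_rV n m (t : 'rV[R]_n -> 'rV[R]_m) (g : 'rV[R]_m -> R) x v :
  differentiable t x -> differentiable g (t x) ->
  'D_v (fun x => g (t x)) x =
    \sum_j 'D_v (fun x => t x 0 j) x * 'D_'e_j g (t x).
Proof.
move=> dt dg; rewrite deriveE; last exact: (differentiable_comp dt dg).
rewrite (diff_comp dt dg) /= -[LHS]deriveE // derive_sum_partials //.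
by apply: eq_bigr => j _; rewrite diff_coord.
Qed.

(** Induction on the order: the chain rule writes each partial derivative by sums and products of
    functions of one order less, among them compositions with the same [t]. *)
Lemma ksmooth_on_comp k n m (A : set 'rV[R]_n) (B : set 'rV[R]_m)
    (t : 'rV[R]_n -> 'rV[R]_m) (g : 'rV[R]_m -> R) :
  open A -> open B -> (forall x, A x -> B (t x)) ->
  (forall j, ksmooth_on k A (fun x => t x 0 j)) -> ksmooth_on k B g ->
  ksmooth_on k A (fun x => g (t x)).
Proof.
move=> oA oB AB; elim: k g => [|k IH] g st sg.
  apply/ksmooth_on0 => x Ax; apply: (differentiable_comp (f := t)).
    by apply: differentiable_rV => j; exact: ksmooth_on_diff (st j) Ax.
  exact: ksmooth_on_diff sg (AB _ Ax).
have dt x : A x -> differentiable t x.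
  by move=> Ax; apply: differentiable_rV => j; exact: ksmooth_on_diff (st j) Ax.
have dg x : A x -> differentiable g (t x).
  by move=> Ax; exact: ksmooth_on_diff sg (AB _ Ax).
apply/ksmooth_onS; split=> [x Ax|i].
  exact: (differentiable_comp (dt _ Ax) (dg _ Ax)).
have s1 : ksmooth_on k A (fun x =>
    \sum_j 'D_'e_i (fun x => t x 0 j) x * 'D_'e_j g (t x)).
  apply: ksmooth_on_sum => // j; apply: ksmooth_onM => //.
    by have /ksmooth_onS[_] := st j; exact.
  apply: (IH (fun y => 'D_'e_j g y)) => [l|]; first by apply: ksmooth_onW; exact: st.
  by have /ksmooth_onS[_] := sg; exact.
by apply: (ksmooth_on_eq oA _ s1) => x Ax; rewrite derive_comp_rV //; [exact: dt|exact: dg].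
Qed.

Lemma smooth_on_comp n m (A : set 'rV[R]_n) (B : set 'rV[R]_m)
    (t : 'rV[R]_n -> 'rV[R]_m) (g : 'rV[R]_m -> R) :
  open A -> open B -> (forall x, A x -> B (t x)) ->
  smooth_map_on A t -> smooth_on B g -> smooth_on A (fun x => g (t x)).
Proof.
move=> oA oB AB st /smooth_onE sg; apply/smooth_onE => k.
by apply: (ksmooth_on_comp oA oB AB) => // j; have /smooth_onE := st j.
Qed.

Lemma ksmooth_on_inv k n (A : set 'rV[R]_n) (g : 'rV[R]_n -> R) : open A ->
  (forall x, A x -> g x != 0) -> ksmooth_on k A g ->
  ksmooth_on k A (fun x => (g x)^-1).
Proof.
move=> oA g0; elim: k => [|k IH].
  move=> /ksmooth_on0 sg; apply/ksmooth_on0 => x Ax.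
  by apply: differentiableV; [exact: sg | exact: g0].
move=> sg1; have /ksmooth_onS[dg sg] := sg1; apply/ksmooth_onS; split=> [x Ax|i].
  by apply: differentiableV; [exact: dg | exact: g0].
have si := IH (ksmooth_onW sg1).
have s1 := ksmooth_onM oA (@ksmooth_on_cst _ _ _ oA k (-1))
  (ksmooth_onM oA (ksmooth_onM oA si si) (sg i)).
apply: (ksmooth_on_eq oA _ s1) => x Ax.
rewrite deriveV; [|exact: g0 | by apply: diff_derivable; exact: dg].
by rewrite mulN1r -expr2 exprVn -mulNr.
Qed.

Lemma smooth_on_inv n (A : set 'rV[R]_n) (g : 'rV[R]_n -> R) : open A ->
  (forall x, A x -> g x != 0) -> smooth_on A g ->
  smooth_on A (fun x => (g x)^-1).
Proof.
move=> oA g0 /smooth_onE sg; apply/smooth_onE => k.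
exact: ksmooth_on_inv.
Qed.

Lemma smooth_on_coord n (A : set 'rV[R]_n) j : open A ->
  smooth_on A (fun x => x 0 j).
Proof.
move=> oA; apply/smooth_onE => -[|k]; first by apply/ksmooth_on0 => x _;
  exact: differentiable_coord.
apply/ksmooth_onS; split=> [x _|i]; first exact: differentiable_coord.
by apply: (ksmooth_on_eq oA _ (@ksmooth_on_cst _ _ _ oA k (('e_i : 'rV[R]_n) 0 j))) =>
  x _; rewrite derive_coord.
Qed.

Lemma smooth_on_subset n (A B : set 'rV[R]_n) (g : 'rV[R]_n -> R) :
  A `<=` B -> smooth_on B g -> smooth_on A g.
Proof. by move=> AB sg s x /AB; exact: sg. Qed.

Lemma derive_comp_R n (F : R -> R) (u : 'rV[R]_n -> R) x dF :
  is_derive (u x) (1 : R) F dF -> differentiable u x ->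
  differentiable (fun x => F (u x)) x /\
  forall v, 'D_v (fun x => F (u x)) x = dF * 'D_v u x.
Proof.
move=> [dF1 dFE] du; have dF' : differentiable F (u x) by exact/derivable1_diffP.
split=> [|v]; first exact: (differentiable_comp du dF').
rewrite deriveE; last exact: (differentiable_comp du dF').
rewrite (diff_comp du dF') /= -[in RHS]dFE !deriveE //.
by rewrite -[X in 'd F _ X]mulr1 -[X in 'd F _ X]/(_ *: (1 : R^o)) linearZ mulrC.
Qed.

(* The functions [flat m], for all [m], are stable under differentiation up to
   linear combinations, and they all vanish to second order at [0]. *)
Definition flat m (t : R) : R := if 0 < t then t^-1 ^+ m * expR (- t^-1) else 0.

Lemma flat_ge0 m t : 0 <= flat m t.
Proof.
rewrite /flat; case: ifPn => // t0.
by rewrite mulr_ge0 ?expR_ge0 // exprn_ge0 // invr_ge0 ltW.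
Qed.

(** This is the exponential series bound [expR s >= s^(m+1) / (m+1)!] at [s = 1/t]. *)
Lemma flat_bound m t : flat m t <= m.+1`!%:R * `|t|.
Proof.
rewrite /flat; case: ifPn => [t0|_]; last by rewrite mulr_ge0.
have s0 : 0 < t^-1 by rewrite invr_gt0.
have f0 : 0 < m.+1`!%:R :> R by rewrite ltr0n fact_gt0.
have h : t^-1 ^+ m.+1 <= expR t^-1 * m.+1`!%:R.
  by rewrite -ler_pdivrMr //; have := @expR_ge1Dxn _ _ m (ltW s0); lra.
rewrite gtr0_norm // expRN ler_pdivrMr ?expR_gt0 // -(ler_pM2r s0) -exprSr.
by rewrite mulrAC -[_ * t * _]mulrA divff ?gt_eqF // mulr1 [leRHS]mulrC.
Qed.

Lemma flat_shift m t : 0 < t -> flat m t = t * flat m.+1 t.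
Proof.
by move=> t0; rewrite /flat t0 exprS !mulrA divff ?gt_eqF // mul1r.
Qed.

Lemma is_derive_flat m t :
  is_derive t (1 : R) (flat m) (flat m.+2 t - m%:R * flat m.+1 t).
Proof.
case: (ltgtP t 0) => [t0|t0|->].
- have E : \forall s \near t, 0 = flat m s.
    apply: filterS (lt_nbhsl t0) => s s0; rewrite /flat ltNge ltW //.
  rewrite /flat !ltNge !(ltW t0) /= mulr0 subr0.
  exact: near_eq_is_derive E (is_derive_cst (0 : R) t (1 : R)).
- pose f (s : R) := s^-1 ^+ m * expR (- s^-1).
  have E : \forall s \near t, f s = flat m s.
    by apply: filterS (lt_nbhsr t0) => s s0; rewrite /flat s0.
  apply: near_eq_is_derive E _; rewrite /flat t0.
  have tn0 : t != 0 by rewrite gt_eqF.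
  have dV : is_derive t (1 : R) (fun s : R => s^-1) (- t ^- 2).
    by have := is_deriveV tn0 (is_derive_id t (1 : R)); rewrite [_ *: _]mulr1.
  have dE : is_derive t (1 : R) (fun s : R => expR (- s^-1)) (expR (- t^-1) * t ^- 2).
    by have := @is_derive1_comp R expR (fun s =>
      - s^-1) t _ _ (is_derive_expR _) (is_deriveN dV); rewrite opprK.
  have fE : f = ((fun s => s^-1) ^+ m) * (fun s => expR (- s^-1)).
    by apply/funext => s; rewrite /f /GRing.mul /= exprfctE.
  have dM := is_deriveM (is_deriveX m dV) dE.
  rewrite fE; apply: (is_derive_eq dM); rewrite exprfctE -exprVn.
  rewrite -![_ *: _]/(_ * _).
  case: (m) => [|k] /=; rewrite ?exprS; ring.
(* At [0] the claimed derivative is zero: for [y > 0], [flat m y = y * flat m.+1 y] is at most a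
   multiple of [y ^+ 2]. *)
- have [||df dE] := @differentiable_linear_approx R R R (flat m) (\0 : {linear R -> R}) 0.
  + by move=> z; exact: cvg_cst.
  + move=> e e0; have f0 : 0 < m.+2`!%:R :> R by rewrite ltr0n fact_gt0.
    exists (e / m.+2`!%:R); first by rewrite divr_gt0.
    move=> y; rewrite subr0 ltr_pdivlMr // => ye.
    rewrite [flat m 0]/flat ltxx !subr0 ger0_norm ?flat_ge0 //.
    have [y0|y0] := ltP 0 y; last by rewrite /flat ltNge y0 /= mulr_ge0 // ltW.
    rewrite flat_shift // mulrC gtr0_norm // ler_pM2r //.
    by apply: le_trans (flat_bound _ _) _; rewrite mulrC ltW.
  rewrite /flat ltxx mulr0 subr0; apply: DeriveDef; first exact/derivable1_diffP.
  by rewrite deriveE // dE.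
Qed.

Lemma ksmooth_on_flat k n (A : set 'rV[R]_n) (u : 'rV[R]_n -> R) m : open A ->
  ksmooth_on k A u -> ksmooth_on k A (fun x => flat m (u x)).
Proof.
move=> oA; elim: k m => [|k IH] m.
  move=> /ksmooth_on0 su; apply/ksmooth_on0 => x Ax.
  by have [] := derive_comp_R (is_derive_flat m (u x)) (su x Ax).
move=> su1; have /ksmooth_onS[du su] := su1; apply/ksmooth_onS; split=> [x Ax|i].
  by have [] := derive_comp_R (is_derive_flat m (u x)) (du x Ax).
have su0 := ksmooth_onW su1.
have s1 := ksmooth_onM oA (ksmooth_onD oA (IH m.+2 su0)
  (ksmooth_onM oA (@ksmooth_on_cst _ _ _ oA k (- m%:R)) (IH m.+1 su0))) (su i).
apply: (ksmooth_on_eq oA _ s1) => x Ax.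
by have [_ ->] := derive_comp_R (is_derive_flat m (u x)) (du x Ax); rewrite mulNr.
Qed.

(** The bump is [flat 0] of [r^2] minus the squared Euclidean distance: the sup norm is not smooth,
    and the Euclidean ball lies inside the sup ball. *)
Lemma bump_rV n (p : 'rV[R]_n) r : 0 < r -> exists b : 'rV[R]_n -> R,
  [/\ smooth_on setT b, forall x, 0 <= b x, 0 < b p &
      forall x, r <= `|x - p| -> b x = 0].
Proof.
move=> r0; pose q (x : 'rV[R]_n) := \sum_j (x 0 j - p 0 j) ^+ 2.
have oT : open [set: 'rV[R]_n] by exact: openT.
exists (fun x => flat 0 (r ^+ 2 + -1 * q x)); split.
- apply/smooth_onE => k; apply: ksmooth_on_flat => //.
  apply: (ksmooth_onD oT); first exact: (@ksmooth_on_cst _ _ _ oT).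
  apply: (ksmooth_onM oT); first exact: (@ksmooth_on_cst _ _ _ oT).
  apply: ksmooth_on_sum => // j.
  have sj : ksmooth_on k setT (fun x : 'rV[R]_n => x 0 j + - p 0 j).
    apply: (ksmooth_onD oT); last exact: (@ksmooth_on_cst _ _ _ oT).
    by have /smooth_onE := @smooth_on_coord n setT j oT.
  exact: (ksmooth_onM oT sj sj).
- by move=> x; exact: flat_ge0.
- rewrite /q big1 => [|j _]; last by rewrite subrr expr0n.
  by rewrite mulr0 addr0 /flat exprn_gt0 // expr0 mul1r expR_gt0.
- move=> x rx; rewrite /flat ifF //; apply/negP; rewrite mulN1r subr_gt0 => qr.
  move: rx; rewrite leNgt => /negP; apply.
  have q0 : 0 <= q x by apply: sumr_ge0 => j _; exact: sqr_ge0.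
  apply: (@le_lt_trans _ _ (Num.sqrt (q x))); last first.
    by rewrite -(ger0_norm (ltW r0)) -sqrtr_sqr ltr_sqrt // exprn_gt0.
  rewrite rV_norm_le ?sqrtr_ge0 //; apply/forallP => j.
  rewrite -sqrtr_sqr ler_sqrt // !mxE /q (bigD1 j) //= lerDl.
  by apply: sumr_ge0 => i _; exact: sqr_ge0.
Qed.

End SmoothFunctions.

(** * Series of smooth functions *)

Section GeometricSeries.
Variable R : realType.

Definition ssum (u : nat -> R) : R := limn (series u).

(** The ratio [1/3] is small enough for a term of the gliding hump to outweigh all later ones. *)
Definition gdom (u : nat -> R) (C : R) := forall j, `|u j| <= C * 3^-1 ^+ j.

Lemma gdom_cvg u C : gdom u C -> cvgn (series u).
Proof.
move=> uC; apply: normed_cvg.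
apply: (@series_le_cvg _ _ (geometric C 3^-1)) => [j|j|//|]; first exact: normr_ge0.
  by apply: le_trans (uC j).
by apply: is_cvg_geometric_series; rewrite ger0_norm ?invr_ge0 // invf_lt1 // ltr1n.
Qed.

Lemma gdom_tail u C N : gdom u C ->
  `|ssum u - series u N| <= C * 3 / 2 * 3^-1 ^+ N.
Proof.
move=> uC; have cu := gdom_cvg uC.
have C0 : 0 <= C by have := uC 0%N; rewrite expr0 mulr1; apply: le_trans.
(* The subtracted power lets the induction close; it is dropped in the limit. *)
have tail k : `|series u (N + k)%N - series u N| <=
    C * 3 / 2 * (3^-1 ^+ N - 3^-1 ^+ (N + k)).
  elim: k => [|k IH]; first by rewrite addn0 !subrr normr0 mulr0.
  rewrite addnS seriesS /= -addrA; apply: le_trans (ler_normD _ _) _.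
  have := uC (N + k)%N; rewrite exprS.
  set x := 3^-1 ^+ (N + k) in IH *; set y := 3^-1 ^+ N in IH *.
  by move=> h; lra.
apply/ler_addgt0Pr => e e0.
have /cvgrPdist_lt/(_ _ e0)[K _ KP] := cu.
have := KP (N + K)%N (leq_addl _ _) => /= h1; have h2 := tail K.
have h3 : 0 <= C * 3 / 2 * 3^-1 ^+ (N + K).
  by rewrite mulr_ge0 ?exprn_ge0 ?invr_ge0 // divr_ge0 // mulr_ge0.
have := ler_distD (series u (N + K)%N) (ssum u) (series u N).
by move: h1; rewrite /ssum; lra.
Qed.

Lemma ssum_le u C : gdom u C -> `|ssum u| <= C * 3 / 2.
Proof.
move=> uC; have := gdom_tail 0 uC; rewrite expr0 mulr1.
by rewrite /series /= big_geq // subr0.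
Qed.

Lemma ssum_lin u v C D c : gdom u C -> gdom v D ->
  ssum (fun j => c * u j + v j) = c * ssum u + ssum v.
Proof.
move=> /gdom_cvg cu /gdom_cvg cv; rewrite /ssum.
rewrite -[c * limn _]/(c *: limn _) -lim_seriesZ // -lim_seriesD //.
exact: is_cvg_seriesZ.
Qed.

Lemma ssum0 : ssum (fun=> 0) = 0.
Proof.
apply/eqP; rewrite -normr_le0.
have : gdom (fun=> 0) 0 by move=> j; rewrite normr0 mul0r.
by move=> /ssum_le; rewrite !mul0r.
Qed.

Lemma ssumZ u C c : gdom u C -> ssum (fun j => c * u j) = c * ssum u.
Proof.
move=> uC; have z : gdom (fun=> 0) 0 by move=> j; rewrite normr0 mul0r.
have := ssum_lin c uC z; rewrite ssum0 addr0 => <-; congr ssum.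
by apply/funext => j; rewrite addr0.
Qed.

Lemma ssumB u v C D : gdom u C -> gdom v D ->
  ssum (fun j => u j - v j) = ssum u - ssum v.
Proof.
move=> uC vD; rewrite [RHS]addrC -mulN1r -(ssum_lin (-1) vD uC); congr ssum.
by apply/funext => j; rewrite mulN1r addrC.
Qed.

Lemma differentiable_expansion n (f : 'rV[R]_n -> R) x e :
  differentiable f x -> 0 < e -> exists2 d, 0 < d & forall y, `|y - x| < d ->
    `|f y - f x - \sum_i (y - x) 0 i * 'D_'e_i f x| <= e * `|y - x|.
Proof.
move=> df e0; have /eqaddoP/(_ e e0) := diff_locally df.
move=> /nbhs_ballP[d /= d0 dP]; exists d => // y yx.
have := dP (y - x); rewrite -ball_normE /= sub0r normrN => /(_ yx).
set z := (X in `|X| <= _ -> _); suff -> : z = f y - f x -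
    \sum_i (y - x) 0 i * 'D_'e_i f x by [].
rewrite -derive_sum_partials // deriveE //.
by rewrite -[z]/(f (y - x + x) - (f x + 'd f x (y - x))) subrK opprD addrA.
Qed.

Variable a : nat -> R.
Hypothesis a3 : gdom a 1.

Lemma gdomM (u : nat -> R) C : (forall j, `|u j| <= C) ->
  gdom (fun j => a j * u j) C.
Proof.
move=> uC j; rewrite normrM mulrC ler_pM //.
by have := a3 j; rewrite mul1r.
Qed.

(** One cut [N] serves all [y]: the head is a finite sum, and since the increments of [h j] are at
    most [C * |y - x|] uniformly in [j], the tail is small relative to [|y - x|]. *)
Lemma derive_series n (A : set 'rV[R]_n) (h : nat -> 'rV[R]_n -> R) C0 C1 :
  open A -> (forall j x, A x -> differentiable (h j) x) ->
  (forall j x, A x -> `|h j x| <= C0) ->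
  (forall j i x, A x -> `|'D_'e_i (h j) x| <= C1) ->
  forall x, A x -> differentiable (fun x => ssum (fun j => a j * h j x)) x /\
    forall i, 'D_'e_i (fun x => ssum (fun j => a j * h j x)) x =
      ssum (fun j => a j * 'D_'e_i (h j) x).
Proof.
move=> oA dh hC0 hC1 x Ax; apply: differentiable_strong => e e0.
have [r r0 rA] := open_normP oA Ax.
pose C := n%:R * `|C1|; have C_ge0 : 0 <= C by rewrite mulr_ge0.
have D1 j i y : A y -> `|'D_'e_i (h j) y| <= `|C1|.
  by move=> Ay; apply: le_trans (hC1 _ _ _ Ay) (ler_norm _).
have [N NP] : exists N, C * 3 / 2 * 3^-1 ^+ N < e / 4.
  have q1 : `|3^-1 : R| < 1 by rewrite ger0_norm ?invr_ge0 // invf_lt1 // ltr1n.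
  have e4 : 0 < e / 4 by rewrite divr_gt0.
  have /cvgrPdist_lt/(_ _ e4)[N _ NP] := cvg_geometric (C * 3 / 2) q1.
  exists N; have := NP N (leqnn _); rewrite /= sub0r normrN; apply: le_lt_trans.
  exact: ler_norm.
pose P := \sum_(0 <= j < N) (fun y : 'rV[R]_n => a j * h j y).
have PE y : P y = series (fun j => a j * h j y) N by rewrite /P fct_sumE.
have dP : differentiable P x /\
    forall i, 'D_'e_i P x = series (fun j => a j * 'D_'e_i (h j) x) N.
  rewrite /P /series /=; elim: (N) => [|k [IH1 IH2]].
    rewrite big_geq //; split=> [|i]; first exact: differentiable_cst.
    by rewrite big_geq // derive_cst.
  have dk : differentiable (fun y => a k * h k y) x.
    by apply: differentiableM; [exact: differentiable_cst | exact: dh].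
  rewrite big_nat_recr //=; split=> [|i]; first exact: differentiableD.
  rewrite big_nat_recr //= -IH2 deriveD; [|exact: diff_derivable|exact: diff_derivable].
  congr (_ + _); rewrite deriveM; [|by []|by apply: diff_derivable; exact: dh].
  by rewrite derive_cst scaler0 addr0.
have e2 : 0 < e / 2 by rewrite divr_gt0.
have [d d0 dP'] := differentiable_expansion dP.1 e2.
exists (Num.min d r); first by rewrite lt_min d0.
move=> y; rewrite lt_min => /andP[yd yr]; have Ay := rA _ yr.
pose u j := a j * (h j y - h j x).
pose v i j := a j * 'D_'e_i (h j) x.
have uC : gdom u (C * `|y - x|).
  apply: gdomM => j.
  have dhj z : `|z - x| < r -> differentiable (h j) z by move=> /rA; exact: dh.
  have bhj z : `|z - x| < r -> \sum_i `|'D_'e_i (h j) z - 0| <= C.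
    move=> /rA Az; rewrite /C -[n in n%:R]card_ord -sumr_const mulr_suml.
    by apply: ler_sum => i _; rewrite subr0 mul1r D1.
  have xx : `|x - x| < r by rewrite subrr normr0.
  have := mvt_ball dhj bhj yr xx.
  by rewrite big1 ?subr0 // => i _; rewrite mulr0.
have vC i : gdom (v i) `|C1| by apply: gdomM => j; exact: D1.
have gh z : A z -> gdom (fun j => a j * h j z) C0.
  by move=> Az; apply: gdomM => j; exact: hC0.
have uE : ssum (fun j => a j * h j y) - ssum (fun j => a j * h j x) = ssum u.
  rewrite -(ssumB (gh _ Ay) (gh _ Ax)); congr ssum; apply/funext => j.
  by rewrite /u mulrBr.
have uN : series u N = P y - P x.
  rewrite !PE /series /= -sumrB; apply: eq_bigr => j _.
  by rewrite /u mulrBr.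
have h1 := gdom_tail N uC; have h2 := dP' _ yd.
have h3 : `|\sum_i (y - x) 0 i * (ssum (v i) - 'D_'e_i P x)| <= `|y - x| * (e / 4).
  apply: (@le_trans _ _ (\sum_(i < n) `|y - x| * (`|C1| * 3 / 2 * 3^-1 ^+ N))).
    apply: le_trans (ler_norm_sum _ _ _) _; apply: ler_sum => i _.
    rewrite normrM; apply: ler_pM => //; first exact: rV_coord_le.
    by rewrite dP.2; exact: gdom_tail.
  rewrite sumr_const card_ord -mulrnAr ler_wpM2l //.
  apply: le_trans (ltW NP); rewrite /C -[leLHS]mulr_natl !mulrA //.
rewrite uE.
have -> : ssum u - \sum_i (y - x) 0 i * ssum (v i) =
  (ssum u - series u N) + (P y - P x - \sum_i (y - x) 0 i * 'D_'e_i P x) -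
  \sum_i (y - x) 0 i * (ssum (v i) - 'D_'e_i P x).
  rewrite uN (_ : \sum_i (y - x) 0 i * (ssum (v i) - 'D_'e_i P x) =
    \sum_i (y - x) 0 i * ssum (v i) - \sum_i (y - x) 0 i * 'D_'e_i P x); first by ring.
  by rewrite -sumrB; apply: eq_bigr => i _; rewrite mulrBr.
have h4 : C * `|y - x| * 3 / 2 * 3^-1 ^+ N <= `|y - x| * (e / 4).
  rewrite (_ : C * `|y - x| * 3 / 2 * 3^-1 ^+ N = `|y - x| * (C * 3 / 2 * 3^-1 ^+ N));
    last by ring.
  by rewrite ler_wpM2l // ltW.
apply: le_trans (ler_normB _ _) _.
have := ler_normD (ssum u - series u N) (P y - P x - \sum_i (y - x) 0 i * 'D_'e_i P x).
by move: h1 h2 h3 h4; lra.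
Qed.

Lemma smooth_series n (A : set 'rV[R]_n) (h : nat -> 'rV[R]_n -> R) :
  open A -> (forall j, smooth_on A (h j)) ->
  (forall s, exists C, forall j x, A x -> `|partials s (h j) x| <= C) ->
  smooth_on A (fun x => ssum (fun j => a j * h j x)).
Proof.
move=> oA sh hC.
pose H s x := ssum (fun j => a j * partials s (h j) x).
have dH s x : A x -> differentiable (H s) x /\ forall i, 'D_'e_i (H s) x = H (i :: s) x.
  have [C0 C0P] := hC s.
  have /choice[C1 C1P] i : exists C, forall j x, A x -> `|partials (i :: s) (h j) x| <= C.
    exact: hC.
  apply: (derive_series (C0 := C0) (C1 := \sum_i `|C1 i|) oA) => //.
    by move=> j y Ay; exact: sh.
  move=> j i y Ay; apply: le_trans (C1P i j y Ay) _.
  rewrite (bigD1 i) //=; apply: le_trans (ler_norm _) _; rewrite lerDl.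
  exact: sumr_ge0.
have E s x : A x -> partials s (H [::]) x = H s x.
  elim: s x => [//|i s IH] x Ax /=.
  rewrite -(dH s x Ax).2; apply: near_eq_derive.
  by apply: filterS (open_nbhs_nbhs (conj oA Ax)) => y Ay; exact: IH.
move=> s x Ax; apply: near_eq_differentiable (dH s x Ax).1.
by apply: filterS (open_nbhs_nbhs (conj oA Ax)) => y Ay; rewrite E.
Qed.

End GeometricSeries.

(** * The Hahn-Banach theorem *)

Section HahnBanach.
Variables (R : realType) (V : lmodType R) (p : V -> R).
Hypothesis pD : forall x y, p (x + y) <= p x + p y.
Hypothesis pZ : forall c x, 0 <= c -> p (c *: x) = c * p x.

(* A linear relation dominated by [p] is the graph of a partial linear
   functional. *)
Definition dominated_rel (G : set (V * R)) :=
  [/\ G (0, 0),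
      forall c x y a b, G (x, a) -> G (y, b) -> G (c *: x + y, c * a + b) &
      forall x a, G (x, a) -> a <= p x].

Lemma dominated_rel_extend (M : set (V * R)) x0 : dominated_rel M ->
  exists2 M', dominated_rel M' & M `<=` M' /\ exists b, M' (x0, b).
Proof.
move=> [M0 ML Mp].
have MD x y a b : M (x, a) -> M (y, b) -> M (x + y, a + b).
  by move=> xa yb; have := ML 1 _ _ _ _ xa yb; rewrite scale1r mul1r.
have MZ c x a : M (x, a) -> M (c *: x, c * a).
  by move=> xa; have := ML c _ _ _ _ xa M0; rewrite !addr0.
(* A value [b] at [x0] is admissible when [a - p (x - x0) <= b <= p (x + x0) - a] for all [(x, a)]
   in [M]; the supremum of the left sides qualifies by subadditivity. *)
pose S' : set R := [set r | exists x a, M (x, a) /\ r = a - p (x - x0)].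
have ubS x a : M (x, a) -> ubound S' (p (x + x0) - a).
  move=> xa _ [y [b [yb ->]]]; rewrite lerBrDr addrAC lerBlDr.
  apply: le_trans (Mp _ _ (MD _ _ _ _ yb xa)) _.
  by apply: le_trans (pD (x + x0) (y - x0)); rewrite addrACA subrr addr0 [x + y]addrC.
have nS' : S' !=set0 by exists (0 - p (0 - x0)), 0, 0.
have hS : has_sup S' by split=> //; exists (p (0 + x0) - 0); exact: ubS.
pose b := sup S'.
have b1 x a : M (x, a) -> a + b <= p (x + x0).
  move=> xa; rewrite addrC -lerBrDr; apply: ge_sup => //; exact: ubS.
have b2 x a : M (x, a) -> a - b <= p (x - x0).
  move=> xa; rewrite lerBlDr -lerBlDl; apply: ub_le_sup; last by exists x, a.
  by case: hS.
pose M' : set (V * R) := [set z | exists x a t, M (x, a) /\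
  z = (x + t *: x0, a + t * b)].
have MM' : M `<=` M'.
  by move=> [x a] xa; exists x, a, 0; rewrite scale0r mul0r !addr0.
exists M'; last first.
  by split=> //; exists b, 0, 0, 1; rewrite scale1r mul1r !add0r.
split; first exact: MM'.
- move=> c _ _ _ _ [x [a [t [xa [-> ->]]]]] [y [a' [t' [ya [-> ->]]]]].
  exists (c *: x + y), (c * a + a'), (c * t + t'); split; first exact: ML.
  congr (_, _); last by ring.
  by rewrite scalerDr scalerA scalerDl addrACA.
move=> _ _ [x [a [t [xa [-> ->]]]]].
case: (ltgtP t 0) => [t0|t0|->]; last by rewrite scale0r mul0r !addr0; exact: Mp.
  have s0 : 0 < - t by rewrite oppr_gt0.
  have := b2 _ _ (MZ (- t)^-1 _ _ xa).
  rewrite -(ler_pM2l s0) -pZ ?(ltW s0) // mulrBr scalerBr scalerA mulrA.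
  by rewrite divff ?gt_eqF // scale1r mul1r scaleNr opprK mulNr opprK.
have := b1 _ _ (MZ t^-1 _ _ xa).
rewrite -(ler_pM2l t0) -pZ ?(ltW t0) // mulrDr scalerDr scalerA mulrA.
by rewrite divff ?gt_eqF // scale1r mul1r.
Qed.

Theorem hahn_banach (G0 : set (V * R)) : dominated_rel G0 ->
  exists l : V -> R, [/\ forall c x y, l (c *: x + y) = c * l x + l y,
    forall x, l x <= p x & forall x a, G0 (x, a) -> l x = a].
Proof.
move=> G0d.
(* Zorn's lemma runs over the part to be added to [G0], so that the union of the empty chain
   qualifies too. *)
have [|G [Gd Gmax]] := @Zorn_bigcup _ (fun G => dominated_rel (G0 `|` G)).
  move=> F FP Ftot; have [[G1 FG1]|nF] := pselect (exists X, F X); last first.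
    rewrite (_ : \bigcup_(X in F) X = set0) ?setU0 //.
    by apply/seteqP; split=> // z [X FX]; exfalso; apply: nF; exists X.
  have up z w : (G0 `|` \bigcup_(X in F) X) z -> (G0 `|` \bigcup_(X in F) X) w ->
      exists2 X, F X & (G0 `|` X) z /\ (G0 `|` X) w.
    move=> [zG|[X FX Xz]] [wG|[Y FY Yw]].
    - by exists G1 => //; split; left.
    - by exists Y => //; split; [left|right].
    - by exists X => //; split; [right|left].
    - have [XY|YX] := Ftot _ _ FX FY.
        by exists Y => //; split; right => //; exact: XY.
      by exists X => //; split; right => //; exact: YX.
  have sub X z : F X -> (G0 `|` X) z -> (G0 `|` \bigcup_(X in F) X) z.
    by move=> FX [zG|Xz]; [left | right; exists X].
  split.
  - by left; case: G0d.
  - move=> c x y a b xa yb; have [X FX [Xx Xy]] := up _ _ xa yb.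
    by apply: (sub X) => //; have [_ + _] := FP _ FX; apply.
  - move=> x a xa; have [X FX [Xx _]] := up _ _ xa xa.
    by have [_ _] := FP _ FX; apply.
set M := G0 `|` G in Gd *.
have tot x : exists a, M (x, a).
  have [M' M'd [MM' [b M'b]]] := dominated_rel_extend x Gd.
  apply: contrapT => nx; apply: (Gmax M').
    split; first by move=> z Gz; apply: MM'; right.
    by move=> M'G; apply: nx; exists b; right; exact: M'G.
  rewrite (_ : G0 `|` M' = M') //; apply/seteqP; split=> z; last by right.
  by case=> // G0z; apply: MM'; left.
have [M0 ML Mp] := Gd.
(* Domination forces single values: the difference of two values lies over [0], where [p]
   vanishes. *)
have fct x a b : M (x, a) -> M (x, b) -> a = b.
  have le a' b' : M (x, a') -> M (x, b') -> a' <= b'.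
    move=> xa xb; have := Mp _ _ (ML (-1) _ _ _ _ xb xa).
    have p0 : p 0 = 0 by have := pZ 0 (lexx 0); rewrite scale0r mul0r.
    by rewrite scaleN1r addNr p0 mulN1r addrC subr_le0.
  by move=> xa xb; apply/le_anti; rewrite !le.
have [l lP] := choice tot.
exists l; split=> [c x y|x|x a G0x].
- by apply: fct (lP _) _; exact: ML.
- exact: Mp.
- by apply: fct (lP _) _; left.
Qed.

End HahnBanach.

(** * Smooth functions on a manifold *)

Section RealSmooth.
Variables (R : realType) (n : nat) (M : smoothManifold R n).
Local Notation chart := (chart R n M).
Implicit Types (g h : M -> R) (c : chart) (p q : M).

Lemma cdom_cinv c x : cimg c x -> cdom c (cinv c x) /\ cfun c (cinv c x) = x.
Proof. by move=> [p cp <-]; rewrite cfunK. Qed.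

Lemma cimg_cfun c p : cdom c p -> cimg c (cfun c p).
Proof. by move=> cp; exists p. Qed.

Lemma open_chart_preimage c (U : set 'rV[R]_n) : open U ->
  open [set p | cdom c p /\ U (cfun c p)].
Proof.
move=> oU; rewrite openE => p [cp Up].
have c1 : nbhs p (cdom c) by apply: open_nbhs_nbhs; split=> //; exact: cdom_open.
have c2 := cfun_continuous c cp _ (open_nbhs_nbhs (conj oU Up)).
exact: filterI c1 c2.
Qed.

Lemma near_chart c p (P : M -> Prop) : cdom c p ->
  (\forall q \near p, P q) -> \forall x \near cfun c p, P (cinv c x).
Proof.
by move=> cp Pp; apply: (cinv_continuous c cp); rewrite cfunK.
Qed.

Lemma transition_smooth c c' : atlas M c -> atlas M c' ->
  smooth_map_on (cfun c @` (cdom c `&` cdom c')) (transition c c').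
Proof. by move=> ac ac'; have [] := atlas_compatible ac ac'. Qed.

Lemma open_cimg2 c c' : open (cfun c @` (cdom c `&` cdom c')).
Proof.
rewrite openE => _ [p [cp c'p] <-].
have c1 : nbhs (cfun c p) (cimg c).
  by apply: open_nbhs_nbhs; split; [exact: open_cimg | exact: cimg_cfun].
have c2 : \forall x \near cfun c p, cdom c' (cinv c x).
  by apply: near_chart => //; apply: open_nbhs_nbhs; split=> //; exact: cdom_open.
by apply: filterS2 c1 c2 => x /cdom_cinv[cx xE] c'x; exists (cinv c x).
Qed.

(** Smooth transitions carry the property from one chart around each point to every chart. *)
Lemma rsmooth_local g :
  (forall p, exists c U, [/\ atlas M c, open U, cdom c p, U (cfun c p) &
    smooth_on U (fun x => g (cinv c x))]) -> rsmooth g.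
Proof.
move=> gl c ac s _ [p cp <-].
have [c' [U [ac' oU c'p Up sU]]] := gl p.
pose A := [set x | exists q, [/\ cdom c q, cdom c' q, U (cfun c' q) & x = cfun c q]].
have oA : open A.
  rewrite openE => _ [q [cq c'q Uq ->]].
  have c1 : nbhs (cfun c q) (cimg c).
    by apply: open_nbhs_nbhs; split; [exact: open_cimg | exact: cimg_cfun].
  have c2 : \forall x \near cfun c q, cdom c' (cinv c x) /\ U (cfun c' (cinv c x)).
    apply: (near_chart (P := fun q => cdom c' q /\ U (cfun c' q))) => //.
    by apply: open_nbhs_nbhs; split=> //; exact: open_chart_preimage.
  apply: filterS2 c1 c2 => x /cdom_cinv[cx xE] [c'x Ux]; exists (cinv c x).
  by rewrite xE.
have AU x : A x -> U (transition c c' x).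
  by move=> [q [cq c'q Uq ->]]; rewrite /transition /= cfunK.
have st : smooth_map_on A (transition c c').
  move=> j; apply: smooth_on_subset (transition_smooth ac ac' j).
  by move=> _ [q [cq c'q Uq ->]]; exists q.
have sA := smooth_on_comp oA oU AU st sU.
have Ap : A (cfun c p) by exists p.
have E x : A x -> g (cinv c' (transition c c' x)) = g (cinv c x).
  by move=> [q [cq c'q Uq ->]]; rewrite /transition /= cfunK // cfunK.
exact: (smooth_on_eq oA E sA s Ap).
Qed.

Lemma rsmooth_cst (a : R) : rsmooth (fun _ : M => a).
Proof. by move=> c ac; exact: (smooth_on_cst (open_cimg c)). Qed.

Lemma rsmoothD g h : rsmooth g -> rsmooth h -> rsmooth (fun p => g p + h p).
Proof.
by move=> sg sh c ac; exact: (smooth_onD (open_cimg c) (sg c ac) (sh c ac)).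
Qed.

Lemma rsmoothM g h : rsmooth g -> rsmooth h -> rsmooth (fun p => g p * h p).
Proof.
by move=> sg sh c ac; exact: (smooth_onM (open_cimg c) (sg c ac) (sh c ac)).
Qed.

Lemma rsmoothZ a g : rsmooth g -> rsmooth (fun p => a * g p).
Proof. by move=> sg; apply: rsmoothM => //; exact: rsmooth_cst. Qed.

Lemma rsmoothB g h : rsmooth g -> rsmooth h -> rsmooth (fun p => g p - h p).
Proof.
by move=> sg sh c ac; exact: (smooth_onB (open_cimg c) (sg c ac) (sh c ac)).
Qed.

Lemma rsmooth_inv g : (forall p, g p != 0) -> rsmooth g ->
  rsmooth (fun p => (g p)^-1).
Proof. by move=> g0 sg c ac; exact: (smooth_on_inv (open_cimg c) (fun x _ =>
  g0 _) (sg c ac)). Qed.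

Lemma rsmooth_sum (I : Type) (r : seq I) (F : I -> M -> R) :
  (forall i, rsmooth (F i)) -> rsmooth (fun p => \sum_(i <- r) F i p).
Proof.
move=> sF c ac.
exact: (smooth_on_sum (open_cimg c) r (F := fun i x => F i (cinv c x)) (fun i => sF i c ac)).
Qed.

Lemma rsmooth_continuous g : rsmooth g -> continuous g.
Proof.
move=> sg p; have cp := chart_at_dom p; set c := chart_at p in cp.
have dg := sg c (chart_at_atlas p) [::] _ (cimg_cfun cp).
have cg := differentiable_continuous dg.
have E : \forall q \near p, g (cinv c (cfun c q)) = g q.
  have : nbhs p (cdom c) by apply: open_nbhs_nbhs; split=> //; exact: cdom_open.
  by apply: filterS => q cq; rewrite cfunK.
apply: near_eq_continuous E _.
exact: (continuous_comp (cfun_continuous c cp) cg).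
Qed.

(** A bump of a chart image is extended by zero. Smoothness off the chart holds because the compact
    set carrying it is closed, [M] being Hausdorff. *)
Lemma bump (p : M) (U : set M) : open U -> U p -> exists b : M -> R,
  [/\ rsmooth b, forall q, 0 <= b q, 0 < b p & forall q, ~ U q -> b q = 0].
Proof.
move=> oU Up; have cp := chart_at_dom p; set c := chart_at p in cp.
have ac : atlas M c := chart_at_atlas p.
pose W := [set x | cimg c x /\ U (cinv c x)].
have oW : open W.
  rewrite openE => _ [[q cq <-] Uq].
  have c1 : nbhs (cfun c q) (cimg c).
    by apply: open_nbhs_nbhs; split; [exact: open_cimg | exact: cimg_cfun].
  rewrite cfunK // in Uq.
  exact: filterI c1 (near_chart cq (open_nbhs_nbhs (conj oU Uq))).
have Wp : W (cfun c p) by split; [exact: cimg_cfun | rewrite cfunK].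
have [r r0 rW] := open_normP oW Wp.
have r2 : 0 < r / 2 by lra.
have [b [sb b0 bp bout]] := bump_rV (cfun c p) r2.
pose f q := if q \in cdom c then b (cfun c q) else 0.
exists f; split.
- apply: rsmooth_local => q.
  have [cq|ncq] := pselect (cdom c q).
    exists c, (cimg c); split => //; [exact: open_cimg | exact: cimg_cfun|].
    apply: (smooth_on_eq (open_cimg c) _ (smooth_on_subset (@subsetT _ _) sb)) => x xc.
    by have [cx xE] := cdom_cinv xc; rewrite /f mem_set // xE.
  pose K := cinv c @` [set x | `|x - cfun c p| <= r / 2].
  have KW x : `|x - cfun c p| <= r / 2 -> W x by move=> xr; apply: rW; lra.
  have cK : compact K.
    apply: continuous_compact.
      apply: continuous_in_subspaceT => x; rewrite inE => /KW[/cdom_cinv[cx xE] _].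
      by have := cinv_continuous c cx; rewrite xE.
    rewrite (_ : [set x | _] = (fun x => x + cfun c p) @` [set x | `|x| <= r / 2]).
      apply: continuous_compact; last exact: proper_rV.
      by apply: continuous_subspaceT; apply: isometry_continuous => x y;
        congr `|_|; rewrite opprD addrACA subrr addr0.
    apply/seteqP; split=> [x xr|_ [x xr <-]] /=; last by rewrite addrK.
    by exists (x - cfun c p) => //; rewrite subrK.
  have nKq : ~ K q by move=> [x /KW[/cdom_cinv[cx _] _] xE]; apply: ncq; rewrite -xE.
  have f0 q' : ~ K q' -> f q' = 0.
    move=> nK; rewrite /f; case: ifPn => //; rewrite inE => cq'.
    apply: bout; rewrite leNgt; apply/negP => h; apply: nK.
    by exists (cfun c q'); [exact: ltW | rewrite cfunK].
  have clK : closed K by apply: compact_closed cK; exact: m_hausdorff.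
  have cq := chart_at_dom q; set c' := chart_at q in cq.
  have ac' : atlas M c' := chart_at_atlas q.
  have oW2 : open [set x | cimg c' x /\ ~ K (cinv c' x)].
    rewrite openE => _ [[q' cq' <-] nKq'].
    have c1 : nbhs (cfun c' q') (cimg c').
      by apply: open_nbhs_nbhs; split; [exact: open_cimg | exact: cimg_cfun].
    rewrite cfunK // in nKq'.
    exact: filterI c1 (near_chart cq' (open_nbhs_nbhs (conj (closed_openC clK) nKq'))).
  exists c', [set x | cimg c' x /\ ~ K (cinv c' x)]; split => //.
    by split; [exact: cimg_cfun | rewrite cfunK].
  by apply: (smooth_on_eq oW2 _ (smooth_on_cst oW2 0)) => x [_ nKx]; rewrite f0.
- by move=> q; rewrite /f; case: ifP.
- by rewrite /f mem_set.
- move=> q nUq; rewrite /f; case: ifPn => //; rewrite inE => cq.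
  apply: bout; rewrite leNgt; apply/negP => h; apply: nUq.
  by have [] := rW (cfun c q) _; [lra | rewrite cfunK].
Qed.

End RealSmooth.

Section RealFunctions.
Variables (R : realType) (n : nat) (M : smoothManifold R n).

Definition rsmooth_pred : {pred M -> R^o} := fun g => `[< rsmooth (g : M -> R) >].

Lemma rsmooth_submod_closed : submod_closed rsmooth_pred.
Proof.
split=> [|a f g /asboolP sf /asboolP sg]; apply/asboolP; first exact: rsmooth_cst.
exact: (rsmoothD (rsmoothZ a sf) sg).
Qed.

HB.instance Definition _ :=
  GRing.isSubmodClosed.Build R (M -> R^o) rsmooth_pred rsmooth_submod_closed.

(** Real functions carry the order and the Hahn-Banach arguments; functionals on the complex space
    are recovered by [complexify]. *)
Record rfun := RFun {
  rfun_fun :> M -> R^o;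
  _ : rfun_fun \in rsmooth_pred }.

HB.instance Definition _ := [isSub for rfun_fun].
HB.instance Definition _ := [Choice of rfun by <:].
HB.instance Definition _ := [SubChoice_isSubLmodule of rfun by <:].

Lemma rfunP (f : rfun) : rsmooth (f : M -> R).
Proof. exact/asboolP/(valP f). Qed.

Definition mkr (g : M -> R) (sg : rsmooth g) : rfun :=
  @RFun (g : M -> R^o) (introT (asboolP _) sg).

Lemma rfun_ext (f g : rfun) : (forall p, f p = g p) -> f = g.
Proof. by move=> fg; apply/val_inj/funext. Qed.

Lemma rfun_lin (c : R) (f g : rfun) p : (c *: f + g) p = c * f p + g p.
Proof. by []. Qed.

End RealFunctions.

(** * The derivation along the vector field and segments tangent to it *)

Section Derivation.
Variables (R : realType) (n : nat) (M : smoothManifold R n) (X : vectorField M).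

Definition Xr (g : M -> R) : M -> R := fun p => lie_in X (chart_at p) g p.

Lemma XrE c g p : rsmooth g -> atlas M c -> cdom c p ->
  Xr g p = 'D_(vf_coord X c p) (fun x => g (cinv c x)) (cfun c p).
Proof.
move=> sg ac cp.
by rewrite /Xr (lie_in_chart X sg (chart_at_atlas p) ac (chart_at_dom p) cp).
Qed.

Lemma rsmooth_Xr g : rsmooth g -> rsmooth (Xr g).
Proof. by move=> sg c ac; exact: smooth_on_lie. Qed.

Let dchart (g : M -> R) p : rsmooth g ->
  derivable (fun x => g (cinv (chart_at p) x)) (cfun (chart_at p) p)
    (vf_coord X (chart_at p) p).
Proof.
move=> sg; apply: diff_derivable.
exact: (sg _ (chart_at_atlas p) [::] _ (cimg_cfun (chart_at_dom p))).
Qed.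

Lemma Xr_cst (a : R) p : Xr (fun=> a) p = 0.
Proof. by rewrite /Xr /lie_in derive_cst. Qed.

Lemma XrD g h p : rsmooth g -> rsmooth h ->
  Xr (fun p => g p + h p) p = Xr g p + Xr h p.
Proof. by move=> sg sh; rewrite /Xr /lie_in -deriveD //; exact: dchart. Qed.

Lemma XrM g h p : rsmooth g -> rsmooth h ->
  Xr (fun p => g p * h p) p = g p * Xr h p + h p * Xr g p.
Proof.
move=> sg sh; rewrite /Xr /lie_in.
have := deriveM (dchart (p := p) sg) (dchart (p := p) sh).
by rewrite /= cfunK //; exact: chart_at_dom.
Qed.

Lemma XrZ a g p : rsmooth g -> Xr (fun p => a * g p) p = a * Xr g p.
Proof.
by move=> sg; rewrite XrM ?Xr_cst ?mulr0 ?addr0 //; exact: rsmooth_cst.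
Qed.

Lemma XrB g h p : rsmooth g -> rsmooth h ->
  Xr (fun p => g p - h p) p = Xr g p - Xr h p.
Proof.
move=> sg sh; rewrite -[- Xr h p]mulN1r -XrZ // -XrD //; last exact: rsmoothZ.
by congr (Xr _ p); apply/funext => q; rewrite mulN1r.
Qed.

Lemma Xr_sum (I : Type) (r : seq I) (F : I -> M -> R) p :
  (forall i, rsmooth (F i)) ->
  Xr (fun p => \sum_(i <- r) F i p) p = \sum_(i <- r) Xr (F i) p.
Proof.
move=> sF; elim: r => [|i r IH].
  rewrite big_nil -[RHS](Xr_cst 0 p); congr (Xr _ p).
  by apply/funext => q; rewrite big_nil.
rewrite big_cons -IH -XrD //; last exact: rsmooth_sum.
by congr (Xr _ p); apply/funext => q; rewrite big_cons.
Qed.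

Lemma Xr_inv0 g p : (forall p, g p != 0) -> rsmooth g -> Xr g p = 0 ->
  Xr (fun p => (g p)^-1) p = 0.
Proof.
move=> g0 sg Xg; have si := rsmooth_inv g0 sg.
have := XrM p sg si; rewrite Xg mulr0 addr0.
rewrite (_ : (fun p => g p / g p) = fun=> 1); last first.
  by apply/funext => q; rewrite divff.
by rewrite Xr_cst => /esym/eqP; rewrite mulf_eq0 (negbTE (g0 p)) => /eqP.
Qed.

(** A segment in the chart, tangent to [X] at [p]: it agrees to first order with the integral curve,
    whose place it takes. *)
Definition flow_line p (t : R) : M :=
  cinv (chart_at p) (cfun (chart_at p) p + t *: vf_coord X (chart_at p) p).

Lemma flow_line0 p : flow_line p 0 = p.
Proof. by rewrite /flow_line scale0r addr0 cfunK //; exact: chart_at_dom. Qed.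

Lemma flow_line_derive g p : rsmooth g ->
  is_derive (0 : R) (1 : R) (fun t => g (flow_line p t)) (Xr g p).
Proof.
move=> sg; set c := chart_at p; have cp : cdom c p := chart_at_dom p.
have := @is_derive_line R n (fun x => g (cinv c x)) (cfun c p) (vf_coord X c p) 0.
rewrite scale0r addr0; apply.
exact: (sg _ (chart_at_atlas p) [::] _ (cimg_cfun cp)).
Qed.

Lemma flow_line_near p (U : set M) : open U -> U p ->
  \forall t \near (0 : R)^'+, U (flow_line p t).
Proof.
move=> oU Up; set c := chart_at p; have cp : cdom c p := chart_at_dom p.
have cl : continuous (fun t : R => cfun c p + t *: vf_coord X c p).
  apply: (@lipschitz_continuous _ _ _ _ `|vf_coord X c p|) => s t.
  by rewrite opprD addrACA subrr add0r -scalerBl normrZ mulrC.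
have h := near_chart cp (open_nbhs_nbhs (conj oU Up)).
have E : cfun c p = cfun c p + 0 *: vf_coord X c p by rewrite scale0r addr0.
rewrite E in h; have h' := cl 0 _ h.
have /nbhs_ballP[d /= d0 dP] := h'.
by exists d => // t td _; exact: dP.
Qed.

End Derivation.

Lemma is_derive_gt (R : realType) (f : R -> R) a :
  is_derive (0 : R) (1 : R) f a -> 0 < a ->
  \forall t \near (0 : R)^'+, f 0 < f t.
Proof.
move=> [df fa] a0; rewrite -fa in a0.
have h : \forall t \near (0 : R)^', 0 < t^-1 *: ((f \o shift 0) (t *: 1) - f 0).
  by have /cvgr_gt := df; apply.
have [d /= d0 dP] := iffLR (nbhs_ballP _ _) h.
exists d => // t td t0; have := dP t td; rewrite gt_eqF // => /(_ isT).
rewrite /= addr0 [t *: 1]mulr1 -[_ *: _]/(_ * _) pmulr_rgt0 ?invr_gt0 //.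
by rewrite subr_gt0.
Qed.

(** * Invariant functionals *)

Lemma compact_max (R : realType) (T : topologicalType) (K : set T) (f : T -> R) :
  compact K -> K !=set0 -> continuous f ->
  exists2 p, K p & forall q, K q -> f q <= f p.
Proof.
move=> cK K0 cf; have [p] := compact_EVT_max K0 cK (continuous_subspaceT cf).
by rewrite inE => Kp pmax; exists p => // q Kq; apply: pmax; rewrite inE.
Qed.

Lemma compact_min (R : realType) (T : topologicalType) (K : set T) (f : T -> R) :
  compact K -> K !=set0 -> continuous f ->
  exists2 p, K p & forall q, K q -> f p <= f q.
Proof.
move=> cK K0 cf; have cf' : continuous (fun p => - f p) by move=> p; exact: cvgN (cf p).
have [p Kp pmax] := compact_max cK K0 cf'.
by exists p => // q /pmax; rewrite lerN2.
Qed.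

Section InvariantFunctionals.
Variables (R : realType) (n : nat) (M : smoothManifold R n) (X : vectorField M).
Hypothesis Mcompact : compact [set: M].
Local Notation E := (rfun M).

Definition rX (u : E) : E := mkr (rsmooth_Xr X (rfunP u)).

Lemma closed_mcompact (K : set M) : closed K -> compact K.
Proof. by move=> clK; exact: (subclosed_compact clK Mcompact). Qed.

Lemma Xr_lin c (f g : E) p : Xr X (c *: f + g) p = c * Xr X f p + Xr X g p.
Proof.
rewrite -XrZ; last exact: rfunP.
rewrite -XrD //; [exact/rsmoothZ/rfunP | exact: rfunP].
Qed.

Definition linear_functional (nu : E -> R) :=
  forall c f g, nu (c *: f + g) = c * nu f + nu g.

Lemma rfun_continuous (f : E) : continuous (f : M -> R).
Proof. exact: rsmooth_continuous (rfunP f). Qed.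

(* The tangency condition on [K] says that [1] is at distance at least [1] from
   the range of [X] for the sup norm on [K]. *)
Lemma invariant_functional (K : set M) : closed K -> K !=set0 ->
  (forall u : E, exists2 p, K p & 0 <= Xr X u p) ->
  exists nu : E -> R, [/\ linear_functional nu,
    forall (f : E) a, (forall p, K p -> f p <= a) -> nu f <= a,
    forall u, nu (rX u) = 0 & forall (f : E) c, (forall p, f p = c) -> nu f = c].
Proof.
move=> clK K0 tang; have cK := closed_mcompact clK.
have /choice[pm pmP] (f : E) : exists p, K p /\ forall q, K q -> f q <= f p.
  by have [p Kp pmax] := compact_max cK K0 (@rfun_continuous f); exists p.
pose P (f : E) : R := f (pm f).
have Pub (f : E) q : K q -> f q <= P f by have [_] := pmP f; apply.
have PD (f g : E) : P (f + g) <= P f + P g.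
  by rewrite /P /=; apply: lerD; apply: Pub; have [] := pmP (f + g).
have PZ c (f : E) : 0 <= c -> P (c *: f) = c * P f.
  move=> c0; apply/le_anti/andP; split.
    by apply: ler_wpM2l => //; apply: Pub; have [] := pmP (c *: f).
  by apply: (Pub (c *: f)); have [] := pmP f.
(* On constants plus the range of [X] the functional returns the constant; tangency gives its
   domination by the maximum over [K]. *)
pose G0 : set (E * R) := [set z : E * R | exists u : E, forall p, z.1 p = z.2 + Xr X u p].
have [|nu [nulin nuP nuG]] := hahn_banach (p := P) PD PZ (G0 := G0).
  split.
  - by exists 0 => p; rewrite add0r (_ : Xr X _ p = 0) // Xr_cst.
  - move=> c f g a b [u /= fu] [v /= gv]; exists (c *: u + v) => p.
    rewrite -[LHS]/(c * f p + g p) fu gv Xr_lin /=.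
    by rewrite mulrDr addrACA.
  - move=> f a [u /= fu]; have [p Kp Xu] := tang u.
    by apply: le_trans (Pub f p Kp); rewrite fu lerDl.
exists nu; split => //.
- move=> f a fa; apply: le_trans (nuP f) _; apply: fa; by have [] := pmP f.
- by move=> u; apply: nuG; exists u => p; rewrite /= add0r.
- by move=> f c fc; apply: nuG; exists 0 => p; rewrite fc (_ : Xr X _ p = 0) ?addr0 // Xr_cst.
Qed.

(** A minimum of [u] qualifies: if [Xu] were negative there, [u] would decrease along the
    segment. *)
Lemma tangent_whole (p0 : M) (u : E) : exists2 p, [set: M] p & 0 <= Xr X u p.
Proof.
have nM : [set: M] !=set0 by exists p0.
have [p _ pmin] := compact_min Mcompact nM (@rfun_continuous u).
exists p => //; rewrite leNgt; apply/negP => Xu.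
have du := flow_line_derive X p (rsmoothZ (-1) (rfunP u)).
have := is_derive_gt du; rewrite XrZ; last exact: rfunP.
rewrite mulN1r oppr_gt0 Xu => /(_ isT) h.
near (0 : R)^'+ => t.
have : -1 * u (flow_line X p 0) < -1 * u (flow_line X p t) by near: t.
by rewrite flow_line0 !mulN1r ltrN2 ltNge pmin.
Unshelve. all: by end_near. Qed.

(* A flow-free version of the fact that, by Gronwall's inequality, the zero set
   of [r] is invariant: a maximum of [r e^(-Au)] on [r e^(Au) <= c] is pushed
   up along [X]. *)
Lemma tangent_boundary (r : E) (D : R) :
  (forall p, 0 <= r p) -> (forall p, `|Xr X r p| <= D * r p) ->
  closure [set p | 0 < r p] `&` [set p | r p = 0] !=set0 ->
  forall u : E,
    exists2 p, (closure [set p | 0 < r p] `&` [set p | r p = 0]) p & 0 <= Xr X u p.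
Proof.
move=> r0 rD; set V := [set p | 0 < r p]; set K := closure V `&` _ => nK u.
apply: contrapT => nu.
have Xu p : K p -> Xr X u p < 0.
  by move=> Kp; rewrite ltNge; apply/negP => h; apply: nu; exists p.
have cr : continuous (r : M -> R) := @rfun_continuous r.
have cu : continuous (u : M -> R) := @rfun_continuous u.
have cXu := @rfun_continuous (rX u).
have clK : closed K.
  apply: closedI; first exact: closed_closure.
  apply: (preimage_closed (f := (r : M -> R)) (D := [set 0])); first by move=> p _; exact: cr.
  exact: closed_eq.
have [b b0 bP] : exists2 b, 0 < b & forall p, `|u p| <= b.
  have [p0 _] := nK.
  have cn : continuous (fun p => `|u p|) by move=> p; exact: cvg_norm (cu p).
  have [p _ pm] := compact_max Mcompact (ex_intro _ p0 I) cn.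
  exists (`|u p| + 1); first by rewrite ltr_wpDl.
  by move=> q; apply: le_trans (pm q I) _; rewrite lerDl.
have [d d0 dP] : exists2 d, 0 < d & forall p, K p -> Xr X u p < - d.
  have [p Kp pm] := compact_max (closed_mcompact clK) nK cXu.
  exists (- Xr X u p / 2); first by rewrite divr_gt0 // oppr_gt0 Xu.
  by move=> q Kq; have := pm q Kq; have := Xu p Kp; rewrite /=; lra.
have [eta eta0 etaP] : exists2 eta, 0 < eta &
    forall p, closure V p -> r p < eta -> Xr X u p < - d.
  pose L := closure V `&` [set p | - d <= Xr X u p].
  have clL : closed L.
    apply: closedI; first exact: closed_closure.
    apply: (preimage_closed (f := Xr X u) (D := [set x | - d <= x]));
      first by move=> p _; exact: cXu.
    exact: closed_ge.
  have [nL|nL] := pselect (L !=set0); last first.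
    exists 1 => // p Vp _; rewrite ltNge; apply/negP => h; apply: nL; by exists p.
  have [p Lp pm] := compact_min (closed_mcompact clL) nL cr.
  exists (r p).
    rewrite lt_neqAle r0 andbT eq_sym; apply/eqP => rp0.
    by have [Vp /= h] := Lp; have := dP p (conj Vp rp0); rewrite ltNge h.
  move=> q Vq rq; rewrite ltNge; apply/negP => h.
  by have := pm q (conj Vq h); rewrite leNgt rq.
have D0 : 0 <= D.
  have [p [Vp _]] := nK; have [q [Vq _]] := Vp setT filterT.
  by have := le_trans (normr_ge0 _) (rD q); rewrite pmulr_lge0.
(* Chosen so that [A * d = D + 1]: the drift of the exponential then beats [|Xr| <= D * r] by
   [r]. *)
pose A := (D + 1) / d.
have A0 : 0 < A by rewrite divr_gt0 //; lra.
(* Small enough for [r e^(Au) <= c] to imply [r < eta], where [Xu < - d] holds on the closure of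
   [V]. *)
pose c := eta / 2 * expR (- (A * b)).
have c0 : 0 < c by rewrite mulr_gt0 ?expR_gt0 // divr_gt0.
pose e s p := r p * expR (s * u p).
have ce s : continuous (e s).
  move=> p; have cs : {for p, continuous (fun p => s * u p)}.
    exact: (cvgM (cvg_cst s) (cu p)).
  have cx : {for p, continuous (fun p => expR (s * u p))}.
    exact: (continuous_comp cs (@continuous_expR R _)).
  exact: (cvgM (cr p) cx).
pose Q := closure V `&` [set p | e A p <= c].
have clQ : closed Q.
  apply: closedI; first exact: closed_closure.
  apply: (preimage_closed (f := e A) (D := [set x | x <= c])); first by move=> p _; exact: ce.
  exact: closed_le.
have [v Vv vQ] : exists2 v, V v & Q v.
  have [k [Vk /= rk]] := nK.
  have h : \forall p \near k, e A p < c.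
    by have /cvgr_lt := ce A k; apply; rewrite /e rk mul0r.
  have [v [Vv ev]] := Vk _ h; exists v => //; split; last exact: ltW.
  exact: subset_closure.
have [q Qq qmax] := compact_max (closed_mcompact clQ) (ex_intro _ v vQ) (ce (- A)).
have [Vq /= eq_c] := Qq.
have rq0 : 0 < r q.
  have : 0 < e (- A) q by apply: lt_le_trans (qmax v vQ); rewrite mulr_gt0 ?expR_gt0.
  by rewrite /e pmulr_lgt0 ?expR_gt0.
have rq_eta : r q < eta.
  have uq : - b <= u q by have := bP q; rewrite ler_norml => /andP[].
  have h1 : expR (- (A * b)) <= expR (A * u q).
    by rewrite ler_expR -mulrN ler_wpM2l // ltW.
  have h2 : r q * expR (- (A * b)) <= c.
    by apply: le_trans eq_c; rewrite /e ler_wpM2l // ltW.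
  move: h2; rewrite /c ler_pM2r ?expR_gt0 // => h2.
  by apply: le_lt_trans h2 _; rewrite ltr_pdivrMr // ltr_pMr // ltr1n.
have Xuq := etaP q Vq rq_eta.
pose g := flow_line X q; have g0 : g 0 = q := flow_line0 X q.
have de s : is_derive (0 : R) (1 : R) (fun t => e s (g t))
    (expR (s * u q) * (Xr X r q + s * r q * Xr X u q)).
  have dr := flow_line_derive X q (rfunP r).
  have du := is_deriveZ s (flow_line_derive X q (rfunP u)).
  have dx := @is_derive1_comp R expR (fun t => s * u (g t)) 0 _ _ (is_derive_expR _) du.
  apply: (is_derive_eq (is_deriveM dr dx)).
  by rewrite -/g /= g0 -![_ *: _]/(_ * _); ring.
have Xrq := rD q; rewrite ler_norml in Xrq; move/andP: Xrq => [Xrq1 Xrq2].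
have AXu : A * r q * Xr X u q < - ((D + 1) * r q).
  rewrite (_ : (D + 1) * r q = A * r q * d); last by rewrite /A mulrAC divfK ?gt_eqF.
  by rewrite -mulrN ltr_pM2l // mulr_gt0.
(* At [q] the derivative of [r e^(-Au)] is positive and that of [r e^(Au)] is negative, so the
   segment stays in [Q] and exceeds the maximum. *)
have h1 := is_derive_gt (de (- A)).
have h2 := is_derive_gt (is_deriveN (de A)).
have oV : open V.
  by apply: (open_comp (f := (r : M -> R)) (D := [set x | 0 < x])) => [p _|];
    [exact: cr | exact: open_gt].
have nearV := flow_line_near X oV rq0.
have {}h1 : \forall t \near (0 : R)^'+, e (- A) (g 0) < e (- A) (g t).
  by apply: h1; rewrite mulr_gt0 ?expR_gt0 //; lra.
have {}h2 : \forall t \near (0 : R)^'+, - e A (g 0) < - e A (g t).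
  by apply: h2; rewrite oppr_gt0 pmulr_rlt0 ?expR_gt0 //; lra.
near (0 : R)^'+ => t.
have e1 : e (- A) (g 0) < e (- A) (g t) by near: t.
have e2 : - e A (g 0) < - e A (g t) by near: t.
have Vt : V (g t) by near: t.
move: e1 e2; rewrite g0 ltrN2 => e1 e2.
have : Q (g t) by split; [exact: subset_closure | rewrite /=; lra].
by move=> /qmax; rewrite leNgt e1.
Unshelve. all: by end_near. Qed.

End InvariantFunctionals.

(** * The topology of smooth functions *)

Section SmoothTopology.
Variables (R : realType) (n : nat) (M : smoothManifold R n).
Local Notation E := (rfun M).

Lemma partials_lin (A : set 'rV[R]_n) s (f g : 'rV[R]_n -> R) c x : open A ->
  smooth_on A f -> smooth_on A g -> A x ->
  partials s (fun x => c * f x + g x) x = c * partials s f x + partials s g x.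
Proof.
move=> oA sf sg; elim: s x => [//|i s IH] x Ax /=.
have E : \forall y \near x, partials s (fun x => c * f x + g x) y =
    c * partials s f y + partials s g y.
  by apply: filterS (open_nbhs_nbhs (conj oA Ax)) => y Ay; exact: IH.
rewrite (near_eq_derive _ E).
have df : derivable (partials s f) x 'e_i by apply: diff_derivable; exact: sf.
have dg : derivable (partials s g) x 'e_i by apply: diff_derivable; exact: sg.
by rewrite deriveD //; [congr (_ + _); rewrite deriveZ|apply: derivableZ].
Qed.

Lemma partials_bounded (A K : set 'rV[R]_n) k (f : 'rV[R]_n -> R) :
  open A -> compact K -> K `<=` A -> smooth_on A f ->
  exists2 e, 0 <= e & forall s x, (size s <= k)%N -> K x -> `|partials s f x| <= e.
Proof.
move=> oA cK KA; elim: k f => [|k IH] f sf.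
  have cf : {within K, continuous f}.
    apply: continuous_in_subspaceT => x; rewrite inE => /KA Ax.
    exact: (partials_continuous (s := [::]) sf Ax).
  have [B [_ BP]] := compact_bounded (continuous_compact cf cK).
  exists (`|B| + 1); first by rewrite addr_ge0.
  move=> s x; rewrite leqn0 => /nilP -> Kx /=.
  have := BP (`|B| + 1); rewrite ltr_pwDr ?ler_norm // => /(_ isT (f x)); apply.
  by exists x.
have [e0 e0_ge0 e0P] : exists2 e, 0 <= e & forall s x, (size s <= 0)%N -> K x ->
  `|partials s f x| <= e.
  have [e ege eP] := IH f sf; exists e => // s x s0; apply: eP.
  by apply: leq_trans s0 _.
have /choice[e eP] i : exists e, 0 <= e /\ forall s x, (size s <= k)%N -> K x ->
    `|partials s (fun x => 'D_'e_i f x) x| <= e.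
  by have [e ege eP] := IH _ (smooth_on_derive i sf); exists e.
exists (e0 + \sum_i e i).
  by rewrite addr_ge0 // sumr_ge0 // => i _; have [] := eP i.
move=> s x; case/lastP: s => [_|s i].
  move=> Kx; apply: le_trans (e0P [::] x isT Kx) _; rewrite lerDl.
  by apply: sumr_ge0 => i _; have [] := eP i.
rewrite size_rcons ltnS partials_rcons => sk Kx; have [_ /(_ s x sk Kx)] := eP i.
move=> h; apply: le_trans h _; rewrite (bigD1 i) //= addrCA lerDl addr_ge0 //.
by apply: sumr_ge0 => j _; have [] := eP j.
Qed.

(** The closed cells lie in chart images and support the seminorms; the open cells around the
    centres in [L] cover [M], so the seminorms bound the sup norm. *)
Definition finite_cover (L : seq M) (rad : M -> R) :=
  (forall p x, `|x - cfun (chart_at p) p| <= rad p -> cimg (chart_at p) x) /\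
  (forall q, exists2 p, p \in L &
    cdom (chart_at p) q /\ `|cfun (chart_at p) q - cfun (chart_at p) p| < rad p).

Lemma finite_cover_ex : compact [set: M] -> exists L rad, finite_cover L rad.
Proof.
move=> /compact_near_coveringP cM.
have /choice[rad radP] (p : M) : exists r, 0 < r /\
    forall x, `|x - cfun (chart_at p) p| <= r -> cimg (chart_at p) x.
  have [r r0 rP] := open_normP (open_cimg (chart_at p)) (cimg_cfun (chart_at_dom p)).
  by exists (r / 2); split=> [|x xr]; [rewrite divr_gt0 | apply: rP; lra].
pose U p := [set q | cdom (chart_at p) q /\
  `|cfun (chart_at p) q - cfun (chart_at p) p| < rad p].
have oU p : open (U p).
  apply: (@open_chart_preimage _ _ _ (chart_at p) [set x | `|x - cfun (chart_at p) p| <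
    rad p]).
  rewrite (_ : [set x | _] = ball (cfun (chart_at p) p) (rad p)); first exact: ball_open.
  by rewrite -ball_normE; apply/seteqP; split=> x; rewrite /= distrC.
(* The filter of finite lists directed by inclusion: near-covering along it yields a finite
   subcover. *)
pose F : set_system (seq M) := [set P : set (seq M) | exists L : seq M, forall L' :
  seq M, {subset L <= L'} -> P L'].
have FF : Filter F.
  split; first by exists [::].
  - move=> P Q [LP LPP] [LQ LQQ]; exists (LP ++ LQ) => L' sub.
    by split; [apply: LPP | apply: LQQ] => x xL; apply: sub; rewrite mem_cat xL ?orbT.
  - by move=> P Q PQ [L LP]; exists L => L' /LP /PQ.
have [q _|L LP] := cM _ F (fun (L : seq M) q => exists2 p, p \in L & U p q) FF.
  exists (U q, [set L : seq M | q \in L]); last by move=> [q' L] /= [Uq' qL]; exists q.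
  split=> /=; last by exists [:: q] => L' sub; apply: sub; rewrite inE.
  apply: open_nbhs_nbhs; split; first exact: oU.
  split; first exact: chart_at_dom.
  by rewrite subrr normr0; have [] := radP q.
exists L, rad; split; first by move=> p; have [] := radP p.
by move=> q; have [p pL Up] := LP L (fun _ h => h) q I; exists p.
Qed.

Section Cover.
Variables (L : seq M) (rad : M -> R).
Hypothesis cover : finite_cover L rad.

Definition cell p : set 'rV[R]_n := [set x | `|x - cfun (chart_at p) p| <= rad p].

Lemma cell_cimg p : cell p `<=` cimg (chart_at p).
Proof. by move=> x; have [+ _] := cover; exact. Qed.

Lemma cell_compact p : compact (cell p).
Proof.
rewrite (_ : cell p = (fun x => x + cfun (chart_at p) p) @` [set x | `|x| <= rad p]).
  apply: continuous_compact; last exact: proper_rV.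
  by apply: continuous_subspaceT; apply: isometry_continuous => x y;
    congr `|_|; rewrite opprD addrACA subrr addr0.
apply/seteqP; split=> [x xr|_ [x xr <-]]; last by rewrite /cell /= addrK.
by exists (x - cfun (chart_at p) p); rewrite /= ?subrK.
Qed.

(* The C^k seminorm of [g] is at most [e]. *)
Definition Cbd (k : nat) (e : R) (g : M -> R) := forall p s x, p \in L ->
  (size s <= k)%N -> cell p x ->
  `|partials s (fun x => g (cinv (chart_at p) x)) x| <= e.

Lemma Cbd_ex k g : rsmooth g -> exists2 e, 0 <= e & Cbd k e g.
Proof.
move=> sg.
have /choice[e eP] p : exists e, 0 <= e /\ forall s x, (size s <= k)%N -> cell p x ->
    `|partials s (fun x => g (cinv (chart_at p) x)) x| <= e.
  have [e e0 eP] := @partials_bounded (cimg (chart_at p)) (cell p) k _ (open_cimg _)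
    (@cell_compact p) (@cell_cimg p) (sg _ (chart_at_atlas p)).
  by exists e.
exists (\sum_(p <- L) e p); first by apply: sumr_ge0 => p _; have [] := eP p.
move=> p s x pL sk px; apply: le_trans ((eP p).2 s x sk px) _.
rewrite (big_rem p) //= lerDl; apply: sumr_ge0 => q _; have [] := eP q; by [].
Qed.

Lemma Cbd_lin k c d e (f g : E) : Cbd k d f -> Cbd k e g ->
  Cbd k (`|c| * d + e) (c *: f + g : E).
Proof.
move=> fd ge p s x pL sk px.
rewrite (@partials_lin (cimg (chart_at p)) s (fun x => f (cinv (chart_at p) x))
  (fun x => g (cinv (chart_at p) x)) c x (open_cimg _)); last first.
- exact: cell_cimg.
- exact: (rfunP g (chart_at_atlas p)).
- exact: (rfunP f (chart_at_atlas p)).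
apply: le_trans (ler_normD _ _) _; rewrite normrM.
by apply: lerD; [apply: ler_wpM2l => //; exact: fd | exact: ge].
Qed.

Lemma Cbd_le k k' d e g : (k' <= k)%N -> d <= e -> Cbd k d g -> Cbd k' e g.
Proof.
move=> kk de gd p s x pL sk px; apply: le_trans de; apply: gd => //.
exact: leq_trans kk.
Qed.

Lemma Cbd_sup k e g q : Cbd k e g -> `|g q| <= e.
Proof.
move=> ge; have [_ /(_ q)[p pL [cq qr]]] := cover.
have := ge p [::] (cfun (chart_at p) q) pL isT (ltW qr).
by rewrite /= cfunK.
Qed.

(** The added value [0] keeps the set nonempty and the supremum nonnegative in every case. *)
Definition Cnorm k (g : E) : R := sup [set r | r = 0 \/ exists p s x,
  [/\ p \in L, (size s <= k)%N, cell p x &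
    r = `|partials s (fun x => g (cinv (chart_at p) x)) x|]].

Lemma Cnorm_le k e (g : E) : 0 <= e -> Cbd k e g -> Cnorm k g <= e.
Proof.
move=> e0 ge; apply: ge_sup; first by exists 0; left.
by move=> _ [->//|[p [s [x [pL sk px ->]]]]]; exact: ge.
Qed.

Lemma Cnorm_ub k (g : E) r : (r = 0 \/ exists p s x,
  [/\ p \in L, (size s <= k)%N, cell p x &
    r = `|partials s (fun x => g (cinv (chart_at p) x)) x|]) -> r <= Cnorm k g.
Proof.
move=> rP; apply: ub_le_sup => //; have [e e0 eP] := Cbd_ex k (rfunP g).
by exists e => _ [->//|[p [s [x [pL sk px ->]]]]]; exact: eP.
Qed.

Lemma Cnorm_ge0 k g : 0 <= Cnorm k g.
Proof. by apply: Cnorm_ub; left. Qed.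

Lemma CnormP k (g : E) : Cbd k (Cnorm k g) g.
Proof. by move=> p s x pL sk px; apply: Cnorm_ub; right; exists p, s, x. Qed.

Lemma Cnorm_lin k c (f g : E) :
  Cnorm k (c *: f + g) <= `|c| * Cnorm k f + Cnorm k g.
Proof.
apply: Cnorm_le; first by rewrite addr_ge0 ?mulr_ge0 ?Cnorm_ge0.
by apply: Cbd_lin; exact: CnormP.
Qed.

Lemma CnormD k (f g : E) : Cnorm k (f + g) <= Cnorm k f + Cnorm k g.
Proof. by have := Cnorm_lin k 1 f g; rewrite scale1r normr1 mul1r. Qed.

Lemma Cnorm0 k : Cnorm k 0 = 0.
Proof.
apply/le_anti; rewrite Cnorm_ge0 andbT; apply: Cnorm_le => // p s x _ _ px.
have s0 := smooth_on_cst (open_cimg (chart_at p)) (0 : R).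
have := partials_lin s (-1) (open_cimg _) s0 s0 (cell_cimg px).
rewrite (_ : (fun x => -1 * 0 + 0) = fun=> 0); last first.
  by apply/funext => y; rewrite mulr0 addr0.
by rewrite mulN1r addNr => ->; rewrite normr0.
Qed.

Lemma CnormZ k c (f : E) : 0 <= c -> Cnorm k (c *: f) = c * Cnorm k f.
Proof.
have le c' g : 0 <= c' -> Cnorm k (c' *: g) <= c' * Cnorm k g.
  by move=> c0; have := Cnorm_lin k c' g 0; rewrite addr0 Cnorm0 addr0 ger0_norm.
rewrite le_eqVlt => /predU1P[<-|c0]; first by rewrite scale0r mul0r Cnorm0.
apply/le_anti; rewrite le ?(ltW c0) //= -ler_pdivlMl //.
have := le c^-1 (c *: f); rewrite scalerA mulVf ?gt_eqF // scale1r; apply.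
by rewrite invr_ge0 ltW.
Qed.

Lemma rsmooth_series (a : nat -> R) (h : nat -> E) : gdom a 1 ->
  (forall k, exists C, forall j, Cbd k C (h j)) ->
  rsmooth (fun q => ssum (fun j => a j * h j q)).
Proof.
move=> a3 hC; apply: rsmooth_local => q.
have [_ /(_ q)[p pL [cq qr]]] := cover.
pose U : set 'rV[R]_n := [set x | `|x - cfun (chart_at p) p| < rad p].
have oU : open U.
  rewrite (_ : U = ball (cfun (chart_at p) p) (rad p)); first exact: ball_open.
  by rewrite -ball_normE; apply/seteqP; split=> x; rewrite /U /= distrC.
have Ucell x : U x -> cell p x by move=> /ltW.
exists (chart_at p), U; split => //; first exact: chart_at_atlas.
apply: (smooth_series a3 (h := fun j x => h j (cinv (chart_at p) x)) oU) => [j|s].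
  apply: smooth_on_subset (rfunP (h j) (chart_at_atlas p)) => x /Ucell.
  exact: cell_cimg.
have [C CP] := hC (size s); exists C => j x /Ucell px.
exact: CP.
Qed.

End Cover.
End SmoothTopology.

(** * From real to complex functionals *)

Section Complexification.
Variables (R : realType) (n : nat) (M : smoothManifold R n).
Local Notation E := (rfun M).
Local Notation Re := complex.Re.
Local Notation Im := complex.Im.

Lemma rsmooth_Re (f : smoothfun M) : rsmooth (fun p => Re (f p)).
Proof. by move=> c ac; have [] := smoothfunP f ac. Qed.

Lemma rsmooth_Im (f : smoothfun M) : rsmooth (fun p => Im (f p)).
Proof. by move=> c ac; have [] := smoothfunP f ac. Qed.

Definition re (f : smoothfun M) : E := mkr (rsmooth_Re f).
Definition im (f : smoothfun M) : E := mkr (rsmooth_Im f).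

Lemma csmooth_cpx (g h : E) :
  (fun p => (g p +i* h p)%C : R[i]^o) \in @csmooth_pred R n M.
Proof.
apply/asboolP => c ac; split; [exact: (rfunP g ac) | exact: (rfunP h ac)].
Qed.

Definition cpx (g h : E) : smoothfun M := SmoothFun (csmooth_cpx g h).

Lemma re_cpx g h : re (cpx g h) = g.
Proof. exact: rfun_ext. Qed.

Lemma im_cpx g h : im (cpx g h) = h.
Proof. exact: rfun_ext. Qed.

Lemma re_lin (a : R[i]) (f g : smoothfun M) :
  re (a *: f + g) = Re a *: re f + (- Im a *: im f + re g).
Proof.
apply: rfun_ext => p.
rewrite -[LHS]/(Re (a * f p + g p)) -[RHS]/(Re a * Re (f p) + (- Im a * Im (f p) + Re (g p))).
by case: a (f p) (g p) => a1 a2 [f1 f2] [g1 g2] /=; ring.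
Qed.

Lemma im_lin (a : R[i]) (f g : smoothfun M) :
  im (a *: f + g) = Re a *: im f + (Im a *: re f + im g).
Proof.
apply: rfun_ext => p.
rewrite -[LHS]/(Im (a * f p + g p)) -[RHS]/(Re a * Im (f p) + (Im a * Re (f p) + Im (g p))).
by case: a (f p) (g p) => a1 a2 [f1 f2] [g1 g2] /=; ring.
Qed.

Definition complexify (l : E -> R) (f : smoothfun M) : R[i]^o :=
  (l (re f) +i* l (im f))%C.

Lemma complexify_linear l : linear_functional l -> linear (complexify l).
Proof.
move=> ll a f g; rewrite /complexify re_lin im_lin !ll.
by case: a => a1 a2 /=; apply/eqP; rewrite eq_complex /=; apply/andP; split; apply/eqP; ring.
Qed.

Lemma normc_lt (a b e : R) : `|a| < e / 2 -> `|b| < e / 2 ->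
  `|(a +i* b)%C| < e%:C%C.
Proof.
move=> ae be; rewrite normc_def ltcR /=.
have e0 : 0 < e by have := normr_ge0 a; lra.
rewrite -(ger0_norm (ltW e0)) -sqrtr_sqr ltr_sqrt ?exprn_gt0 //.
rewrite -[a ^+ 2]real_normK ?num_real // -[b ^+ 2]real_normK ?num_real //.
have h1 : `|a| ^+ 2 < (e / 2) ^+ 2 by rewrite ltr_pXn2r ?nnegrE ?normr_ge0 ?divr_ge0 ?ltW.
have h2 : `|b| ^+ 2 < (e / 2) ^+ 2 by rewrite ltr_pXn2r ?nnegrE ?normr_ge0 ?divr_ge0 ?ltW.
have h3 : 0 < e ^+ 2 by rewrite exprn_gt0.
by move: h1 h2; rewrite expr_div_n; lra.
Qed.

Lemma normc_ge_Im (z : R[i]) : (`|Im z|)%:C%C <= `|z|.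
Proof.
case: z => a b; rewrite normc_def lecR /= -sqrtr_sqr ler_wsqrtr //.
by rewrite lerDr sqr_ge0.
Qed.

Fixpoint words (k : nat) : seq (seq 'I_n) :=
  if k is k'.+1 then [::] :: [seq i :: s | i <- enum 'I_n, s <- words k']
  else [:: [::]].

Lemma mem_words k s : (size s <= k)%N -> s \in words k.
Proof.
elim: k s => [|k IH] [|i s] //= sk; rewrite inE /=.
by apply/allpairsP; exists (i, s); split=> //=; [rewrite mem_enum | exact: IH].
Qed.

Lemma filter_all_seq (T : Type) (I : eqType) (F : set_system T) (r : seq I)
    (P : I -> T -> Prop) (FF : Filter F) : (forall i, F (P i)) ->
  F (fun x => forall i, i \in r -> P i x).
Proof.
move=> FP; elim: r => [|i r IH]; first by apply: filterE.
apply: filterS2 (FP i) IH => x Pi Pr j; rewrite inE => /predU1P[->//|]; exact: Pr.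
Qed.

Lemma Cinf_ball_nbhs (f : smoothfun M) c K s e : atlas M c -> compact K ->
  K `<=` cimg c -> 0 < e -> nbhs f (Cinf_ball f c K s e).
Proof.
move=> ac cK Kc e0; apply: open_nbhs_nbhs; split.
  exists [set Cinf_ball f c K s e]; last by rewrite bigcup_set1.
  by move=> _ ->; apply: finI_from1; exists f, c, K, s, e; split.
move=> x Kx; rewrite subrr.
have sub0 : (fun y => Re ((0 : smoothfun M) (cinv c y))) = fun=> 0 by [].
have z := smooth_on_cst (open_cimg c) (0 : R).
have p0 : partials s (fun=> 0) x = 0 :> R.
  have := partials_lin s (-1) (open_cimg c) z z (Kc x Kx).
  rewrite (_ : (fun x => -1 * 0 + 0) = fun=> 0); last first.
    by apply/funext => y; rewrite mulr0 addr0.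
  by rewrite mulN1r addNr.
by rewrite /cpartials sub0 p0 normr0 ltcR.
Qed.

Variables (L : seq M) (rad : M -> R).
Hypothesis cover : finite_cover L rad.

Lemma near_Cbd k e (f : smoothfun M) : 0 < e ->
  \forall g \near f, Cbd L rad k e (re (g - f)) /\ Cbd L rad k e (im (g - f)).
Proof.
move=> e0.
have H : \forall g \near f, forall z, z \in [seq (p, s) | p <- L, s <- words k] ->
    Cinf_ball f (chart_at z.1) (cell rad z.1) z.2 e g.
  refine (@filter_all_seq _ _ _ _ _ (nbhs_filter f) _) => -[p s]; apply: Cinf_ball_nbhs => //.
  - exact: chart_at_atlas.
  - exact: (@cell_compact _ _ M rad).
  - exact: (cell_cimg cover).
apply: filterS H => g gP; split=> p s x pL sk px.
  have /gP/(_ x px) : (p, s) \in [seq (p, s) | p <- L, s <- words k].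
    by apply/allpairsP; exists (p, s); split=> //; exact: mem_words.
  rewrite /= => /ltW h; have := le_trans (normc_ge_Re _) h.
  by rewrite /= lecR.
have /gP/(_ x px) : (p, s) \in [seq (p, s) | p <- L, s <- words k].
  by apply/allpairsP; exists (p, s); split=> //; exact: mem_words.
rewrite /= => /ltW h; have := le_trans (normc_ge_Im _) h.
by rewrite /= lecR.
Qed.

(** Continuity in the form that the estimates produce: a distribution of finite order, controlled by
    one seminorm. *)
Definition bounded_functional (l : E -> R) := exists k C, forall (f : E) e,
  Cbd L rad k e f -> `|l f| <= C * e.

Lemma complexify_continuous l : linear_functional l -> bounded_functional l ->
  continuous (complexify l).
Proof.
move=> ll [k [C lC]] f.
move=> B /nbhs_ballP[e']; rewrite -ball_normE /= => e'0 eB.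
suff : \forall g \near f, `|complexify l f - complexify l g| < e'.
  by apply: filterS => g; exact: eB.
(* The norm on [R[i]] has values in [R[i]]: a positive [e'] is real, and is replaced by its real
   part. *)
move: {B eB} e'0; rewrite ltcE /= => /andP[/eqP e'im e'0].
have -> : e' = (Re e')%:C%C by case: e' e'im {e'0} => a b /= ->.
move: (Re e') e'0 => {e'im} {}e' e0.
have [d d0 Cd] : exists2 d, 0 < d & C * d < e' / 2.
  exists (e' / 2 / (`|C| + 1)); first by rewrite !divr_gt0 // ltr_wpDl.
  rewrite mulrCA gtr_pMr ?divr_gt0 // ltr_pdivrMr ?ltr_wpDl // mul1r.
  by rewrite ltr_pwDr ?ler_norm.
have := @near_Cbd k d f d0; apply: filterS => g [gr gi].
have -> : complexify l f - complexify l g = - complexify l (g - f).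
  have := complexify_linear ll (-1) f g; rewrite scaleN1r [- f + g]addrC => ->.
  by rewrite -[-1 *: _]/(-1 * _) mulN1r opprD opprK.
rewrite normrN; apply: normc_lt; apply: le_lt_trans Cd; exact: lC.
Qed.

Definition clinear l (ll : linear_functional l) : {linear smoothfun M -> R[i]^o} :=
  HB.pack (complexify l) (GRing.isLinear.Build _ _ _ _ _ (complexify_linear ll)).

End Complexification.

(** * Global hypoellipticity for real functionals *)

Section Hypoelliptic.
Variables (R : realType) (n : nat) (M : smoothManifold R n).
Variables (O : orientation M) (X : vectorField M).
Local Notation E := (rfun M).
Variables (L : seq M) (rad : M -> R).
Hypothesis cover : finite_cover L rad.
Hypothesis GH : globally_hypoelliptic X O.

Lemma re_lie f : re (lie X f) = rX X (re f).
Proof. exact: rfun_ext. Qed.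

Lemma im_lie f : im (lie X f) = rX X (im f).
Proof. exact: rfun_ext. Qed.

Lemma hypoelliptic_functional (l : E -> R) (w : nform M) :
  linear_functional l -> bounded_functional L rad l ->
  (forall f, - complexify l (lie X f) = nf_integral O (nf_scale f w)) ->
  exists w', forall f, complexify l f = nf_integral O (nf_scale f w').
Proof.
move=> ll lb lw; have := GH (U := clinear ll); apply.
  exact: (complexify_continuous cover ll lb).
by exists w.
Qed.

Lemma nform_ext (w w' : nform M) : nf_coord w = nf_coord w' -> w = w'.
Proof.
case: w w' => [c s h] [c' s' h'] /= cc'; subst c'.
by congr NForm; exact: Prop_irrelevance.
Qed.

End Hypoelliptic.

(** * Integration of densities *)

Section ChartIntegrals.
Variables (R : realType) (n : nat) (M : smoothManifold R n).
Hypothesis Mcompact : compact [set: M].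
Local Notation E := (rfun M).
Local Notation chart := (chart R n M).
Local Notation Re := complex.Re.
Local Notation Im := complex.Im.

(** A closed set inside [A] is given as a witness, instead of the closure of the nonvanishing locus,
    so that products can reuse it directly. *)
Definition supported (A : set M) (h : M -> R) :=
  exists C : set M, [/\ closed C, C `<=` A & forall p, ~ C p -> h p = 0].

Lemma supportedM A g h : supported A h -> supported A (fun p => g p * h p).
Proof.
by move=> [C [clC CA C0]]; exists C; split=> // p /C0 ->; rewrite mulr0.
Qed.

Lemma supportedMr A g h : supported A h -> supported A (fun p => h p * g p).
Proof.
by move=> [C [clC CA C0]]; exists C; split=> // p /C0 ->; rewrite mul0r.
Qed.

Lemma supported_sub (A B : set M) h : A `<=` B -> supported A h -> supported B h.
Proof. by move=> AB [C [clC CA C0]]; exists C; split=> // p /CA/AB. Qed.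

Lemma supportedI (A B : set M) g h : supported A g -> supported B h ->
  supported (A `&` B) (fun p => g p * h p).
Proof.
move=> [C [clC CA C0]] [D [clD DB D0]]; exists (C `&` D); split.
- exact: closedI.
- by move=> p [/CA ? /DB].
- move=> p CDp; have [Cp|/C0 ->] := pselect (C p); last by rewrite mul0r.
  by rewrite D0 ?mulr0 // => Dp; apply: CDp.
Qed.

Lemma supported_closure (A : set M) h : closure [set p | h p != 0] `<=` A ->
  supported A h.
Proof.
move=> hA; exists (closure [set p | h p != 0]); split=> //.
  exact: closed_closure.
move=> p np; apply/eqP/negPn/negP => hp; apply: np; exact: subset_closure.
Qed.

(** Vanishing off [U] does not give support in [U]. The ball of half radius leaves room for a
    compact set, closed since [M] is Hausdorff. *)
Lemma supported_bump (p : M) (U : set M) : open U -> U p -> exists b : E,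
  [/\ forall q, 0 <= b q, 0 < b p & supported U b].
Proof.
move=> oU Up; pose c := chart_at p.
have cp : cdom c p := chart_at_dom p.
have : \forall x \near cfun c p, U (cinv c x) /\ cimg c x.
  apply: filterI; first by apply: near_chart => //; apply: open_nbhs_nbhs.
  by apply: open_nbhs_nbhs; split; [exact: open_cimg | exact: cimg_cfun].
move=> /nbhs_ballP[r r0 rP].
have {}rP x : `|x - cfun c p| < r -> U (cinv c x) /\ cimg c x.
  by move=> xr; apply: rP; rewrite -ball_normE /= distrC.
pose K : set 'rV[R]_n := [set x | `|x - cfun c p| <= r / 2].
have cK : compact K by exact: (@cell_compact R n M (fun=> r / 2) p).
pose C := cinv c @` K.
have KP x : K x -> U (cinv c x) /\ cimg c x by move=> /= xr; apply: rP;
  apply: le_lt_trans xr _; rewrite ltr_pdivrMr // ltr_pMr ?ltr1n.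
have cC : compact C.
  apply: continuous_compact => //; apply: continuous_in_subspaceT => x.
  rewrite inE => /KP[_ /cdom_cinv[cx <-]]; exact: cinv_continuous.
pose W : set 'rV[R]_n := [set x | `|x - cfun c p| < r / 2].
have oW : open W.
  rewrite (_ : W = ball (cfun c p) (r / 2)); first exact: ball_open.
  by rewrite -ball_normE; apply/seteqP; split=> x; rewrite /W /= distrC.
have Wp : cdom c p /\ W (cfun c p).
  by split=> //; rewrite /W /= subrr normr0 divr_gt0.
have [b [sb b0 bp bU]] := bump (open_chart_preimage c oW) Wp.
exists (mkr sb); split => //; exists C; split.
- exact: (compact_closed (@m_hausdorff _ _ M) cC).
- by move=> _ [x /KP[Ux _] <-].
- move=> q Cq; apply: bU => -[cq qr]; apply: Cq; exists (cfun c q); last exact: cfunK.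
  exact: ltW.
Qed.

(** The integrands of the chart [c]. Smoothness is asked in [c] alone, since the coefficient of a
    density is not a function on [M]. *)
Definition adm (c : chart) (h : M -> R) :=
  supported (cdom c) h /\ smooth_on (cimg c) (fun x => h (cinv c x)).

Definition cext (c : chart) (h : M -> R) (x : 'rV[R]_n) : R :=
  if x \in cimg c then h (cinv c x) else 0.

Lemma cext_in c h x : cimg c x -> cext c h x = h (cinv c x).
Proof. by move=> cx; rewrite /cext mem_set. Qed.

Lemma cext_support c h : supported (cdom c) h -> exists K : set 'rV[R]_n,
  [/\ compact K, K `<=` cimg c & forall x, ~ K x -> cext c h x = 0].
Proof.
move=> [C [clC CA C0]]; exists (cfun c @` C); split.
- apply: continuous_compact; last exact: closed_mcompact.
  by apply: continuous_in_subspaceT => p; rewrite inE => /CA; exact: cfun_continuous.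
- by move=> _ [p /CA cp <-]; exact: cimg_cfun.
- move=> x nx; rewrite /cext; case: ifPn => // xc; apply: C0 => Cx; apply: nx.
  by exists (cinv c x) => //; have [] := cdom_cinv (set_mem xc).
Qed.

Lemma cext_smooth c h : adm c h -> smooth_on [set: 'rV[R]_n] (cext c h).
Proof.
move=> [sh smh] s x _; have [K [cK Kc K0]] := cext_support sh.
have clK : closed K.
  by apply: compact_closed => //; exact: norm_hausdorff.
have [Kx|nKx] := pselect (K x).
  have : smooth_on (cimg c) (cext c h).
    by apply: (smooth_on_eq (open_cimg c)) smh => y cy; rewrite cext_in.
  by apply; exact: Kc.
have oK : open (~` K) by exact: closed_openC.
have : smooth_on (~` K) (cext c h).
  by apply: (smooth_on_eq oK) (smooth_on_cst oK (0 : R)) => y /K0.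
exact.
Qed.

Lemma smooth_cc (f : 'rV[R]_n -> R) (K : set 'rV[R]_n) s : compact K ->
  smooth_on [set: 'rV[R]_n] f -> (forall x, ~ K x -> f x = 0) ->
  cc (partials s f).
Proof.
move=> cK sf f0.
have clK : closed K by apply: compact_closed => //; exact: norm_hausdorff.
apply: (@cc_extend _ _ [set: 'rV[R]_n] K) => //; first exact: openT.
  by move=> x _; exact: (partials_continuous sf).
have oK : open (~` K) by exact: closed_openC.
elim: s => [|i s IH] x nKx /=; first exact: f0.
rewrite (near_eq_derive (g := fun=> 0)) ?derive_cst //.
by apply: filterS (open_nbhs_nbhs (conj oK nKx)) => y; exact: IH.
Qed.

Lemma adm_cc c h : adm c h -> cc (cext c h).
Proof.
move=> ah; have [K [cK Kc K0]] := cext_support ah.1.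
exact: (smooth_cc [::] cK (cext_smooth ah) K0).
Qed.

Definition ci (c : chart) (h : M -> R) : R := integral_rV (cext c h).

Lemma chart_integralE c (h : M -> R[i]) :
  chart_integral c h = (ci c (fun p => Re (h p)) +i* ci c (fun p => Im (h p)))%C.
Proof.
by rewrite /chart_integral /ci; congr (_ +i* _)%C; congr integral_rV;
  apply/funext => x; rewrite /cext; case: ifP.
Qed.

Lemma admM c f h : atlas M c -> rsmooth f -> adm c h -> adm c (fun p => f p * h p).
Proof.
move=> ac sf [sh smh]; split; first exact: supportedM.
exact: (smooth_onM (open_cimg c) (sf c ac) smh).
Qed.

Lemma ci_sum c (I : Type) (r : seq I) (h : I -> M -> R) : (forall i, adm c (h i)) ->
  ci c (fun p => \sum_(i <- r) h i p) = \sum_(i <- r) ci c (h i).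
Proof.
move=> ah; rewrite /ci -I_sum => [|i]; last exact: adm_cc.
congr integral_rV; apply/funext => x; rewrite /cext; case: ifP => // _.
by rewrite big1_eq.
Qed.

Lemma ciZ c a h : adm c h -> ci c (fun p => a * h p) = a * ci c h.
Proof.
move=> ah; rewrite /ci -I_Z; last exact: adm_cc.
by congr integral_rV; apply/funext => x; rewrite /cext; case: ifP; rewrite ?mulr0.
Qed.

Lemma ciD c g h : adm c g -> adm c h ->
  ci c (fun p => g p + h p) = ci c g + ci c h.
Proof.
move=> ag ah; rewrite /ci -I_D; [|exact: adm_cc..].
by congr integral_rV; apply/funext => x; rewrite /cext; case: ifP; rewrite ?addr0.
Qed.

Lemma ci_gt0 c h p : adm c h -> (forall p, cdom c p -> 0 <= h p) -> cdom c p ->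
  0 < h p -> 0 < ci c h.
Proof.
move=> ah h0 cp hp; apply: (I_gt0 (x := cfun c p)) (adm_cc ah) _ _.
  by move=> x; rewrite /cext; case: ifPn => // /set_mem/cdom_cinv[/h0].
by rewrite cext_in ?cfunK //; exact: cimg_cfun.
Qed.

Lemma ci_eq c g h : (forall p, cdom c p -> g p = h p) -> ci c g = ci c h.
Proof.
move=> gh; congr integral_rV; apply/funext => x; rewrite /cext; case: ifPn => //.
by move=> /set_mem/cdom_cinv[/gh].
Qed.

End ChartIntegrals.

(** * Densities and partitions of unity *)

Section Densities.
Variables (R : realType) (n : nat) (M : smoothManifold R n).
Hypothesis Mcompact : compact [set: M].
Variable O : orientation M.
Local Notation E := (rfun M).
Local Notation chart := (chart R n M).
Local Notation Re := complex.Re.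
Local Notation Im := complex.Im.

Lemma oatlas c : ocharts O c -> atlas M c.
Proof. exact: ocharts_atlas. Qed.

Definition density (v : chart -> M -> R) :=
  (forall c, atlas M c -> smooth_on (cimg c) (fun x => v c (cinv c x))) /\
  (forall c c' p, atlas M c -> atlas M c' -> cdom c p -> cdom c' p ->
     v c p = \det (jacobian (transition c c') (cfun c p)) * v c' p).

Lemma density_Re (w : nform M) : density (fun c p => Re (nf_coord w c p)).
Proof.
split=> [c /(nf_smooth w)[]//|c c' p ac ac' cp c'p].
rewrite (nf_change w ac ac' cp c'p); case: (nf_coord w c' p) => a b /=; ring.
Qed.

Lemma density_Im (w : nform M) : density (fun c p => Im (nf_coord w c p)).
Proof.
split=> [c /(nf_smooth w)[]//|c c' p ac ac' cp c'p].
rewrite (nf_change w ac ac' cp c'p); case: (nf_coord w c' p) => a b /=; ring.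
Qed.

Lemma density_scale f v : rsmooth f -> density v ->
  density (fun c p => f p * v c p).
Proof.
move=> sf [sv cv]; split=> [c ac|c c' p ac ac' cp c'p].
  exact: (smooth_onM (open_cimg c) (sf c ac) (sv c ac)).
by rewrite (cv c c') // mulrCA.
Qed.

Lemma adm_density c f v : atlas M c -> rsmooth f -> supported (cdom c) f ->
  density v -> adm c (fun p => f p * v c p).
Proof.
move=> ac sf ssf dv; split; first exact: supportedMr.
exact: (density_scale sf dv).1.
Qed.

(** This is the change of variables along [transition c c']. The orientation makes its Jacobian
    determinant positive, so the absolute value agrees with the transformation rule of densities. *)
Lemma ci_change c c' f v : ocharts O c -> ocharts O c' -> rsmooth f ->
  supported (cdom c `&` cdom c') f -> density v ->
  ci c (fun p => f p * v c p) = ci c' (fun p => f p * v c' p).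
Proof.
move=> oc oc' sf [C [clC CD C0]] dv.
have [ac ac'] := (oatlas oc, oatlas oc').
have af' : adm c' (fun p => f p * v c' p).
  by apply: adm_density => //; exists C; split=> // p /CD[].
pose A := cfun c @` (cdom c `&` cdom c'); pose B := cfun c' @` (cdom c' `&` cdom c).
have oA : open A by exact: open_cimg2.
have oB : open B by exact: open_cimg2.
have TK y : A y -> B (transition c c' y) /\ transition c' c (transition c c' y) = y.
  move=> [p [cp c'p] <-]; rewrite /transition /= !cfunK //; split=> //.
  by exists p.
have SK z : B z -> A (transition c' c z) /\ transition c c' (transition c' c z) = z.
  move=> [p [c'p cp] <-]; rewrite /transition /= !cfunK //; split=> //.
  by exists p.
have sT := transition_smooth ac ac'.
have sS := transition_smooth ac' ac.
have Scont z : B z -> {for z, continuous (transition c' c)}.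
  move=> Bz; apply: differentiable_continuous.
  exact: (smooth_map_differentiable sS Bz).
have Jpos y : A y -> 0 < \det (jacobian (transition c c') y).
  by move=> [p [cp c'p] <-]; exact: (ocharts_pos oc oc' cp c'p).
have Junit y : A y -> jacobian (transition c c') y \in unitmx.
  by move=> Ay; rewrite unitmxE unitfE gt_eqF // Jpos.
have Jcont y : A y -> {for y, continuous (fun y : 'rV[R]_n =>
  \det (jacobian (transition c c') y))}.
  by move=> Ay; exact: (det_jacobian_continuous oA sT Ay).
have [hcont _] := adm_cc Mcompact af'.
have cC' : compact (cfun c' @` C).
  apply: continuous_compact; last exact: (closed_mcompact Mcompact clC).
  by apply: continuous_in_subspaceT => p; rewrite inE => /CD[_ c'p]; exact: cfun_continuous.
have CB' : cfun c' @` C `<=` B by move=> _ [p /CD[cp c'p] <-]; exists p.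
have h0 z : ~ (cfun c' @` C) z -> cext c' (fun p => f p * v c' p) z = 0.
  move=> nz; rewrite /cext; case: ifPn => // zc; rewrite C0 ?mul0r // => Cz.
  by apply: nz; exists (cinv c' z) => //; have [] := cdom_cinv (set_mem zc).
rewrite [RHS]/ci (integral_cov oA oB TK SK Scont (smooth_strong_diff oA sT) Junit Jcont
  hcont cC' CB' h0).
congr integral_rV; apply/funext => y /=; case: ifPn => [/set_mem Ay|].
  have [p [cp c'p] py] := Ay; rewrite -py cext_in; last by exact: cimg_cfun.
  rewrite cext_in; last by rewrite /transition /= cfunK //; exact: cimg_cfun.
  rewrite /transition /= !cfunK // (dv.2 c c' p ac ac' cp c'p) -mulrA; congr (_ * _).
  by rewrite mulrC gtr0_norm // (ocharts_pos oc oc' cp c'p).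
move=> /negP nA; rewrite /cext; case: ifPn => // /set_mem cy.
rewrite C0 ?mul0r // => /CD[_ c'y]; apply: nA; apply/mem_set; exists (cinv c y).
  by split=> //; have [] := cdom_cinv cy.
by have [] := cdom_cinv cy.
Qed.

Section Partition.
Variable P : partitionOfUnity O.
Local Notation N := (pu_size P).
Local Notation ck := (pu_chart P).
Local Notation rho := (pu_fun P).

Definition mint (v : chart -> M -> R) : R :=
  \sum_(k < N) ci (ck k) (fun p => rho k p * v (ck k) p).

Lemma pu_oc k : ocharts O (ck k). Proof. exact: pu_chartP. Qed.
Lemma pu_ac k : atlas M (ck k). Proof. exact/oatlas/pu_oc. Qed.

Lemma pu_supported k : supported (cdom (ck k)) (rho k).
Proof. exact/supported_closure/pu_supp. Qed.

Lemma adm_pu k v : density v -> adm (ck k) (fun p => rho k p * v (ck k) p).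
Proof. apply: adm_density; [exact: pu_ac | exact: pu_smooth | exact: pu_supported]. Qed.

Lemma pu_integralE w : pu_integral P w =
  (mint (fun c p => Re (nf_coord w c p)) +i* mint (fun c p => Im (nf_coord w c p)))%C.
Proof.
rewrite /pu_integral /mint.
have sumE (s : seq ('I_N)) (F G : 'I_N -> R) :
  ((\sum_(k <- s) F k) +i* (\sum_(k <- s) G k))%C = \sum_(k <- s) (F k +i* G k)%C.
  by elim: s => [|k s IH]; rewrite ?big_nil // !big_cons -IH.
rewrite sumE; apply: eq_bigr => k _; rewrite chart_integralE.
congr (_ +i* _)%C; apply: ci_eq => p _; case: (nf_coord w (ck k) p) => a b /=; ring.
Qed.

Lemma mint_sum (I : Type) (r : seq I) (v : I -> chart -> M -> R) :
  (forall i, density (v i)) ->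
  mint (fun c p => \sum_(i <- r) v i c p) = \sum_(i <- r) mint (v i).
Proof.
move=> dv; rewrite /mint exchange_big /=; apply: eq_bigr => k _.
rewrite -(ci_sum Mcompact) => [|i]; last exact: adm_pu.
by apply: ci_eq => p _; rewrite mulr_sumr.
Qed.

(** Each term of the partition is supported in two charts and can be moved into [c], where the
    weights add up to [1]. *)
Lemma mint_local c f v : ocharts O c -> rsmooth f -> supported (cdom c) f ->
  density v -> mint (fun c p => f p * v c p) = ci c (fun p => f p * v c p).
Proof.
move=> oc sf ssf dv; rewrite /mint.
have sk k : rsmooth (fun p => rho k p * f p).
  by apply: rsmoothM => //; exact: pu_smooth.
rewrite (eq_bigr (fun k => ci c (fun p => rho k p * f p * v c p))) => [|k _].
  rewrite -(ci_sum Mcompact) => [|k].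
    apply: ci_eq => p _; rewrite -mulr_suml -mulr_suml pu_sum; ring.
  by apply: adm_density (oatlas oc) (sk k) _ dv; exact: supportedM.
rewrite -(ci_change (pu_oc k) oc (sk k) _ dv).
  by apply: ci_eq => p _; rewrite mulrA.
by apply: supportedI => //; exact: pu_supported.
Qed.

End Partition.

Lemma mint_indep P Q v : density v -> mint P v = mint Q v.
Proof.
move=> dv.
have dk (k : 'I_(pu_size P)) := density_scale (pu_smooth k) dv.
transitivity (\sum_k mint Q (fun c p => pu_fun P k p * v c p)).
  apply: eq_bigr => k _; rewrite (mint_local Q (pu_oc k)) //; first exact: pu_smooth.
  exact: pu_supported.
rewrite -mint_sum //; apply: eq_bigr => k _; apply: ci_eq => p _.
by rewrite -mulr_suml pu_sum mul1r.
Qed.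

Lemma nf_integral_pu (P : partitionOfUnity O) w : nf_integral O w = pu_integral P w.
Proof.
rewrite /nf_integral; case: xgetP => [_ -> [Q ->]|/(_ (pu_integral P w))[]]; last by exists P.
by rewrite !pu_integralE; congr (_ +i* _)%C; apply: mint_indep;
  [exact: density_Re | exact: density_Im].
Qed.

(** The default value of [xget]. It lets [invariant_density] exclude the absence of partitions of
    unity, by the value of its functional on the constant [1]. *)
Lemma nf_integral_no_pu w : (partitionOfUnity O -> False) -> nf_integral O w = 0.
Proof. by move=> nP; rewrite /nf_integral; case: xgetP => [_ -> [P]|//]. Qed.

(** The test function of the fundamental lemma of the calculus of variations; the factor [h p]
    treats both signs at once. *)
Lemma chart_bump c (h : M -> R) p U : atlas M c ->
  smooth_on (cimg c) (fun x => h (cinv c x)) -> cdom c p -> open U -> U p ->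
  h p != 0 -> exists b : E, [/\ forall q, 0 <= b q, supported (cdom c `&` U) b &
    0 < h p * ci c (fun q => b q * h q)].
Proof.
move=> ac sh cp oU Up h0.
have ch : {for cfun c p, continuous (fun x => h (cinv c x))}.
  exact: (partials_continuous (s := [::]) sh (cimg_cfun cp)).
have ch2 : {for cfun c p, continuous (fun x => h p * h (cinv c x))}.
  exact: (cvgM (cvg_cst _) ch).
have : \forall x \near cfun c p, 0 < h p * h (cinv c x).
  move/cvgr_gt: ch2; apply; rewrite cfunK //.
  by rewrite -expr2 exprn_even_gt0.
move=> /nbhs_interior/= ; rewrite nbhsE => -[W0 [oW0 W0p] W0P].
have oW := open_chart_preimage c oW0.
have oWU : open ([set q | cdom c q /\ W0 (cfun c q)] `&` U) by exact: openI.
have [b [b0 bp sb]] := supported_bump oWU (conj (conj cp W0p) Up).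
exists b; have sbc : supported (cdom c) b by apply: supported_sub sb => q [[]].
split => //; first by apply: supported_sub sb => q [[]].
have ad : adm c (fun q => b q * h q).
  split; first exact: supportedMr.
  exact: (smooth_onM (open_cimg c) (rfunP b ac) sh).
rewrite -(ciZ Mcompact) //; apply: (ci_gt0 Mcompact (p := p)) => //.
- exact: (admM ac (rsmooth_cst (h p))).
- move=> q cq; rewrite mulrCA; have [bq|bq] := eqVneq (b q) 0; first by rewrite bq mul0r.
  rewrite mulr_ge0 //; have [C [clC CA C0]] := sb.
  have [/CA[[_ Wq] _]|/C0 bq0] := pselect (C q); last by rewrite bq0 eqxx in bq.
  by have /= := interior_subset (W0P _ Wq); rewrite cfunK // => /ltW.
- by rewrite mulrCA mulr_gt0 // -expr2 exprn_even_gt0.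
Qed.

Lemma density_bump P v c p U : density v -> ocharts O c -> cdom c p -> open U -> U p ->
  v c p != 0 -> exists b : E, [/\ forall q, 0 <= b q, supported U b &
    0 < v c p * mint P (fun c q => b q * v c q)].
Proof.
move=> dv oc cp oU Up v0; have ac := oatlas oc.
have [b [b0 sb vb]] := chart_bump ac (dv.1 c ac) cp oU Up v0.
exists b; split => //; first by apply: supported_sub sb => q [].
rewrite (mint_local P oc) //; first exact: rfunP.
by apply: supported_sub sb => q [].
Qed.

End Densities.

(** * Integration by parts *)

Section IntegrationByParts.
Variables (R : realType) (n : nat).

Lemma cc_translate (V : normedModType R) (g : V -> R) b : cc g -> cc (fun x => g (x + b)).
Proof.
move=> [cg [B Bg]]; split.
  move=> x; have c1 : {for x, continuous (fun x => x + b)}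
    by exact: (cvgD cvg_id (cvg_cst b)).
  exact: (continuous_comp c1 (cg (x + b))).
exists (B + `|b|) => x xB; apply: Bg.
have : `|x| <= `|x + b| + `|b| by rewrite -[x in `|x|](addrK b) (le_trans (ler_normB _ _)).
by move: xB; lra.
Qed.

Lemma norm_delta (i : 'I_n) : `|('e_i : 'rV[R]_n)| <= 1.
Proof.
rewrite rV_norm_le //; apply/forallP => j; rewrite mxE eqxx /=; by case: eqP => _;
  rewrite ?normr1 ?normr0.
Qed.

(** The integral of [F (x + b) - F x] vanishes by translation invariance, and this increment differs
    from [t * D x] by at most [t * e], by the mean value theorem and the uniform continuity of
    [D]. *)
Lemma I_derive0 (F : 'rV[R]_n -> R) K i : compact K ->
  smooth_on [set: 'rV[R]_n] F -> (forall x, ~ K x -> F x = 0) ->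
  integral_rV (fun x => 'D_'e_i F x) = 0.
Proof.
move=> cK sF F0; set D := fun x => 'D_'e_i F x.
have ccF : cc F := smooth_cc [::] cK sF F0.
have ccD : cc D := smooth_cc [:: i] cK sF F0.
have [_ [B1 FB]] := ccF; have [_ [B2 DB]] := ccD.
pose B := `|B1| + `|B2| + 1.
have B0 : 0 <= B by rewrite !addr_ge0.
have main e : 0 < e -> `|integral_rV D| <= e * (2 * B) ^+ n.
  move=> e0; have [d d0 dP] := cc_unif (@proper_rV R n) ccD e0.
  pose t := Num.min (d / 2) 1.
  have t0 : 0 < t by rewrite lt_min divr_gt0 //=.
  have td : t < d by rewrite gt_min; apply/orP; left; lra.
  have t1 : t <= 1 by rewrite ge_min lexx orbT.
  pose b : 'rV[R]_n := t *: 'e_i.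
  have bt : `|b| <= t by rewrite normrZ gtr0_norm // ger_pMr // norm_delta.
  pose G (x : 'rV[R]_n) := F (x + b) - F x - t * D x.
  have ccFb := cc_translate b ccF.
  have ccG : cc G by apply: cc_B; [exact: cc_B | exact: cc_Z].
  have IG : integral_rV G = - (t * integral_rV D).
    rewrite /G I_B; [|exact: cc_B|exact: cc_Z].
    by rewrite I_B // I_shift // I_Z // subrr sub0r.
  have Gle x : `|G x| <= t * e.
    have dF s : 0 <= s <= 1 -> differentiable F (x + s *: b).
      by move=> _; exact: (sF [::]).
    have [s /andP[s0 s1] Fx] := mvt_line dF.
    rewrite /G Fx (bigD1 i) //= big1 ?addr0 => [|j ji]; last first.
      by rewrite !mxE eqxx /= (negPf ji) mulr0 mul0r.
    rewrite !mxE !eqxx mulr1 -mulrBr normrM gtr0_norm // ler_pM2l // ltW //.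
    apply: dP; rewrite addrC addKr normrZ ger0_norm //.
    apply: le_lt_trans td; apply: le_trans bt; rewrite ler_piMl //.
  have G0 x : B < `|x| -> G x = 0.
    move=> Bx; rewrite /G.
    have x1 : B1 < `|x + b|.
      have : `|x| <= `|x + b| + `|b| by rewrite -[x in `|x|](addrK b) (le_trans
        (ler_normB _ _)).
      have := ler_norm B1; have := normr_ge0 B2; move: Bx; rewrite /B; lra.
    have x2 : B1 < `|x| by have := ler_norm B1; have := normr_ge0 B2; move: Bx;
      rewrite /B; lra.
    have x3 : B2 < `|x| by have := ler_norm B2; have := normr_ge0 B1; move: Bx;
      rewrite /B; lra.
    by rewrite FB // FB // DB // mulr0 !subr0.
  have := I_bound ccG B0 G0 Gle.
  by rewrite IG normrN normrM gtr0_norm // -mulrA ler_pM2l.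
apply/eqP; rewrite -normr_le0; apply/ler_addgt0Pr => e e0; rewrite add0r.
have B1n : 0 < (2 * B) ^+ n + 1.
  by rewrite ltr_wpDl // exprn_ge0 // mulr_ge0.
apply: le_trans (main (e / ((2 * B) ^+ n + 1)) _) _; first exact: divr_gt0.
rewrite mulrAC -mulrA ger_pMr // ler_pdivrMr // mul1r lerDl //.
Qed.

End IntegrationByParts.

Section Transport.
Variables (R : realType) (n : nat) (M : smoothManifold R n).
Hypothesis Mcompact : compact [set: M].
Variables (O : orientation M) (X : vectorField M).
Local Notation E := (rfun M).
Local Notation chart := (chart R n M).

Lemma Xr_sumE c g p : rsmooth g -> atlas M c -> cdom c p -> Xr X g p =
  \sum_i vf_coord X c p 0 i * 'D_'e_i (fun x => g (cinv c x)) (cfun c p).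
Proof.
move=> sg ac cp; rewrite (XrE X sg ac cp) derive_sum_partials //.
exact: (sg c ac [::] _ (cimg_cfun cp)).
Qed.

Lemma Xr_near0 g p : rsmooth g -> (\forall q \near p, g q = 0) -> Xr X g p = 0.
Proof.
move=> sg g0; have cp := chart_at_dom p.
rewrite (XrE X sg (chart_at_atlas p) cp).
have E : \forall x \near cfun (chart_at p) p, g (cinv (chart_at p) x) = 0.
  exact: (near_chart (P := fun q => g q = 0)).
by rewrite (near_eq_derive _ E) derive_cst.
Qed.

Lemma supported_near0 (g : M -> R) p (C : set M) : closed C -> (forall q, ~ C q -> g q = 0) ->
  ~ C p -> \forall q \near p, g q = 0 :> R.
Proof.
by move=> clC C0 nCp; apply: filterS (open_nbhs_nbhs (conj (closed_openC clC) nCp)) => q /C0.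
Qed.

Lemma supported_Xr A b : rsmooth b -> supported A b -> supported A (Xr X b).
Proof.
move=> sb [C [clC CA C0]]; exists C; split=> // p nCp.
exact/Xr_near0/(supported_near0 clC C0 nCp).
Qed.

(** In coordinates, the divergence of [h X], that is the coefficient of the Lie derivative of
    [h dx_1 ... dx_n]. *)
Definition divergence (c : chart) (h : M -> R) (p : M) : R :=
  \sum_i 'D_'e_i (fun x => vf_coord X c (cinv c x) 0 i * h (cinv c x)) (cfun c p).

Section Chart.
Variable c : chart.
Hypothesis ac : atlas M c.
Let oc := open_cimg c.

Lemma divergence_smooth h : smooth_on (cimg c) (fun x => h (cinv c x)) ->
  smooth_on (cimg c) (fun x => divergence c h (cinv c x)).
Proof.
move=> sh; have sS : smooth_on (cimg c) (fun x => \sum_i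
    'D_'e_i (fun x => vf_coord X c (cinv c x) 0 i * h (cinv c x)) x).
  apply: smooth_on_sum => // i; apply: smooth_on_derive.
  exact: (smooth_onM oc (vf_smooth X ac i) sh).
by apply: (smooth_on_eq oc) sS => x /cdom_cinv[_]; rewrite /divergence => ->.
Qed.

Lemma ci_by_parts (b h : M -> R) : rsmooth b -> supported (cdom c) b ->
  smooth_on (cimg c) (fun x => h (cinv c x)) ->
  ci c (fun p => Xr X b p * h p) = - ci c (fun p => b p * divergence c h p).
Proof.
move=> sb sbc sh; have sdiv := divergence_smooth sh.
pose v i (p : M) := b p * (vf_coord X c p 0 i * h p).
have sXh i : smooth_on (cimg c) (fun x => vf_coord X c (cinv c x) 0 i * h (cinv c x)).
  exact: (smooth_onM oc (vf_smooth X ac i) sh).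
have av i : adm c (v i).
  by split; [exact: supportedMr | exact: (smooth_onM oc (sb c ac) (sXh i))].
have a2 : adm c (fun p => b p * divergence c h p).
  by split; [exact: supportedMr | exact: (smooth_onM oc (sb c ac) sdiv)].
have a1 : adm c (fun p => Xr X b p * h p).
  split; first exact/supportedMr/supported_Xr.
  exact: (smooth_onM oc (rsmooth_Xr X sb ac) sh).
apply/eqP; rewrite -addr_eq0 -(ciD Mcompact) //; apply/eqP.
rewrite /ci; have -> : cext c (fun p => Xr X b p * h p + b p * divergence c h p) =
    fun x => \sum_i 'D_'e_i (cext c (v i)) x.
  apply/funext => x; rewrite {1}/cext; case: ifPn => [/set_mem cx|/negP ncx].
    have [cp px] := cdom_cinv cx; rewrite (Xr_sumE sb ac cp) /divergence px.
    rewrite mulr_suml mulr_sumr -big_split /=; apply: eq_bigr => i _.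
    have E : \forall y \near x, cext c (v i) y =
        b (cinv c y) * (vf_coord X c (cinv c y) 0 i * h (cinv c y)).
      by apply: filterS (open_nbhs_nbhs (conj oc cx)) => y cy; rewrite cext_in.
    have d1 : derivable (fun x => b (cinv c x)) x 'e_i.
      by apply: diff_derivable; exact: (sb c ac [::]).
    have d2 : derivable (fun x => vf_coord X c (cinv c x) 0 i * h (cinv c x)) x 'e_i.
      by apply: diff_derivable; exact: (sXh i [::]).
    rewrite (near_eq_derive _ E) (deriveM d1 d2) /=.
    by rewrite -![_ *: _]/(_ * _); ring.
  rewrite big1 // => i _; have [K [cK Kc K0]] := cext_support Mcompact (av i).1.
  have clK : closed K by apply: compact_closed => //; exact: norm_hausdorff.
  rewrite (near_eq_derive (g := fun=> 0)) ?derive_cst //.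
  have nKx : (~` K) x by move=> /Kc/mem_set.
  by apply: filterS (open_nbhs_nbhs (conj (closed_openC clK) nKx)) => y; exact: K0.
have K i := cext_support Mcompact (av i).1.
rewrite I_sum => [|i].
  rewrite big1 // => i _; have [Ki [cK Kc K0]] := K i.
  exact: (I_derive0 i cK (cext_smooth Mcompact (av i)) K0).
have [Ki [cK Kc K0]] := K i.
exact: (smooth_cc [:: i] cK (cext_smooth Mcompact (av i)) K0).
Qed.

End Chart.

(** Integration by parts against a bump function turns weak invariance into a pointwise equation. *)
Lemma invariant_divergence (P : partitionOfUnity O) v c p : density v ->
  (forall u : E, mint P (fun c q => rX X u q * v c q) = 0) ->
  ocharts O c -> cdom c p -> divergence c (v c) p = 0.
Proof.
move=> dv inv oc cp; have ac := oatlas oc; apply/eqP/negPn/negP => dp.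
have sv := dv.1 c ac.
have [b [b0 sb]] := chart_bump Mcompact ac (divergence_smooth ac sv) cp openT I dp.
have sbc : supported (cdom c) b by apply: supported_sub sb => q [].
have sXb : supported (cdom c) (rX X b) by exact: supported_Xr (rfunP b) sbc.
have := inv b; rewrite (mint_local Mcompact P oc (rfunP (rX X b)) sXb dv) /=.
rewrite (ci_by_parts ac (rfunP b) sbc sv) => /eqP; rewrite oppr_eq0 => /eqP ->.
by rewrite mulr0 ltxx.
Qed.

End Transport.

(** * Positivity of the invariant density *)

Section Nonvanishing.
Variables (R : realType) (n : nat) (M : smoothManifold R n).
Hypothesis Mcompact : compact [set: M].
Variables (O : orientation M) (X : vectorField M).
Local Notation E := (rfun M).
Local Notation chart := (chart R n M).

Lemma chart_continuous (c : chart) (h : M -> R) p : cdom c p ->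
  smooth_on (cimg c) (fun x => h (cinv c x)) -> {for p, continuous h}.
Proof.
move=> cp sh; have ch : {for cfun c p, continuous (fun x => h (cinv c x))}.
  exact: (partials_continuous (s := [::]) sh (cimg_cfun cp)).
have cc : {for p, continuous (fun q => h (cinv c (cfun c q)))}.
  exact: (continuous_comp (cfun_continuous c cp) ch).
apply: near_eq_continuous cc.
by apply: filterS (open_nbhs_nbhs (conj (cdom_open c) cp)) => q cq; rewrite cfunK.
Qed.

Lemma adm_rsmooth (c : chart) (h : M -> R) : atlas M c -> adm c h -> rsmooth h.
Proof.
move=> ac [[C [clC CA C0]] sh]; apply: rsmooth_local => p.
have [Cp|nCp] := pselect (C p).
  exists c, (cimg c); split => //; [exact: open_cimg | exact: CA |].
  exact/cimg_cfun/CA.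
have cp := chart_at_dom p.
have := near_chart cp (supported_near0 clC C0 nCp).
move=> /nbhs_interior; rewrite nbhsE => -[U [oU Up] UP].
exists (chart_at p), U; split => //; first exact: chart_at_atlas.
by apply: (smooth_on_eq oU) (smooth_on_cst oU (0 : R)) => x /UP/interior_subset.
Qed.

(** Monotonicity in [D] makes a local bound an eventual property at infinity, to which near-covering
    applies. *)
Lemma compact_uniform_bound (Q : R -> M -> Prop) :
  (forall D D' p, D <= D' -> Q D p -> Q D' p) ->
  (forall p : M, exists D, \forall q \near p, Q D q) -> exists D, forall p, Q D p.
Proof.
move=> Qmono Qloc; have cov : near_covering [set: M] by exact/compact_near_coveringP.
have [] := cov _ (pinfty_nbhs R) Q _ _.
  move=> p _; have [D QD] := Qloc p.
  exists ([set q | Q D q], [set D' | D < D']).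
    by split=> //=; exists D; split=> //; exact: num_real.
  by move=> [q D'] /= [Qq /ltW DD']; exact: Qmono DD' Qq.
move=> D [_ /(_ (D + 1))]; rewrite ltrDl ltr01 => /(_ isT) h.
by exists (D + 1) => p; exact: h.
Qed.

Variables (P : partitionOfUnity O) (v : chart -> M -> R).
Hypothesis dv : density v.
Hypothesis pde : forall c p, ocharts O c -> cdom c p -> divergence X c (v c) p = 0.
Local Notation N := (pu_size P).
Local Notation ck := (pu_chart P).
Local Notation rho := (pu_fun P).

Let t k p := rho k p * (v (ck k) p * v (ck k) p).

Let adm_t k : adm (ck k) (t k).
Proof.
split; first exact/supportedMr/pu_supported.
apply: (smooth_onM (open_cimg _) (pu_smooth k (pu_ac k))).
exact: (smooth_onM (open_cimg _) (dv.1 _ (pu_ac k)) (dv.1 _ (pu_ac k))).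
Qed.

Let t_smooth k : rsmooth (t k).
Proof. exact: adm_rsmooth (pu_ac k) (adm_t k). Qed.

(** A global function with the zeros of the density, which itself is only a family of coefficients.
    Squares make it nonnegative and, through the divergence equation, yield [|Xr| <= D * r], as
    [tangent_boundary] requires. *)
Definition square_density : E :=
  mkr (rsmooth_sum (index_enum _) t_smooth).

Lemma square_density_ge0 p : 0 <= square_density p.
Proof.
apply: sumr_ge0 => k _; apply: mulr_ge0; first exact: pu_ge0.
by rewrite -expr2 sqr_ge0.
Qed.

Lemma pu_gt0 p : exists k, 0 < rho k p.
Proof.
apply: contrapT => h; have := pu_sum P p; rewrite big1 => [/eqP|k _].
  by rewrite eq_sym oner_eq0.
apply/eqP; rewrite eq_le pu_ge0 andbT leNgt; apply/negP => rk; apply: h.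
by exists k.
Qed.

Lemma pu_gt0_dom k p : 0 < rho k p -> cdom (ck k) p.
Proof.
have [C [clC CA C0]] := pu_supported k => rk; apply: CA; apply: contrapT => /C0.
by move=> r0; rewrite r0 ltxx in rk.
Qed.

(** The equation [div (v X) = 0] reads [Xv = - (div X) v], so differentiating [rho v^2] returns a
    multiple of [v^2]. *)
Let Xt k p : cdom (ck k) p -> Xr X (t k) p =
  (Xr X (rho k) p - 2 * rho k p * divergence X (ck k) (fun=> 1) p) *
  (v (ck k) p * v (ck k) p).
Proof.
move=> cp; have ac := pu_ac k; have cx := cimg_cfun cp.
rewrite (Xr_sumE X (t_smooth k) ac cp) (Xr_sumE X (pu_smooth k) ac cp).
have := pde (pu_oc k) cp; rewrite /divergence.
have dX i : derivable (fun x => vf_coord X (ck k) (cinv (ck k) x) 0 i) (cfun (ck k) p) 'e_i.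
  by apply: diff_derivable; exact: (vf_smooth X ac i [::]).
have dvk i : derivable (fun x => v (ck k) (cinv (ck k) x)) (cfun (ck k) p) 'e_i.
  by apply: diff_derivable; exact: (dv.1 _ ac [::]).
have dr i : derivable (fun x => rho k (cinv (ck k) x)) (cfun (ck k) p) 'e_i.
  by apply: diff_derivable; exact: (pu_smooth k ac [::]).
have d1 i : derivable (fun x : 'rV[R]_n => 1 : R) (cfun (ck k) p) 'e_i.
  exact: derivable_cst.
under eq_bigr => i _ do rewrite (deriveM (dX i) (dvk i)) /= !cfunK //.
under [X in _ -> _ = (_ - _ * X) * _]eq_bigr => i _ do
  rewrite (deriveM (dX i) (d1 i)) /= !cfunK // derive_cst scaler0 add0r.
have dvv i := derivableM (dvk i) (dvk i).
under [X in _ -> X = _]eq_bigr => i _ do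
  rewrite /t (deriveM (dr i) (dvv i)) (deriveM (dvk i) (dvk i)) /= !cfunK //.
rewrite big_split /= -[in X in _ + X]scaler_sumr => /eqP.
rewrite addr_eq0 => /eqP h.
under [X in _ = (_ - _ * X) * _]eq_bigr => i _ do rewrite scale1r.
set S := \sum_(i < n) 'D_'e_i (fun x => vf_coord _ _ _ _ _) _ in h *.
rewrite (eq_bigr (fun i => 2 * rho k p * v (ck k) p * (vf_coord X (ck k) p 0 i *:
    'D_'e_i (fun x : 'rV_n => v (ck k) (cinv (ck k) x)) (cfun (ck k) p)) +
    v (ck k) p * v (ck k) p * (vf_coord X (ck k) p 0 i *
    'D_'e_i (fun x : 'rV_n => rho k (cinv (ck k) x)) (cfun (ck k) p)))); last first.
  move=> i _; rewrite -![_ *: _]/(_ * _) -[(_ * _)%R (cfun (ck k) p)]/(_ * _) !cfunK //; ring.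
rewrite big_split /= -!mulr_sumr h -[_ *: S]/(_ * S); ring.
Qed.

(** Near a point in the support of [rho k], the coefficients in the two charts differ by the
    determinant [d], and the resulting factor [a] in front of the square in chart [j] is
    continuous. *)
Let Xt_bound k j p : cdom (ck j) p -> exists D, \forall q \near p,
  `|Xr X (t k) q| <= D * (v (ck j) q * v (ck j) q).
Proof.
move=> jp; have [C [clC CA C0]] := pu_supported k.
have ak := pu_ac k; have aj := pu_ac j.
have [Cp|nCp] := pselect (C p); last first.
  exists 0; apply: filterS (open_nbhs_nbhs (conj (closed_openC clC) nCp)) => q nCq.
  have t0 : \forall y \near q, t k y = 0.
    by apply: filterS (supported_near0 clC C0 nCq) => y; rewrite /t => ->; rewrite mul0r.
  by rewrite mul0r (Xr_near0 X (t_smooth k) t0) normr0.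
have kp := CA p Cp.
pose d q := \det (jacobian (transition (ck k) (ck j)) (cfun (ck k) q)).
pose a q := (Xr X (rho k) q - 2 * rho k q * divergence X (ck k) (fun=> 1) q) *
  (d q * d q).
have ca : {for p, continuous a}.
  have c1 : {for p, continuous (Xr X (rho k))}.
    exact: (rsmooth_continuous (rsmooth_Xr X (pu_smooth k))).
  have c2 : {for p, continuous (rho k)} by exact: (rsmooth_continuous (pu_smooth k)).
  have c3 : {for p, continuous (divergence X (ck k) (fun=> 1))}.
    apply: (chart_continuous kp); apply: (divergence_smooth X ak).
    exact: (smooth_on_cst (open_cimg (ck k))).
  have c4 : {for p, continuous d}.
    have cd : {for cfun (ck k) p, continuous (fun y : 'rV[R]_n =>
      \det (jacobian (transition (ck k) (ck j)) y))}.
      pose A := cfun (ck k) @` (cdom (ck k) `&` cdom (ck j)).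
      have A0 : A (cfun (ck k) p) by exists p.
      have oA : open A by exact: open_cimg2.
      exact: (det_jacobian_continuous oA (transition_smooth ak aj) A0).
    exact: (continuous_comp (cfun_continuous (ck k) kp) cd).
  have c5 : {for p, continuous (fun q => 2 * rho k q * divergence X (ck k) (fun=> 1) q)}.
    have c0 : {for p, continuous (fun q => 2 * rho k q)}
      by exact: (cvgM (cvg_cst (2 : R)) c2).
    exact: (cvgM c0 c3).
  have c6 : {for p, continuous (fun q => d q * d q)} by exact: (cvgM c4 c4).
  exact: (cvgM (cvgB c1 c5) c6).
have can : {for p, continuous (fun q => `|a q|)} by exact: (cvg_norm ca).
exists (`|a p| + 1).
have Ha : \forall q \near p, `|a q| < `|a p| + 1.
  have h : `|a p| < `|a p| + 1 by rewrite ltrDl.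
  exact: (@cvgr_lt R M (nbhs p) _ (fun q => `|a q|) `|a p| can _ h).
have Hk := open_nbhs_nbhs (conj (cdom_open (ck k)) kp).
have Hj := open_nbhs_nbhs (conj (cdom_open (ck j)) jp).
apply: filterS3 Ha Hk Hj => q aq kq jq.
rewrite (Xt kq) (dv.2 _ _ _ ak aj kq jq).
rewrite (_ : _ * _ = a q * (v (ck j) q * v (ck j) q)); last by rewrite /a /d; ring.
have w0 : 0 <= v (ck j) q * v (ck j) q by rewrite -expr2 sqr_ge0.
by rewrite normrM (ger0_norm w0); apply: ler_wpM2r => //; exact: ltW.
Qed.

Lemma square_density_bound : exists D, forall p,
  `|Xr X square_density p| <= D * square_density p.
Proof.
apply: (compact_uniform_bound (Q := fun D p => _ <= D * square_density p)).
  move=> D D' p DD' h; apply: le_trans h _.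
  by apply: ler_wpM2r DD'; exact: square_density_ge0.
move=> p; have [j jp] := pu_gt0 p; have cj := pu_gt0_dom jp.
have /choice[D DP] k := Xt_bound k cj.
(* Near [p] the weight [rho j] exceeds half its value at [p], hence
   [v_j^2 <= (2 / rho j p) * square_density]. *)
exists (\sum_k `|D k| * (2 / rho j p)).
have H1 : \forall q \near p, forall k, `|Xr X (t k) q| <= D k * (v (ck j) q * v (ck j) q).
  exact: filter_forall.
have H2 : \forall q \near p, rho j p / 2 < rho j q.
  apply: (@cvgr_gt _ _ _ _ (rho j) (rho j p) (@rsmooth_continuous _ _ _ _ (pu_smooth j) p)).
  by rewrite ltr_pdivrMr // ltr_pMr // ltr1n.
apply: filterS2 H1 H2 => q Hq rq.
have Xs : Xr X square_density q = \sum_k Xr X (t k) q by exact: Xr_sum.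
rewrite Xs (le_trans (ler_norm_sum _ _ _)) // mulr_suml; apply: ler_sum => k _.
apply: le_trans (Hq k) _; rewrite -mulrA.
set w := v (ck j) q * _.
have w0 : 0 <= w by rewrite /w -expr2 sqr_ge0.
apply: le_trans (ler_wpM2r w0 (ler_norm (D k))) _; apply: ler_wpM2l => //.
have tj : rho j q * w <= square_density q.
  rewrite -[square_density q]/(\sum_k t k q) (bigD1 j) //= lerDl.
  apply: sumr_ge0 => i _; apply: mulr_ge0; first exact: pu_ge0.
  by rewrite -expr2 sqr_ge0.
apply: le_trans (_ : 2 / rho j p * (rho j q * w) <= _); last first.
  by apply: ler_wpM2l tj; rewrite divr_ge0 // ltW.
rewrite mulrA ler_peMl //.
rewrite -mulrA mulrC -ler_pdivrMr // mul1r mulrC ler_pdivlMr //.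
by move: rq; lra.
Qed.

Lemma square_density0 c p : ocharts O c -> cdom c p -> square_density p = 0 ->
  v c p = 0.
Proof.
move=> oc cp; rewrite -[square_density p]/(\sum_k t k p) => s0.
have [j jp] := pu_gt0 p; have cj := pu_gt0_dom jp.
have tj : t j p = 0.
  apply/eqP; rewrite eq_le; apply/andP; split; last first.
    by apply: mulr_ge0; [exact: pu_ge0 | rewrite -expr2 sqr_ge0].
  rewrite -s0 (bigD1 j) //= lerDl; apply: sumr_ge0 => i _.
  by apply: mulr_ge0; [exact: pu_ge0 | rewrite -expr2 sqr_ge0].
rewrite (dv.2 c (ck j) p (oatlas oc) (pu_ac j) cp cj).
move/eqP: tj; rewrite mulf_eq0 (gt_eqF jp) /= mulf_eq0 orbb => /eqP ->.
by rewrite mulr0.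
Qed.

Lemma square_density_gt0 c p : ocharts O c -> cdom c p -> 0 < square_density p ->
  v c p != 0.
Proof.
move=> oc cp; rewrite -[square_density p]/(\sum_k t k p) => s0.
apply: contraTneq s0 => v0; rewrite -leNgt big1 // => k _; rewrite /t.
have [C [clC CA C0]] := pu_supported k.
have [Cp|/C0 ->] := pselect (C p); last by rewrite mul0r.
rewrite (dv.2 (ck k) c p (pu_ac k) (oatlas oc) (CA p Cp) cp) v0; ring.
Qed.

End Nonvanishing.

(** * The invariant measure and its density *)

Section InvariantMeasure.
Variables (R : realType) (n : nat) (M : smoothManifold R n).
Hypothesis Mcompact : compact [set: M].
Hypothesis Mconnected : connected [set: M].
Variables (O : orientation M) (X : vectorField M).
Hypothesis GH : globally_hypoelliptic X O.
Local Notation E := (rfun M).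
Local Notation chart := (chart R n M).
Local Notation Re := complex.Re.
Local Notation Im := complex.Im.
Variables (L : seq M) (rad : M -> R).
Hypothesis cover : finite_cover L rad.
Variable p0 : M.

Definition re_density (w : nform M) (c : chart) (p : M) : R := Re (nf_coord w c p).

Fact nform0_change (c c' : chart) (p : M) : atlas M c -> atlas M c' ->
  cdom c p -> cdom c' p ->
  0 = (\det (jacobian (transition c c') (cfun c p)))%:C%C * 0 :> R[i].
Proof. by rewrite mulr0. Qed.

Definition nform0 : nform M :=
  @NForm _ _ M (fun _ _ => 0) (fun c _ => csmooth_on_cst (open_cimg c) 0)
    nform0_change.

Lemma nf_integral0 f : nf_integral O (nf_scale f nform0) = 0.
Proof.
have [[P _]|nP] := pselect (exists P : partitionOfUnity O, True); last first.
  by apply: nf_integral_no_pu => P; apply: nP; exists P.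
rewrite (nf_integral_pu Mcompact P) pu_integralE /mint.
have z : ci (R := R) (n := n) (M := M) ^~ (fun=> 0) = fun=> 0.
  apply/funext => c; rewrite /ci (_ : cext c _ = fun=> 0) ?I_0 //.
  by apply/funext => x; rewrite /cext; case: ifP.
rewrite !big1 // => k _; rewrite -[RHS](congr1 (fun F => F (pu_chart P k)) z);
  by apply: ci_eq => p _; rewrite /= mulr0 mulr0.
Qed.

Lemma represented_mint (l : E -> R) (w : nform M) (P : partitionOfUnity O) :
  linear_functional l ->
  (forall F, complexify l F = nf_integral O (nf_scale F w)) ->
  forall f : E, l f = mint P (fun c p => f p * re_density w c p).
Proof.
move=> ll lw f; have := lw (cpx f 0).
rewrite (nf_integral_pu Mcompact P) pu_integralE => /(congr1 (@complex.Re R)) /=.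
rewrite re_cpx => ->; congr (mint P _); apply/funext => c; apply/funext => p.
rewrite /re_density; case: (nf_coord w c p) => a b.
by rewrite -[RHS]subr0; congr (_ - _); rewrite -[X in X * b = _]/(0 : R) mul0r.
Qed.

(** Invariance says that the Lie derivative is represented by the zero form, so hypoellipticity
    applies to the functional that Hahn-Banach supplies on [K]. *)
Lemma invariant_density (K : set M) : closed K -> K !=set0 ->
  (forall u : E, exists2 p, K p & 0 <= Xr X u p) ->
  exists (nu : E -> R) (w : nform M) (P : partitionOfUnity O), [/\ linear_functional nu,
    forall (f : E) a, (forall p, K p -> f p <= a) -> nu f <= a,
    forall u, nu (rX X u) = 0, forall (f : E) c, (forall p, f p = c) -> nu f = c &
    forall F, complexify nu F = nf_integral O (nf_scale F w)].
Proof.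
move=> clK K0 tang; have [nu [nul nuK nuX nu1]] := invariant_functional Mcompact clK K0 tang.
have nuN f : nu (- f) = - nu f.
  have := nul (-1) f 0; rewrite scaleN1r addr0 mulN1r => ->.
  by rewrite (nu1 0 0) ?addr0.
have nub : bounded_functional L rad nu.
  exists 0, 1 => f e fe; rewrite mul1r ler_norml; apply/andP; split.
    rewrite lerNl -nuN; apply: nuK => p _; apply: le_trans (Cbd_sup cover p fe).
    by rewrite -normrN ler_norm.
  by apply: nuK => p _; apply: le_trans (Cbd_sup cover p fe); rewrite ler_norm.
have [F|w nuw] := hypoelliptic_functional cover GH (w := nform0) nul nub.
  by rewrite nf_integral0 /complexify re_lie im_lie !nuX oppr0.
have [[P _]|nP] := pselect (exists P : partitionOfUnity O, True).
  by exists nu, w, P; split.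
have := nuw (cpx (mkr (@rsmooth_cst _ _ M 1)) 0).
rewrite nf_integral_no_pu => [|P]; last by apply: nP; exists P.
move=> /(congr1 (@complex.Re R)) /=; rewrite re_cpx (nu1 _ 1) // => /eqP.
by rewrite oner_eq0.
Qed.

Lemma invariant_measure :
  exists (mu : E -> R) (w : nform M) (P : partitionOfUnity O), [/\ linear_functional mu,
    forall (f : E) a, (forall p, f p <= a) -> mu f <= a,
    forall u, mu (rX X u) = 0, forall (f : E) c, (forall p, f p = c) -> mu f = c &
    (forall F, complexify mu F = nf_integral O (nf_scale F w)) /\
    forall c p, ocharts O c -> cdom c p -> 0 < re_density w c p].
Proof.
have [mu [w [P [mul muT muX mu1 muw]]]] := invariant_density (@closedT M)
  (ex_intro _ p0 I) (tangent_whole X Mcompact p0).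
exists mu, w, P; split => //; first by move=> f a fa; apply: muT => p _.
split => //.
have dv : density (re_density w) := density_Re w.
have mum := represented_mint P mul muw.
have pde c p : ocharts O c -> cdom c p -> divergence X c (re_density w c) p = 0.
  apply: (invariant_divergence Mcompact (P := P)) => // u.
  by rewrite -mum muX.
pose r := square_density P dv.
have [D rD] := square_density_bound Mcompact P dv pde.
have r0 := square_density_ge0 P dv.
have cr : continuous (r : M -> R) := @rfun_continuous _ _ _ r.
pose V := [set p | 0 < r p].
have oV : open V.
  by apply: (open_comp (f := (r : M -> R)) (D := [set x | 0 < x])) => [p _|];
    [exact: cr | exact: open_gt].
have nV : V !=set0.
  apply: contrapT => nV; have /eqP := mu1 (mkr (@rsmooth_cst _ _ M 1)) 1 (fun=> erefl).
  rewrite mum /mint big1 1?eq_sym ?oner_eq0 // => k _.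
  rewrite (ci_eq (h := fun=> 0)) => [|p kp].
    by rewrite /ci (_ : cext _ _ = fun=> 0) ?I_0 //; apply/funext => x; rewrite /cext;
      case: ifP.
  rewrite (square_density0 (P := P) (dv := dv) (pu_oc k) kp) ?mulr0 //.
  apply/eqP; rewrite eq_le r0 andbT leNgt; apply/negP => rp; apply: nV.
  by exists p.
have nK : ~ (closure V `&` [set p | r p = 0] !=set0).
  move=> nK; have tang := tangent_boundary Mcompact r0 rD nK.
  set K := closure V `&` _ in nK tang.
  have clK : closed K.
    apply: closedI; first exact: closed_closure.
    apply: (preimage_closed (f := (r : M -> R)) (D := [set 0])); first by move=> p _;
      exact: cr.
    exact: closed_eq.
  have [nu [w2 [P2 [nul nuK nuX nu1 nuw]]]] := invariant_density clK nK tang.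
  have dv2 : density (re_density w2) := density_Re w2.
  have num := represented_mint P2 nul nuw.
  (* [nu] only sees values on [K], so it kills the bump functions supported off [K]. *)
  have offK c p : ocharts O c -> cdom c p -> ~ K p -> re_density w2 c p = 0.
    move=> oc cp nKp; apply/eqP/negPn/negP => v0.
    have [b [b0 [C [clC CA C0]]]] := density_bump Mcompact P2 dv2 oc cp (closed_openC
      clK) nKp v0.
    have bK q : K q -> b q = 0 by move=> Kq; apply: C0 => /CA.
    rewrite -num; have -> : nu b = 0.
      apply/eqP; rewrite eq_le nuK => [|q /bK -> //].
      rewrite -oppr_le0; have := nul (-1) b 0; rewrite mulN1r addr0 (nu1 0 0) // addr0 => <-.
      by apply: nuK => q /bK bq; rewrite -[_ q]/(-1 * b q) bq mulr0.
    by rewrite mulr0 ltxx.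
  (* A point of [K] is a limit of points with [r > 0], which are off [K]; a nonzero density would
     persist at such points. *)
  have all0 c p : ocharts O c -> cdom c p -> re_density w2 c p = 0.
    move=> oc cp; apply/eqP/negPn/negP => v0.
    have cv : {for p, continuous (re_density w2 c)}.
      exact: (chart_continuous cp (dv2.1 c (oatlas oc))).
    have h1 : \forall q \near p, re_density w2 c q != 0.
      have n0 : nbhs (re_density w2 c p) (~` [set (0 : R)]).
        by apply: open_nbhs_nbhs; split; [exact/closed_openC/closed_eq | exact/eqP].
      have h : \forall q \near p, (~` [set (0 : R)]) (re_density w2 c q) := cv _ n0.
      by apply: filterS h => q /eqP.
    have h2 := open_nbhs_nbhs (conj (cdom_open c) cp).
    have Kp : K p.
      by apply: contrapT => nKp; move: v0; rewrite (offK c p) // eqxx.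
    have [Vp _] := Kp.
    have [q [rq [vq cq]]] := Vp _ (filterI h1 h2).
    move: vq; rewrite (offK c q) ?eqxx // => -[_ rq0].
    by have : 0 < r q := rq; rewrite (rq0 : r q = 0) ltxx.
  have /eqP := nu1 (mkr (@rsmooth_cst _ _ M 1)) 1 (fun=> erefl).
  rewrite num /mint big1 1?eq_sym ?oner_eq0 // => k _.
  rewrite (ci_eq (h := fun=> 0)) => [|p kp]; last by rewrite all0 ?mulr0 //; exact: pu_oc.
  by rewrite /ci (_ : cext _ _ = fun=> 0) ?I_0 //; apply/funext => x; rewrite /cext;
    case: ifP.
(* Without zeros on its boundary, [V] is closed as well as open. *)
have VT : V = setT.
  apply: Mconnected => //; first by exists V; rewrite ?setTI.
  exists (closure V); first exact: closed_closure.
  rewrite setTI; apply/seteqP; split; first exact: subset_closure.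
  move=> p Vp; rewrite /V /= lt_neqAle r0 andbT; apply/eqP => rp.
  by apply: nK; exists p.
move=> c p oc cp.
have v0 : re_density w c p != 0.
  by apply: (square_density_gt0 (P := P) (dv := dv) oc cp); have : V p by rewrite VT.
(* The density at [p] has the sign of [mu b] for a suitable bump function [b], and [mu] is
   nonnegative on it. *)
have [b [b0 _]] := density_bump Mcompact P dv oc cp openT I v0.
rewrite -mum; have : 0 <= mu b.
  rewrite -oppr_le0; have := mul (-1) b 0; rewrite mulN1r addr0 (mu1 0 0) // addr0 => <-.
  by apply: muT => q _; rewrite -[_ q]/(-1 * b q) mulN1r oppr_le0.
move=> mb; rewrite !ltNge; apply: contra => v_le0; exact: mulr_le0_ge0.
Qed.

End InvariantMeasure.

(** * From densities to functions *)

Section HypoellipticMeasure.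
Variables (R : realType) (n : nat) (M : smoothManifold R n).
Hypothesis Mcompact : compact [set: M].
Hypothesis Mconnected : connected [set: M].
Variables (O : orientation M) (X : vectorField M).
Hypothesis GH : globally_hypoelliptic X O.
Local Notation E := (rfun M).
Local Notation chart := (chart R n M).
Local Notation Re := complex.Re.
Local Notation Im := complex.Im.

Definition rmul (f g : E) : E := mkr (rsmoothM (rfunP f) (rfunP g)).

Lemma re_density_change (w : nform M) c c' p : ocharts O c -> ocharts O c' ->
  cdom c p -> cdom c' p -> re_density w c p =
  \det (jacobian (transition c c') (cfun c p)) * re_density w c' p.
Proof. move=> oc oc'; exact: (density_Re w).2 (oatlas oc) (oatlas oc'). Qed.

(** Jacobian determinants cancel in the quotient of two densities, which is therefore a function on
    [M]. *)
Lemma density_quotient (w w2 : nform M) :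
  (forall c p, ocharts O c -> cdom c p -> 0 < re_density w c p) ->
  exists u : E, forall c p, ocharts O c -> cdom c p ->
    re_density w2 c p = u p * re_density w c p.
Proof.
move=> w0; have /choice[oc ocP] (p : M) : exists c, ocharts O c /\ cdom c p.
  by have [c ? ?] := ocharts_cover O p; exists c.
pose u p := re_density w2 (oc p) p / re_density w (oc p) p.
have uE c p : ocharts O c -> cdom c p -> u p = re_density w2 c p / re_density w c p.
  move=> Oc cp; have [Op op] := ocP p; rewrite /u.
  rewrite (re_density_change w2 Op Oc op cp) (re_density_change w Op Oc op cp).
  rewrite -mulf_div divff ?mul1r //; apply: lt0r_neq0; exact: (ocharts_pos Op Oc op cp).
have su : rsmooth u.
  apply: rsmooth_local => p; have [Op op] := ocP p; have ap := oatlas Op.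
  exists (oc p), (cimg (oc p)); split => //; first exact: open_cimg.
    exact: cimg_cfun.
  have oi := open_cimg (oc p).
  have s2 := (density_Re w2).1 _ ap; have s1 := (density_Re w).1 _ ap.
  have s1n x : cimg (oc p) x -> re_density w (oc p) (cinv (oc p) x) != 0.
    by move=> /cdom_cinv[cx _]; rewrite gt_eqF // w0.
  apply: (smooth_on_eq oi) (smooth_onM oi s2 (smooth_on_inv oi s1n s1)) => x.
  by move=> /cdom_cinv[cx _]; rewrite (uE _ _ Op cx).
exists (mkr su) => c p Oc cp.
by rewrite -[(mkr su) p]/(u p) (uE _ _ Oc cp) divfK // gt_eqF // w0.
Qed.

Variables (L : seq M) (rad : M -> R).
Hypothesis cover : finite_cover L rad.

(** What the sequel retains of the hypothesis on [X], in terms of functions: forms, integrals and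
    the orientation no longer occur. [hm_hypo] is global hypoellipticity, with functionals
    identified with their densities relative to [mu]. *)
Record hypoelliptic_measure (mu : E -> R) : Prop := HypoellipticMeasure {
  hm_lin : linear_functional mu;
  hm_le : forall (f : E) a, (forall p, f p <= a) -> mu f <= a;
  hm_cst : forall (f : E) c, (forall p, f p = c) -> mu f = c;
  hm_inv : forall u, mu (rX X u) = 0;
  hm_gt0 : forall (f : E) p, (forall q, 0 <= f q) -> 0 < f p -> 0 < mu f;
  hm_hypo : forall (l : E -> R) (h : E), linear_functional l ->
    bounded_functional L rad l ->
    (forall u, l (rX X u) = - mu (rmul h u)) ->
    exists u : E, forall f, l f = mu (rmul u f) }.

Lemma hypoelliptic_measure_ex : M -> exists mu, hypoelliptic_measure mu.
Proof.
move=> p0; have [mu [w [P [mul mule muX mu1 [muw w0]]]]] :=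
  invariant_measure Mcompact Mconnected GH cover p0.
have mum := represented_mint Mcompact P mul muw.
have mu0 : mu 0 = 0 by exact: mu1.
have muN f : mu (- f) = - mu f.
  by have := mul (-1) f 0; rewrite scaleN1r addr0 mu0 addr0 mulN1r.
exists mu; split => //.
- move=> f p f0 fp; pose U := [set q | f p / 2 < f q].
  have oU : open U.
    apply: (open_comp (f := (f : M -> R)) (D := [set x | f p / 2 < x])) => [q _|].
      exact: rfun_continuous.
    exact: open_gt.
  have Up : U p by rewrite /U /= ltr_pdivrMr // ltr_pMr // ltr1n.
  have [c oc cp] := ocharts_cover O p.
  have wp := w0 c p oc cp.
  have [b [b0 [C [clC CU C0]]]] := density_bump Mcompact P (density_Re w) oc cp oU Up
    (lt0r_neq0 wp).
  rewrite (pmulr_rgt0 _ wp) -mum => mb.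
  have [q0 _ bmax] := compact_max Mcompact (ex_intro _ p I) (@rfun_continuous _ _ _ b).
  (* On the support of [b] one has [f > f p / 2], so [b <= B <= t * f] there. *)
  pose B := b q0; pose t := 2 * B / f p.
  have B0 : 0 <= B by exact: b0.
  have t0 : 0 <= t by rewrite /t divr_ge0 ?mulr_ge0 // ltW.
  have bt : mu (b - t *: f) <= 0.
    apply: mule => q; rewrite -[_ q]/(b q - t * f q) subr_le0.
    have [/CU Uq|/C0 ->] := pselect (C q); last by rewrite mulr_ge0.
    apply: le_trans (bmax q I) _; rewrite -/B.
    have -> : B = t * (f p / 2) by rewrite /t; field; rewrite gt_eqF.
    by apply: ler_wpM2l => //; exact: ltW.
  have : mu (b - t *: f) = mu b - t * mu f.
    by have := mul (- t) f b; rewrite scaleNr addrC => ->; rewrite mulNr addrC.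
  move=> E; rewrite E in bt; rewrite ltNge; apply/negP => mf.
  have : t * mu f <= 0 by exact: mulr_ge0_le0.
  by move: mb bt; lra.
- move=> l h ll lb lX.
  (* The Lie derivative of [l] is represented by the smooth form [h w]. *)
  have [F|w2 lw2] := hypoelliptic_functional cover GH
      (w := nf_scale (cpx h 0) w) ll lb.
    transitivity (complexify mu (cpx (rmul h (re F)) (rmul h (im F)))).
      rewrite /complexify re_lie im_lie !lX re_cpx im_cpx.
      by apply/eqP; rewrite eq_complex /= !opprK !eqxx.
    rewrite muw; congr nf_integral; apply: nform_ext.
    apply/funext => c; apply/funext => p /=.
    rewrite mulrA; congr (_ * _); rewrite /= /GRing.zero /=.
    case: (F p) => a b; apply/eqP; rewrite eq_complex /=.
    by apply/andP; split; apply/eqP; ring.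
  have lm := represented_mint Mcompact P ll lw2.
  have [u uE] := density_quotient w2 w0.
  exists u => f; rewrite lm mum; apply: eq_bigr => k _; apply: ci_eq => p kp.
  by rewrite (uE _ _ (pu_oc k) kp) /=; ring.
Qed.

End HypoellipticMeasure.

(** * Equicontinuity *)

Lemma geom_eq (R : realType) (x y C : R) :
  (forall N, `|x - y| <= C * 3^-1 ^+ N) -> x = y.
Proof.
move=> main; apply/eqP; rewrite -subr_eq0 -normr_le0; apply/ler_addgt0Pr => e e0.
rewrite add0r; have [N NP] : exists N, C * 3^-1 ^+ N < e.
  have : (fun N => C * 3^-1 ^+ N) @ \oo --> C * 0.
    apply: cvgM; first exact: cvg_cst.
    by apply: cvg_expr; rewrite ger0_norm ?invr_ge0 // invf_lt1 // ltr1n.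
  rewrite mulr0 => /cvgr_lt/(_ _ e0)[N _ NP]; exists N; exact: (NP N (leqnn N)).
exact: le_trans (main N) (ltW NP).
Qed.

Section MeasureAnalysis.
Variables (R : realType) (n : nat) (M : smoothManifold R n).
Hypothesis Mcompact : compact [set: M].
Variable X : vectorField M.
Local Notation E := (rfun M).
Variables (L : seq M) (rad : M -> R).
Hypothesis cover : finite_cover L rad.
Variable mu : E -> R.
Hypothesis H : hypoelliptic_measure X L rad mu.

Lemma mu0 : mu 0 = 0. Proof. exact: (hm_cst H). Qed.

Lemma muD f g : mu (f + g) = mu f + mu g.
Proof. by have := hm_lin H 1 f g; rewrite scale1r mul1r. Qed.

Lemma muZ c f : mu (c *: f) = c * mu f.
Proof. by have := hm_lin H c f 0; rewrite !addr0 mu0 addr0. Qed.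

Lemma muB f g : mu (f - g) = mu f - mu g.
Proof. by rewrite -scaleN1r muD muZ mulN1r. Qed.

Lemma mu_mono (f g : E) : (forall p, f p <= g p) -> mu f <= mu g.
Proof.
move=> fg; rewrite -subr_le0 -muB; apply: (hm_le H) => p.
by rewrite -[(f - g) p]/(f p - g p) subr_le0.
Qed.

Lemma mu_dom (f g : E) : (forall p, `|f p| <= g p) -> `|mu f| <= mu g.
Proof.
move=> fg; rewrite ler_norml -mulN1r -muZ; apply/andP; split; apply: mu_mono => p.
  by rewrite -[_ p]/(-1 * g p) mulN1r; have := fg p; rewrite ler_norml => /andP[].
by apply: le_trans (fg p); exact: ler_norm.
Qed.

Lemma mu_norm (f : E) C : (forall p, `|f p| <= C) -> `|mu f| <= C.
Proof.
move=> fC; have <- : mu (mkr (@rsmooth_cst _ _ M C)) = C by exact: (hm_cst H).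
exact: mu_dom.
Qed.

Lemma rX_rmul f g : rX X (rmul f g) = rmul (rX X f) g + rmul f (rX X g).
Proof.
apply: rfun_ext => p; rewrite -[LHS]/(Xr X (fun q => f q * g q) p).
rewrite (XrM X p (rfunP f) (rfunP g)).
by rewrite -[RHS]/(Xr X f p * g p + f p * Xr X g p); ring.
Qed.

Lemma mu_parts f g : mu (rmul f (rX X g)) = - mu (rmul (rX X f) g).
Proof.
have := hm_inv H (rmul f g); rewrite rX_rmul muD => /eqP.
by rewrite addrC addr_eq0 => /eqP.
Qed.

(** Otherwise a bump function supported where [h] is negative would give a negative value. *)
Lemma mu_ge0_ptw (h : E) : (forall f : E, (forall p, 0 <= f p) -> 0 <= mu (rmul h f)) ->
  forall p, 0 <= h p.
Proof.
move=> hf p; rewrite leNgt; apply/negP => hp.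
have oU : open [set q | h q < 0].
  apply: (open_comp (f := (h : M -> R)) (D := [set x | x < 0])) => [q _|].
    exact: rfun_continuous.
  exact: open_lt.
have [b [b0 bp [C [clC CU C0]]]] := supported_bump oU hp.
have := hf b b0; rewrite leNgt => /negP; apply.
rewrite -oppr_gt0 -mulN1r -muZ; apply: (hm_gt0 H (p := p)) => [q|].
  rewrite -[_ q]/(-1 * (h q * b q)) mulN1r -mulNr.
  have [/CU /= hq|/C0 ->] := pselect (C q); last by rewrite mulr0.
  by rewrite mulr_ge0 // oppr_ge0 ltW.
by rewrite -[_ p]/(-1 * (h p * b p)) mulN1r -mulNr mulr_gt0 // oppr_gt0.
Qed.

Lemma mu_eq0 (u : E) : (forall f, mu (rmul u f) = 0) -> forall p, u p = 0.
Proof.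
move=> uf p; apply/eqP; rewrite eq_le -oppr_ge0; apply/andP; split.
  have h : forall q, 0 <= (-1 *: u : E) q.
    apply: mu_ge0_ptw => f _.
    rewrite (_ : rmul _ _ = -1 *: rmul u f) ?muZ ?uf ?mulr0 //.
    by apply: rfun_ext => q; rewrite -[RHS]/(-1 * (u q * f q)) mulrA.
  by have := h p; rewrite -[_ p]/(-1 * u p) mulN1r.
by apply: mu_ge0_ptw => f _; rewrite uf.
Qed.

Section Series.
Variables (a : nat -> R) (F : nat -> E) (C : R).
Hypothesis a3 : gdom a 1.
Hypothesis FC : forall j p, `|F j p| <= C.

Definition psum N : E := \sum_(0 <= j < N) a j *: F j.

Lemma psumE N p : psum N p = series (fun j => a j * F j p) N.
Proof.
rewrite /psum /series /=; elim: N => [|N IH]; first by rewrite !big_geq.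
rewrite !big_nat_recr //= -IH -[LHS]/((\sum_(0 <= j < N) a j *: F j) p + (a N *: F N) p).
by [].
Qed.

Lemma mu_psum N (g : E) : mu (rmul (psum N) g) = series (fun j => a j * mu (rmul (F j) g)) N.
Proof.
rewrite /psum /series /=; elim: N => [|N IH].
  rewrite !big_geq //; apply: (hm_cst H) => p; exact: mul0r.
rewrite !big_nat_recr //= -IH -muZ -muD; congr mu; apply: rfun_ext => p.
set S := \sum_(_ <= _ < _) _.
rewrite -[LHS]/((S p + a N * F N p) * g p) -[RHS]/(S p * g p + a N * (F N p * g p)); ring.
Qed.

Lemma mu_series (f g : E) : (forall p, f p = ssum (fun j => a j * F j p)) ->
  mu (rmul f g) = ssum (fun j => a j * mu (rmul (F j) g)).
Proof.
move=> fE; have C0 (p : M) : 0 <= C by apply: le_trans (FC 0 p).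
have [B B0 gB] : exists2 B, 0 <= B & forall p, `|g p| <= B.
  have [B B0 gB] := Cbd_ex cover 0 (rfunP g); exists B => // p.
  exact: (Cbd_sup cover p gB).
have FgB j p : `|rmul (F j) g p| <= C * B.
  by rewrite normrM; apply: ler_pM.
have dF : gdom (fun j => a j * mu (rmul (F j) g)) (C * B).
  by apply: (gdomM a3) => j; apply: mu_norm.
apply: (geom_eq (C := C * B * 3)) => N.
have h1 := gdom_tail N dF; rewrite -mu_psum in h1.
have h2 : `|mu (rmul f g) - mu (rmul (psum N) g)| <= C * B * 3 / 2 * 3^-1 ^+ N.
  rewrite -muB; apply: mu_norm => p.
  rewrite -[(_ - _ : E) p]/(f p * g p - psum N p * g p) -mulrBl normrM fE psumE.
  have dp : gdom (fun j => a j * F j p) C by apply: (gdomM a3).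
  have := gdom_tail N dp => h3.
  apply: le_trans (ler_pM _ _ h3 (gB p)) _ => //.
  by rewrite le_eqVlt; apply/orP; left; apply/eqP; ring.
apply: le_trans (ler_distD (mu (rmul (psum N) g)) _ _) _.
apply: le_trans (lerD h2 (_ : _ <= C * B * 3 / 2 * 3^-1 ^+ N)) _; first by rewrite distrC.
by rewrite -mulrDl -splitr.
Qed.

End Series.

End MeasureAnalysis.

(** * The gliding hump *)

Section GlidingHump.
Variables (R : realType) (n : nat) (M : smoothManifold R n).
Hypothesis Mcompact : compact [set: M].
Variable X : vectorField M.
Local Notation E := (rfun M).
Variables (L : seq M) (rad : M -> R).
Hypothesis cover : finite_cover L rad.
Variable mu : E -> R.
Hypothesis H : hypoelliptic_measure X L rad mu.

(** The series of the [X G_j] has a smooth sum [h], while that of the [G_j] is only known to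
    converge uniformly. Its weak version [U] satisfies the equation with right-hand side [h], so
    hypoellipticity provides a smooth [u]. *)
Lemma series_smooth (a : nat -> R) (G : nat -> E) : gdom a 1 ->
  (forall j p, `|G j p| <= 1) ->
  (forall k, exists C, forall j, Cbd L rad k C (rX X (G j))) ->
  exists u : E, forall p, u p = ssum (fun j => a j * G j p).
Proof.
move=> a3 G1 XG.
have GfB (f : E) B j : (forall p, `|f p| <= B) -> `|mu (rmul (G j) f)| <= B.
  move=> fB; apply: (mu_norm H) => p; rewrite -[B]mul1r normrM.
  exact: ler_pM.
have fB (f : E) : exists B, forall p, `|f p| <= B.
  have [B _ gB] := Cbd_ex cover 0 (rfunP f); exists B => p.
  exact: (Cbd_sup cover p gB).
pose U (f : E) := ssum (fun j => a j * mu (rmul (G j) f)).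
have dU (f : E) : exists B, gdom (fun j => a j * mu (rmul (G j) f)) B.
  by have [B /GfB BP] := fB f; exists B; exact: gdomM.
have Ulin : linear_functional U.
  move=> c f g; have [Bf df] := dU f; have [Bg dg] := dU g.
  rewrite /U -(ssum_lin c df dg); congr ssum; apply/funext => j.
  rewrite mulrCA -mulrDr; congr (_ * _).
  rewrite -(muZ H) -(muD H); congr mu; apply: rfun_ext => p.
  by rewrite -[LHS]/(G j p * (c * f p + g p)) -[RHS]/(c * (G j p * f p) + G j p * g p); ring.
have Ubd : bounded_functional L rad U.
  exists 0, (3 / 2) => f e fe; rewrite mulrC mulrA.
  apply: ssum_le; apply: gdomM => // j; apply: GfB => p; exact: (Cbd_sup cover p fe).
pose h : E := mkr (rsmooth_series cover a3 XG).
have hX v : U (rX X v) = - mu (rmul h v).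
  have [C XGC] := XG 0.
  have XGb j p : `|rX X (G j) p| <= C by exact: (Cbd_sup cover p (XGC j)).
  rewrite (mu_series cover H a3 XGb (f := h)) //.
  have [B vB] := fB v.
  have d : gdom (fun j => a j * mu (rmul (rX X (G j)) v)) (C * B).
    apply: (gdomM a3) => j; apply: (mu_norm H) => p.
    by rewrite normrM; exact: ler_pM (XGb j p) (vB p).
  rewrite -mulN1r -(ssumZ (-1) d).
  by rewrite /U; congr ssum; apply/funext => j; rewrite (mu_parts H) mulrN mulN1r.
have [u uU] := hm_hypo H Ulin Ubd hX.
exists u => p; apply: (geom_eq (C := 3)) => N.
(* Against nonnegative [f], the difference of [u] and a partial sum pairs to at most [e * mu f];
   [mu_ge0_ptw] makes this a pointwise bound, which identifies [u] with the series everywhere and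
   not only weakly. *)
have close : `|u p - psum a G N p| <= 3 / 2 * 3^-1 ^+ N.
  pose e : R := 3 / 2 * 3^-1 ^+ N.
  have uf (f : E) : (forall p, 0 <= f p) -> `|mu (rmul (u - psum a G N) f)| <= e * mu f.
    move=> f0; have df : gdom (fun j => a j * mu (rmul (G j) f)) (mu f).
      apply: (gdomM a3) => j; apply: (mu_dom H) => q.
      by rewrite normrM (ger0_norm (f0 q)) ler_piMl.
    have := gdom_tail N df; rewrite -(mu_psum H) -[ssum _]/(U f) uU -(muB H).
    rewrite (_ : _ - _ = rmul (u - psum a G N) f); last first.
      apply: rfun_ext => q; exact: esym (mulrBl _ _ _).
    by have -> : e * mu f = mu f * 3 / 2 * 3^-1 ^+ N by rewrite /e; ring.
  have ce : rsmooth (fun _ : M => e) := rsmooth_cst e.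
  have h1 : forall q, 0 <= (mkr ce + (-1) *: (u - psum a G N) : E) q.
    apply: (mu_ge0_ptw H) => f f0.
    rewrite (_ : rmul _ f = (-1) *: rmul (u - psum a G N) f + e *: f).
      by rewrite (hm_lin H) (muZ H); have := uf f f0; rewrite ler_norml => /andP[]; lra.
    apply: rfun_ext => q.
    set w := u - _; rewrite -[LHS]/((e + -1 * w q) * f q) -[RHS]/(-1 * (w q * f q) + e
      * f q); ring.
  have h2 : forall q, 0 <= (mkr ce + (u - psum a G N) : E) q.
    apply: (mu_ge0_ptw H) => f f0.
    rewrite (_ : rmul _ f = rmul (u - psum a G N) f + e *: f).
      by rewrite (muD H) (muZ H); have := uf f f0; rewrite ler_norml => /andP[]; lra.
    apply: rfun_ext => q.
    set w := u - _; rewrite -[LHS]/((e + w q) * f q) -[RHS]/(w q * f q + e * f q); ring.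
  move: (h1 p) (h2 p).
  rewrite -[(_ + _ *: _ : E) p]/(e + -1 * (u p - psum a G N p)).
  rewrite -[(_ + _ : E) p]/(e + (u p - psum a G N p)) -/e => k1 k2.
  by rewrite ler_norml; apply/andP; split; lra.
have dp : gdom (fun j => a j * G j p) 1 by apply: (gdomM a3).
have := gdom_tail N dp; rewrite -psumE mul1r distrC => h3.
apply: le_trans (ler_distD (psum a G N p) _ _) _.
apply: le_trans (lerD close h3) _.
by rewrite -mulrDl -splitr.
Qed.

Lemma locally_lipschitz (f : 'rV[R]_n -> R) x : differentiable f x ->
  exists K d, 0 < d /\ forall y, `|y - x| < d -> `|f y - f x| <= K * `|y - x|.
Proof.
move=> df; have [d d0 dP] := differentiable_expansion df ltr01.
exists (1 + \sum_i `|'D_'e_i f x|), d; split=> // y /dP; rewrite mul1r => h.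
set S := \sum_i (y - x) 0 i * _ in h.
have hS : `|S| <= \sum_i `|'D_'e_i f x| * `|y - x|.
  apply: le_trans (ler_norm_sum _ _ _) _; apply: ler_sum => i _.
  by rewrite normrM mulrC ler_wpM2l // rV_coord_le.
have := ler_normD (f y - f x - S) S; rewrite subrK mulrDl mul1r mulr_suml.
by move: h hS; lra.
Qed.

(** The supremum need not be attained; the loss [4/3] of an almost maximizer enters the constants of
    [equi_lipschitz]. *)
Lemma near_sup (A : set R) x0 b : A x0 -> 0 < x0 -> (forall x, A x -> x <= b) ->
  exists x, [/\ A x, 3 / 4 * x0 <= x & forall y, A y -> y <= 4 / 3 * x].
Proof.
move=> Ax0 x0_gt0 Ab; have As : has_sup A by split; [exists x0 | exists b].
have sx0 : x0 <= sup A by apply: ub_le_sup => //; exists b.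
have s0 : 0 < sup A / 4 by rewrite divr_gt0 // (lt_le_trans x0_gt0).
have [x Ax xs] := sup_adherent s0 As.
exists x; split => //; first by move: sx0 xs; lra.
move=> y Ay; have : y <= sup A by apply: ub_le_sup => //; exists b.
by move: xs; lra.
Qed.

(* Sokal's choice of signs: [a_j = 3^-j] or [-3^-j] is chosen so that the [j]-th term
   does not decrease the [j]-th functional of the partial sum. *)
Lemma hump_signs (T : nat -> E -> R) (G : nat -> E) :
  (forall j c f g, T j (c *: f + g) = c * T j f + T j g) ->
  exists a, gdom a 1 /\ forall j,
    3^-1 ^+ j * `|T j (G j)| <= `|T j (psum a G j.+1)|.
Proof.
move=> Tlin.
have sgn j (y : E) : exists b : R, `|b| = 3^-1 ^+ j /\
    3^-1 ^+ j * `|T j (G j)| <= `|T j (b *: G j + y)|.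
  pose e : R := 3^-1 ^+ j; have e0 : 0 <= e by rewrite exprn_ge0 // invr_ge0.
  set t := T j (G j); set z := T j y.
  have [h|h] := leP (e * `|t|) `|e * t + z|.
    by exists e; rewrite ger0_norm // Tlin.
  exists (- e); rewrite normrN ger0_norm // Tlin; split=> //.
  rewrite -/e -/t -/z -[e in e * `|t|](ger0_norm e0) -normrM.
  have : `|e * t| = e * `|t| by rewrite normrM ger0_norm.
  (* The values for the two signs differ by [2 * (e * t)], so one of them has size at least
     [e * |t|]. *)
  have := ler_normB (e * t + z) (- e * t + z).
  rewrite (_ : e * t + z - (- e * t + z) = 2 * (e * t)); last by ring.
  by rewrite [`|2 * _|]normrM [`|2|]ger0_norm //; move: h; lra.
have /choice[b bP] j : exists b : E -> R, forall y, `|b y| = 3^-1 ^+ j /\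
    3^-1 ^+ j * `|T j (G j)| <= `|T j (b y *: G j + y)|.
  by have /choice[b bP] := sgn j; exists b.
(* [y] is the sequence of partial sums, on which each new sign depends. *)
pose fix y j : E := if j is i.+1 then b i (y i) *: G i + y i else 0.
pose a j := b j (y j).
have ya N : psum a G N = y N.
  elim: N => [|N IH]; first by rewrite /psum big_geq.
  by rewrite /psum big_nat_recr //= -/(psum a G N) IH addrC.
exists a; split=> j; first by rewrite mul1r (bP j (y j)).1.
by rewrite ya /=; exact: (bP j (y j)).2.
Qed.

(** If the claim fails, [step] picks at scale [1/(j+1)] a difference quotient at [p] of size at
    least [3/4 * 4^j] and almost extremal on [B]. With coefficients of size [3^-j] the sum [u] has
    quotients of order [(4/3)^j] at points tending to [p], although it is differentiable there. *)
Lemma equi_lipschitz (B : set E) (p : M) :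
  (forall G, B G -> forall q, `|G q| <= 1) ->
  (forall k, exists C, forall G, B G -> Cbd L rad k C (rX X G)) ->
  exists K r, 0 < r /\ forall G x, B G -> `|x - cfun (chart_at p) p| < r ->
    `|G (cinv (chart_at p) x) - G p| <= K * `|x - cfun (chart_at p) p|.
Proof.
move=> B1 XB; set c := chart_at p; set x0 := cfun c p; have cp : cdom c p := chart_at_dom p.
apply: contrapT => nlip; pose T x (G : E) := (G (cinv c x) - G p) / `|x - x0|.
have step j : exists z : 'rV[R]_n * E, [/\ B z.2, `|z.1 - x0| < j.+1%:R^-1, 0 < `|z.1 - x0|,
    3 / 4 * 4 ^+ j <= `|T z.1 z.2| &
    forall G, B G -> `|T z.1 G| <= 4 / 3 * `|T z.1 z.2|].
  have [x [G [BG xr Gx]]] : exists x G, [/\ B G, `|x - x0| < j.+1%:R^-1 &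
      4 ^+ j * `|x - x0| < `|G (cinv c x) - G p|].
    apply: contrapT => h; apply: nlip; exists (4 ^+ j), j.+1%:R^-1; split.
      by rewrite invr_gt0.
    by move=> G x BG xr; rewrite leNgt; apply/negP => Gx; apply: h; exists x, G.
  have xx0 : 0 < `|x - x0|.
    rewrite normr_gt0 subr_eq0; apply/eqP => xx.
    by move: Gx; rewrite xx /x0 (cfunK c cp) !subrr !normr0 mulr0 ltxx.
  have TE G' : `|T x G'| = `|G' (cinv c x) - G' p| / `|x - x0|.
    by rewrite /T normrM normfV normr_id.
  pose A := [set t | exists2 G', B G' & t = `|T x G'|].
  have Gt : 4 ^+ j < `|T x G| by rewrite TE ltr_pdivlMr.
  have T0 : 0 < `|T x G| by apply: lt_trans Gt; rewrite exprn_gt0.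
  have AG : A `|T x G| by exists G.
  have Ab t : A t -> t <= 2 / `|x - x0|.
    move=> [G' BG' ->]; rewrite TE ler_pM2r ?invr_gt0 //.
    by apply: le_trans (ler_normB _ _) _; have := B1 _ BG' p;
      have := B1 _ BG' (cinv c x); lra.
  have [t [[G1 BG1 tE] tx tmax]] := near_sup AG T0 Ab; subst t.
  exists (x, G1); split=> //=; first by apply: le_trans tx; lra.
  by move=> G' BG'; apply: tmax; exists G'.
have /choice[z zP] := step.
pose G j := (z j).2; pose Tj j := T (z j).1.
have BG j : B (G j) by have [] := zP j.
have Tlin j a f g : Tj j (a *: f + g) = a * Tj j f + Tj j g.
  by rewrite /Tj /T !rfun_lin; ring.
have [a [a3 aT]] := @hump_signs Tj G Tlin.
have G1 j q : `|G j q| <= 1 by exact: B1.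
have XG k : exists C, forall j, Cbd L rad k C (rX X (G j)).
  by have [C CP] := XB k; exists C => j; exact: CP.
have [u uE] := series_smooth a3 G1 XG.
have dG q : gdom (fun j => a j * G j q) 1 by exact: gdomM.
have Tu j : Tj j u = ssum (fun i => a i * Tj j (G i)).
  have e1 : u (cinv c (z j).1) - u p =
      ssum (fun i => a i * G i (cinv c (z j).1) - a i * G i p).
    by rewrite (ssumB (dG _) (dG _)) !uE.
  have dd : gdom (fun i => a i * G i (cinv c (z j).1) - a i * G i p) 2.
    move=> i; rewrite -mulrBr normrM mulrC; apply: ler_pM => //.
      by apply: le_trans (ler_normB _ _) _; have := G1 i p;
        have := G1 i (cinv c (z j).1); lra.
    by have := a3 i; rewrite mul1r.
  rewrite /Tj {1}/T e1 mulrC -(ssumZ _ dd); congr ssum; apply/funext => i.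
  by rewrite /T; ring.
have Tpsum j N : Tj j (psum a G N) = series (fun i => a i * Tj j (G i)) N.
  rewrite /psum /series /=; elim: N => [|N IH].
    by rewrite !big_geq // /Tj /T subrr mul0r.
  by rewrite !big_nat_recr //= -IH addrC Tlin addrC.
(* With [t] the size of the quotient of [G j], the head is at least [3^-j t] and the tail at most
   [(4/3) t * 3^-j / 2]. A third of [3^-j t] remains, and [3^-j t >= (3/4) (4/3)^j]. *)
have big j : (4 / 3) ^+ j / 4 <= `|Tj j u|.
  have [_ _ _ t4 tmax] := zP j; set t := `|T _ _| in t4 tmax.
  have t0 : 0 <= t by exact: normr_ge0.
  have dT : gdom (fun i => a i * Tj j (G i)) (4 / 3 * t).
    by apply: (gdomM a3) => i; exact: tmax.
  have tail := gdom_tail j.+1 dT; rewrite -Tu -Tpsum in tail.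
  have head := aT j; rewrite -/(G j) -[`|Tj j (G j)|]/t in head.
  have := ler_normB (Tj j u) (Tj j u - Tj j (psum a G j.+1)).
  rewrite opprB addrC subrK => tri.
  have e0 : 0 <= 3^-1 ^+ j :> R by rewrite exprn_ge0 // invr_ge0.
  have et : 3^-1 ^+ j * (3 / 4 * 4 ^+ j) <= 3^-1 ^+ j * t by rewrite ler_wpM2l.
  have -> : (4 / 3) ^+ j / 4 = 3^-1 ^+ j * (3 / 4 * 4 ^+ j) / 3 :> R.
    by rewrite expr_div_n exprVn; field; rewrite expf_neq0.
  have tail2 : 4 / 3 * t * 3 / 2 * 3^-1 ^+ j.+1 = 2 / 3 * (3^-1 ^+ j * t).
    by rewrite exprS; field.
  rewrite tail2 in tail.
  by move: tail head tri et; lra.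
have du : differentiable (fun x => u (cinv c x) : R) x0.
  have su : smooth_on (cimg c) (fun x => u (cinv c x)) := rfunP u (chart_at_atlas p).
  exact: (su [::] x0 (cimg_cfun cp)).
have [K [d [d0 Kd]]] := locally_lipschitz du.
(* Bernoulli's inequality makes [(4/3)^j] exceed any bound. *)
have [j jd jK] : exists2 j, j.+1%:R^-1 < d & K < (4 / 3) ^+ j / 4 :> R.
  have grow i : 1 + i%:R / 3 <= (4 / 3) ^+ i :> R.
    elim: i => [|i IH]; first by rewrite mul0r addr0 expr0.
    rewrite exprS -natr1; have : 0 <= i%:R :> R by [].
    by move: IH; lra.
  pose m := (Num.truncn d^-1 + Num.truncn (12 * `|K|)).+1.
  exists m.
    have : d^-1 < m%:R.
      apply: lt_le_trans (truncnS_gt _) _; rewrite ler_nat ltnS; exact: leq_addr.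
    move=> dm; rewrite -[d]invrK ltf_pV2 ?posrE ?invr_gt0 //.
    by apply: lt_trans dm _; rewrite ltr_nat.
  have Km : 12 * `|K| < m%:R.
    apply: lt_le_trans (truncnS_gt _) _; rewrite ler_nat ltnS; exact: leq_addl.
  by have := grow m; have := ler_norm K; lra.
have [_ xr x1 _ _] := zP j.
have := Kd (z j).1 (lt_trans xr jd).
rewrite /x0 (cfunK c cp) -/x0 leNgt => /negP; apply.
rewrite -ltr_pdivlMr //; apply: lt_le_trans jK _; apply: le_trans (big j) _.
by rewrite /Tj /T normrM normfV normr_id.
Qed.

End GlidingHump.

(** * Ergodicity and solvability *)

Section Solvability.
Variables (R : realType) (n : nat) (M : smoothManifold R n).
Hypothesis Mcompact : compact [set: M].
Hypothesis Mconnected : connected [set: M].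
Variable X : vectorField M.
Local Notation E := (rfun M).
Variables (L : seq M) (rad : M -> R).
Hypothesis cover : finite_cover L rad.
Variable mu : E -> R.
Hypothesis H : hypoelliptic_measure X L rad mu.

Lemma equicontinuous_at (B : set E) (p : M) e : 0 < e ->
  (forall G, B G -> forall q, `|G q| <= 1) ->
  (forall k, exists C, forall G, B G -> Cbd L rad k C (rX X G)) ->
  \forall q \near p, forall G, B G -> `|G q - G p| <= e.
Proof.
move=> e0 B1 XB; have [K [r [r0 Kr]]] := equi_lipschitz cover H p B1 XB.
set c := chart_at p in Kr; have cp : cdom c p := chart_at_dom p.
pose d := Num.min r (e / (`|K| + 1)).
have K1 : 0 < `|K| + 1 by rewrite ltr_wpDl.
have d0 : 0 < d by rewrite lt_min r0 divr_gt0.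
have h1 : \forall q \near p, `|cfun c p - cfun c q| < d.
  have cc := cfun_continuous c cp.
  have nd : nbhs (cfun c p) (ball (cfun c p) d) by exact: nbhsx_ballx.
  have h : \forall q \near p, ball (cfun c p) d (cfun c q) := cc _ nd.
  by apply: filterS h => q; rewrite -ball_normE.
have h2 := open_nbhs_nbhs (conj (cdom_open c) cp).
apply: filterS2 h1 h2 => q qd cq G BG.
rewrite distrC in qd; have := Kr G (cfun c q) BG (lt_le_trans qd _).
rewrite (cfunK c cq) => h; apply: le_trans (h _) _; first by rewrite ge_min lexx.
apply: le_trans (ler_wpM2r (normr_ge0 _) (ler_norm K)) _.
have qe : `|cfun c q - cfun c p| <= e / (`|K| + 1).
  by apply: ltW; apply: lt_le_trans qd _; rewrite ge_min lexx orbT.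
apply: le_trans (ler_wpM2l (normr_ge0 K) qe) _.
by rewrite mulrCA ger_pMr // ler_pdivrMr // mul1r lerDl.
Qed.

Lemma Cbd0 k : Cbd L rad k 0 (0 : E).
Proof. by have := CnormP cover (k := k) (0 : E); rewrite (Cnorm0 cover). Qed.

(* For [Xg = 0] the functions [s(g - g p) / (1 + s^2(g - g p)^2)] are killed by
   [X], so they are equicontinuous at [p], which forces [g] to be locally
   constant. *)
Lemma ergodic (g : E) : (forall p, Xr X g p = 0) -> forall p q, g q = g p.
Proof.
move=> Xg; have loc p : \forall q \near p, g q = g p.
  have st : rsmooth (fun q => g q - g p) := rsmoothB (rfunP g) (rsmooth_cst (g p)).
  have Xt q : Xr X (fun q => g q - g p) q = 0.
    rewrite (XrB X q (rfunP g) (rsmooth_cst (g p))) Xg Xr_cst subrr //.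
  pose t : E := mkr st.
  have dpos s q : 1 + (s * t q) * (s * t q) != 0.
    by rewrite gt_eqF // ltr_pwDl // -expr2 sqr_ge0.
  have sst s : rsmooth (fun q => s * t q) := rsmoothZ s st.
  have Xst s q : Xr X (fun q => s * t q) q = 0 by rewrite (XrZ X s q st) Xt mulr0.
  have sd s : rsmooth (fun q => 1 + (s * t q) * (s * t q)).
    exact: rsmoothD (rsmooth_cst 1) (rsmoothM (sst s) (sst s)).
  have Xd s q : Xr X (fun q => 1 + (s * t q) * (s * t q)) q = 0.
    rewrite (XrD X q (rsmooth_cst 1) (rsmoothM (sst s) (sst s))) Xr_cst add0r.
    by rewrite (XrM X q (sst s) (sst s)) Xst mulr0 addr0.
  have si s := rsmooth_inv (dpos s) (sd s).
  pose G s : E := mkr (rsmoothM (sst s) (si s)).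
  have XG s : rX X (G s) = 0.
    apply: rfun_ext => q; rewrite -[LHS]/(Xr X (fun q =>
      s * t q * (1 + s * t q * (s * t q))^-1) q).
    rewrite (XrM X q (sst s) (si s)) Xst mulr0 ?addr0.
    by rewrite (Xr_inv0 (dpos s) (sd s) (Xd s q)) mulr0 ?addr0.
  have GE s q : G s q = s * t q / (1 + s * t q * (s * t q)) by [].
  have G1 s q : `|G s q| <= 1.
    rewrite GE normrM normfV [X in _ / X]ger0_norm; last first.
      by rewrite addr_ge0 // -expr2 sqr_ge0.
    rewrite ler_pdivrMr; last by rewrite ltr_pwDl // -expr2 sqr_ge0.
    rewrite mul1r; set x := s * t q.
    have := sqr_ge0 (`|x| - 1); rewrite sqrrB1 real_normK ?num_real // -expr2.
    by have := normr_ge0 x; lra.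
  pose B := [set G s | s in [set: R]].
  have B1 F : B F -> forall q, `|F q| <= 1 by move=> [s _ <-]; exact: G1.
  have BX k : exists C, forall F, B F -> Cbd L rad k C (rX X F).
    by exists 0 => _ [s _ <-]; rewrite XG; exact: Cbd0.
  have e0 : (0 : R) < 1 / 4 by lra.
  have := equicontinuous_at p e0 B1 BX.
  apply: filterS => q qG; apply/eqP/negPn/negP => gq.
  have tq : t q != 0 by rewrite -[t q]/(g q - g p) subr_eq0.
  (* With [s = 1 / t q] the function [G s] passes from [0] at [p] to [1/2] at [q], against the bound
     [1/4]. *)
  have := qG (G (t q)^-1) (ex_intro2 _ _ _ I erefl).
  rewrite !GE (_ : t p = 0); last by rewrite -[t p]/(g p - g p) subrr.
  by rewrite mulVf // mulr0 mul0r subr0 mulr1 ger0_norm ?divr_ge0 // -[1 + 1]/(2%:R); lra.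
move=> p; set A := [set q | g q = g p].
have AT : A = setT.
  apply: Mconnected; first by exists p.
    exists A; last by rewrite setTI.
    rewrite openE => q Aq; rewrite /interior.
    by apply: filterS (loc q) => q' gq'; rewrite /A /= gq'.
  exists A; last by rewrite setTI.
  apply: (preimage_closed (f := (g : M -> R)) (D := [set g p])); last exact: closed_eq.
  by move=> q _; exact: rfun_continuous.
by move=> q; have : A q by rewrite AT.
Qed.

(** Along an ultrafilter all bounded sequences converge at once, so the limit functional of
    [a_priori_estimate] requires no diagonal extraction over test functions. *)
Lemma ultra_limit (U : set_system nat) (s : nat -> R) B : UltraFilter U ->
  (forall k, `|s k| <= B) -> exists x : R, s k @[k --> U] --> x.
Proof.
move=> UU sB; have cB : compact `[- B, B]%classic := segment_compact (a := - B) (b := B).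
have UB : (s @ U) `[- B, B]%classic.
  suff h : U (s @^-1` `[- B, B]%classic) by exact: h.
  have <- : setT = s @^-1` `[- B, B]%classic.
    by apply/seteqP; split=> k //= _; rewrite in_itv /= -ler_norml.
  exact: filterT.
have [x [_ clx]] := cB _ _ UB.
exists x => V Vx; have [//|nV] := in_ultra_setVsetC (s @^-1` V) UU.
have [y [nVy Vy]] := clx (~` V) V nV Vx.
by case: nVy.
Qed.

Lemma rX_lin c f g : rX X (c *: f + g) = c *: rX X f + rX X g.
Proof. by apply: rfun_ext => p; exact: Xr_lin. Qed.

Lemma rX_cst a : rX X (mkr (@rsmooth_cst _ _ M a)) = 0.
Proof. by apply: rfun_ext => p; exact: Xr_cst. Qed.

(** Subtracting the mean of [g] changes neither [Xg] nor, as [mu f = 0], the pairing with [f]. Since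
    this pairing is at most [F * s], division by the sup norm [s] leaves [Xg] small. *)
Lemma normalized_counterexample (f g : E) F k (p0 : M) : 0 < F ->
  (forall p, `|f p| <= F) -> mu f = 0 ->
  k.+1%:R * F * Cnorm L rad k (rX X g) < `|mu (rmul f g)| ->
  exists G : E, [/\ forall q, `|G q| <= 1, exists p, `|G p| = 1, mu G = 0 &
    Cnorm L rad k (rX X G) <= k.+1%:R^-1].
Proof.
move=> F0 fF mf fg; pose m : E := mkr (@rsmooth_cst _ _ M (mu g)).
have mum : mu m = mu g by exact: (hm_cst H).
pose g' := -1 *: m + g.
have rXg' : rX X g' = rX X g by rewrite /g' rX_lin rX_cst scaler0 add0r.
have mug' : mu g' = 0 by rewrite (hm_lin H) mum mulN1r addNr.
have mufg' : mu (rmul f g') = mu (rmul f g).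
  rewrite (_ : rmul f g' = - mu g *: f + rmul f g);
    first by rewrite (hm_lin H) mf mulr0 add0r.
  apply: rfun_ext => p; rewrite -[LHS]/(f p * (-1 * mu g + g p)) -[RHS]/(- mu g * f p +
    f p * g p); ring.
have cg : continuous (fun p => `|g' p|).
  by move=> p; exact: cvg_norm (@rfun_continuous _ _ _ g' p).
have [p _ pmax] := compact_max Mcompact (ex_intro _ p0 I) cg.
set s := `|g' p| in pmax.
have Fs : `|mu (rmul f g)| <= F * s.
  by rewrite -mufg'; apply: (mu_norm H) => q; rewrite normrM; apply: ler_pM => //;
    exact: pmax.
have N0 := Cnorm_ge0 cover k (rX X g).
have s0 : 0 < s.
  rewrite -(pmulr_rgt0 _ F0); apply: lt_le_trans Fs; apply: le_lt_trans fg.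
  by rewrite !mulr_ge0 // ltW.
have si : 0 <= s^-1 by rewrite invr_ge0 ltW.
exists (s^-1 *: g'); split.
- move=> q; rewrite -[_ q]/(s^-1 * g' q) normrM ger0_norm // mulrC ler_pdivrMr // mul1r.
  exact: pmax.
- by exists p; rewrite -[_ p]/(s^-1 * g' p) normrM ger0_norm // mulVf // gt_eqF.
- by rewrite (muZ H) mug' mulr0.
- have -> : rX X (s^-1 *: g') = s^-1 *: rX X g.
    by have := rX_lin s^-1 g' 0; rewrite !addr0 rXg' (_ : rX X 0 = 0) ?addr0 //;
      apply: rfun_ext => q; exact: Xr_cst.
  have h : k.+1%:R * Cnorm L rad k (rX X g) < s.
    by rewrite -(ltr_pM2l F0) mulrA [F * _]mulrC; exact: lt_le_trans fg Fs.
  rewrite (CnormZ cover) // -(ler_pM2l s0) mulVKf ?gt_eqF // ler_pdivlMr // mulrC.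
  exact: ltW.
Qed.

Lemma Cnorm_mono k k' (f : E) : (k <= k')%N -> Cnorm L rad k f <= Cnorm L rad k' f.
Proof.
move=> kk; apply: Cnorm_le; first exact: (Cnorm_ge0 cover).
apply: (@Cbd_le _ _ _ _ _ k' k (Cnorm L rad k' f)) => //; exact: (CnormP cover).
Qed.

Lemma a_priori_estimate (f : E) (p0 : M) : mu f = 0 -> exists k C, 0 <= C /\
  forall g, `|mu (rmul f g)| <= C * Cnorm L rad k (rX X g).
Proof.
move=> mf; apply: contrapT => nest.
have [F F0 fF] : exists2 F, 0 < F & forall p, `|f p| <= F.
  have [B B0 gB] := Cbd_ex cover 0 (rfunP f); exists (B + 1); first by rewrite ltr_wpDl.
  by move=> p; apply: le_trans (Cbd_sup cover p gB) _; rewrite lerDl.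
have step k : exists G : E, [/\ forall q, `|G q| <= 1, exists p, `|G p| = 1, mu G = 0 &
    Cnorm L rad k (rX X G) <= k.+1%:R^-1].
  have [g fg] : exists g, k.+1%:R * F * Cnorm L rad k (rX X g) < `|mu (rmul f g)|.
    apply: contrapT => h; apply: nest; exists k, (k.+1%:R * F); split.
      by rewrite mulr_ge0 // ltW.
    by move=> g; rewrite leNgt; apply/negP => fg; apply: h; exists g.
  exact: normalized_counterexample F0 fF mf fg.
have /choice[G GP] := step.
have G1 k q : `|G k q| <= 1 by have [] := GP k.
have /choice[pk pkP] k : exists p, `|G k p| = 1 by have [] := GP k.
have G0 k : mu (G k) = 0 by have [] := GP k.
have XGk k : Cnorm L rad k (rX X (G k)) <= k.+1%:R^-1 by have [] := GP k.
(* For [j >= k] the norm of order [k] is below that of order [j], hence at most [1]; the finitely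
   many [j < k] are added to the bound. *)
have XG k : exists C, forall j, Cbd L rad k C (rX X (G j)).
  exists (1 + \sum_(i < k) Cnorm L rad k (rX X (G i))) => j.
  have sum0 : 0 <= \sum_(i < k) Cnorm L rad k (rX X (G i)).
    by apply: sumr_ge0 => i _; exact: (Cnorm_ge0 cover).
  apply: (Cbd_le (leqnn k)) (CnormP cover (rX X (G j))).
  have [kj|jk] := leqP k j.
    apply: le_trans (Cnorm_mono _ kj) _; apply: le_trans (XGk j) _.
    apply: (@le_trans _ _ 1); last by rewrite lerDl.
    by rewrite invf_le1 // ler1n.
  rewrite (bigD1 (Ordinal jk)) //= addrCA lerDl addr_ge0 // sumr_ge0 // => i _.
  exact: (Cnorm_ge0 cover).
have XGsup k q : `|rX X (G k) q| <= k.+1%:R^-1.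
  apply: le_trans (XGk k); exact: (Cbd_sup cover q (CnormP cover _)).
have [U [UU ooU]] := ultraFilterLemma (eventually_filter).
have Gf (g : E) : exists x : R, mu (rmul (G k) g) @[k --> U] --> x.
  have [B B0 gB] := Cbd_ex cover 0 (rfunP g).
  apply: (ultra_limit (B := B) UU) => k; apply: (mu_norm H) => p.
  rewrite normrM -[B]mul1r; apply: ler_pM => //; exact: (Cbd_sup cover p gB).
have /choice[l lP] := Gf.
have UP : ProperFilter U by exact: ultra_proper.
have luniq g x : mu (rmul (G k) g) @[k --> U] --> x -> l g = x.
  by move=> h; exact: (cvg_unique _ (lP g) h).
have llin : linear_functional l.
  move=> c g h; apply: luniq.
  have e1 : (fun k => mu (rmul (G k) (c *: g + h))) =
      (fun k => c * mu (rmul (G k) g) + mu (rmul (G k) h)).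
    apply/funext => k; rewrite -(hm_lin H); congr mu; apply: rfun_ext => p.
    by rewrite -[LHS]/(G k p * (c * g p + h p)) -[RHS]/(c * (G k p * g p) + G k p * h
      p); ring.
  rewrite e1; apply: cvgD; last exact: lP.
  by apply: cvgM; [exact: cvg_cst | exact: lP].
have lbd : bounded_functional L rad l.
  exists 0, 1 => g e ge; rewrite mul1r leNgt; apply/negP => el.
  have nl : `|mu (rmul (G k) g)| @[k --> U] --> `|l g| by exact: (cvg_norm (lP g)).
  have [k] := filter_ex (cvgr_gt _ nl _ el); rewrite ltNge => /negP; apply.
  apply: (mu_norm H) => p.
  rewrite normrM -[e]mul1r; apply: ler_pM => //; exact: (Cbd_sup cover p ge).
(* [mu (G_k (Xg)) = - mu ((X G_k) g)] tends to zero because [X G_k] does so uniformly. *)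
have linv g : l (rX X g) = 0.
  apply: luniq.
  have [B B0 gB] := Cbd_ex cover 0 (rfunP g).
  have small : (fun k => B / k.+1%:R) @ U --> (0 : R).
    apply: cvg_trans (_ : B / k.+1%:R @[k --> \oo] --> (0 : R)).
      by move=> A /ooU.
    by rewrite -[X in _ --> X](mulr0 B); apply: cvgM; [exact: cvg_cst | exact: cvg_harmonic].
  have le k : `|mu (rmul (G k) (rX X g))| <= B / k.+1%:R.
    rewrite (mu_parts H) normrN; apply: (mu_norm H) => p.
    rewrite normrM [B / _]mulrC; apply: ler_pM (XGsup k p) _ => //.
    exact: (Cbd_sup cover p gB).
  apply/cvgr0Pnorm_lt => e e0.
  have h : \forall k \near U, B / k.+1%:R < e by move/cvgr_lt: small; apply.
  by apply: filterS h => k; apply: le_lt_trans.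
have l0 v : l (rX X v) = - mu (rmul 0 v).
  by rewrite linv (hm_cst H (c := 0)) ?oppr0 // => p; exact: mul0r.
have [u lu] := hm_hypo H llin lbd l0.
have Xu : forall p, Xr X u p = 0.
  apply: (mu_eq0 H (u := rX X u)) => g.
  by apply/eqP; rewrite -oppr_eq0 -(mu_parts H) -lu linv.
have uc := ergodic Xu p0.
have lE g : l g = u p0 * mu g.
  rewrite lu -(muZ H); congr mu; apply: rfun_ext => q.
  by rewrite -[LHS]/(u q * g q) uc.
(* Ergodicity has made the limit a constant multiple of [mu]; the normalization [mu (G_k) = 0] makes
   the constant zero. *)
have up0 : u p0 = 0.
  pose one : E := mkr (@rsmooth_cst _ _ M 1).
  have : l one = 0.
    apply: luniq; rewrite (_ : (fun k => _) = fun=> 0); first exact: cvg_cst.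
    apply/funext => k; rewrite -[RHS](G0 k); congr mu; apply: rfun_ext => q.
    exact: mulr1.
  by rewrite lE (hm_cst H (c := 1)) // mulr1.
(* Points where [|G_k| = 1] accumulate at some [x]. By equicontinuity [|G_k x| >= 3/4] when such a
   point is near [x], so on a fixed neighbourhood [G_k] keeps its sign with size at least [1/2], and
   [mu (G_k b)] cannot tend to zero. *)
have [x [_ clx]] : [set: M] `&` cluster (pk @ U) !=set0.
  by apply: Mcompact; exact: filterT.
pose B := [set G k | k in [set: nat]].
have B1 F' : B F' -> forall q, `|F' q| <= 1 by move=> [k _ <-]; exact: G1.
have BX k : exists C, forall F', B F' -> Cbd L rad k C (rX X F').
  by have [C CP] := XG k; exists C => _ [j _ <-]; exact: CP.
have e0 : (0 : R) < 1 / 4 by lra.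
have := equicontinuous_at x e0 B1 BX.
rewrite /= => /nbhs_interior; rewrite nbhsE => -[W [oW Wx] WP].
have {}WP q k : W q -> `|G k q - G k x| <= 1 / 4.
  by move=> /WP/interior_subset; apply; exists k.
have [b [b0 bx [C [clC CW C0]]]] := supported_bump oW Wx.
have mb : 0 < mu b by exact: (hm_gt0 H (p := x)).
have near_small : \forall k \near U, `|mu (rmul (G k) b)| < mu b / 2.
  have : mu (rmul (G k) b) @[k --> U] --> (0 : R).
    by have := lP b; rewrite lE up0 mul0r.
  by move/cvgr0Pnorm_lt; apply; rewrite divr_gt0.
have UA : (pk @ U) (pk @` [set k | `|mu (rmul (G k) b)| < mu b / 2]).
  by apply: filterS near_small => k kA; exists k.
have [_ [[k /= kA <-] Wk]] := clx _ W UA (open_nbhs_nbhs (conj oW Wx)).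
have h1 := WP _ k Wk; have h2 := pkP k.
have h3 := ler_normD (G k (pk k) - G k x) (G k x); rewrite subrK h2 in h3.
have pos (s : R) : (forall q, W q -> 1 / 2 <= s * G k q) -> mu b / 2 <= s * mu (rmul (G k) b).
  move=> sG; rewrite -(muZ H) mulrC -(muZ H); apply: (mu_mono H) => q.
  rewrite -[leLHS]/(2^-1 * b q) -[leRHS]/(s * (G k q * b q)) mulrA.
  have [/CW/sG Gq|/C0 ->] := pselect (C q); last by rewrite !mulr0.
  by rewrite ler_wpM2r //; move: Gq; lra.
have [xp|xn] := leP 0 (G k x).
  rewrite [`|G k x|]ger0_norm // in h3.
  have : mu b / 2 <= 1 * mu (rmul (G k) b).
    apply: pos => q Wq; have := WP q k Wq; rewrite ler_norml => /andP[+ _].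
    by move: h1 h3; lra.
  by rewrite mul1r; move: kA; have := ler_norm (mu (rmul (G k) b)); lra.
rewrite [`|G k x|]ltr0_norm // in h3.
have : mu b / 2 <= -1 * mu (rmul (G k) b).
  apply: pos => q Wq; have := WP q k Wq; rewrite ler_norml => /andP[_].
  by move: h1 h3; lra.
by rewrite mulN1r; move: kA; have := ler_norm (- mu (rmul (G k) b)); rewrite normrN; lra.
Qed.

Lemma solve (f : E) (p0 : M) : mu f = 0 -> exists u, rX X u = f.
Proof.
move=> mf; have [k [C [C0 est]]] := a_priori_estimate p0 mf.
pose p (z : E) := C * Cnorm L rad k z.
have pD z w : p (z + w) <= p z + p w.
  by rewrite /p -mulrDr ler_wpM2l // (CnormD cover).
have pZ c z : 0 <= c -> p (c *: z) = c * p z.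
  by move=> c0; rewrite /p (CnormZ cover) // mulrCA.
(* Different [g] may have the same [Xg]: the a priori estimate, as domination, makes the relation
   single-valued. *)
pose D : set (E * R) := [set z | exists g, z.1 = rX X g /\ z.2 = - mu (rmul f g)].
have Dd : dominated_rel p D.
  split.
  - exists 0; split => /=; first by apply: rfun_ext => q; rewrite -[RHS]/(Xr X _ q) Xr_cst.
    by rewrite (hm_cst H (c := 0)) ?oppr0 // => q; exact: mulr0.
  - move=> c x y a b [g /= [-> ->]] [h /= [-> ->]]; exists (c *: g + h).
    rewrite /= rX_lin; split=> //.
    rewrite (_ : rmul f (c *: g + h) = c *: rmul f g + rmul f h).
      by rewrite (hm_lin H); ring.
    apply: rfun_ext => q.
    by rewrite -[LHS]/(f q * (c * g q + h q)) -[RHS]/(c * (f q * g q) + f q * h q); ring.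
  - move=> x a [g /= [-> ->]]; apply: le_trans (est g).
    by rewrite -normrN ler_norm.
have [l [llin lp lD]] := hahn_banach pD pZ Dd.
have lbd : bounded_functional L rad l.
  exists k, C => g e ge.
  have e0 : 0 <= e by apply: le_trans (Cbd_sup cover p0 ge).
  have lz0 : l 0 = 0.
    by have := llin (-1) 0 0; rewrite scaler0 addr0 mulN1r addNr.
  have lN : l ((-1) *: g) = - l g.
    by have := llin (-1) g 0; rewrite !addr0 lz0 addr0 mulN1r.
  have bnd (z : E) : Cbd L rad k e z -> l z <= C * e.
    move=> ze; apply: le_trans (lp z) _; rewrite /p ler_wpM2l //.
    exact: Cnorm_le.
  rewrite ler_norml lerNl -lN !bnd //.
  have := Cbd_lin cover (-1) ge (@Cbd0 k).
  by rewrite !addr0 normrN normr1 mul1r.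
have lX v : l (rX X v) = - mu (rmul f v) by apply: lD; exists v.
have [u lu] := hm_hypo H llin lbd lX.
exists u; apply/eqP; rewrite -subr_eq0; apply/eqP.
apply: rfun_ext; apply: (mu_eq0 H) => g.
rewrite (_ : rmul (rX X u - f) g = -1 *: rmul f g + rmul (rX X u) g).
  (* [mu ((Xu) g) = - mu (u (Xg)) = - l (Xg) = mu (f g)]. *)
  rewrite (hm_lin H) mulN1r -lX lu (mu_parts H) addNr //.
apply: rfun_ext => q.
by rewrite -[LHS]/((rX X u q - f q) * g q) -[RHS]/(-1 * (f q * g q) + rX X u q * g q); ring.
Qed.

End Solvability.

(** * Closed range and cohomology freeness *)

Section Conclusion.
Variables (R : realType) (n : nat) (M : smoothManifold R n).
Hypothesis Mcompact : compact [set: M].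
Hypothesis Mconnected : connected [set: M].
Variable X : vectorField M.
Local Notation E := (rfun M).
Local Notation Re := complex.Re.
Local Notation Im := complex.Im.
Variables (L : seq M) (rad : M -> R).
Hypothesis cover : finite_cover L rad.
Variable mu : E -> R.
Hypothesis H : hypoelliptic_measure X L rad mu.

Lemma solve_mean (f : E) (p0 : M) : exists u : E, forall p, Xr X u p = f p - mu f.
Proof.
pose m : E := mkr (@rsmooth_cst _ _ M (mu f)).
have [|u uE] := solve Mcompact Mconnected cover H (f := f - m) p0.
  by rewrite (muB H) [mu m](hm_cst H (c := mu f)) // subrr.
by exists u => p; rewrite -[LHS]/(rX X u p) uE.
Qed.

Lemma lie_cpxE (u v : E) p : lie X (cpx u v) p = (Xr X u p +i* Xr X v p)%C.
Proof. by []. Qed.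

Lemma complexify_mu_lie f : complexify mu (lie X f) = 0.
Proof. by rewrite /complexify re_lie im_lie !(hm_inv H). Qed.

(** Solvability for mean zero identifies the range with the kernel of a continuous functional, from
    which closedness follows. *)
Lemma range_lieE (p0 : M) : range (lie X) = [set f | complexify mu f = 0].
Proof.
apply/seteqP; split=> [_ [f _ <-]|f /= /eqP]; first exact: complexify_mu_lie.
rewrite /complexify eq_complex /= => /andP[/eqP m1 /eqP m2].
have [u uE] := solve_mean (re f) p0; have [v vE] := solve_mean (im f) p0.
exists (cpx u v) => //; apply/val_inj/funext => p /=.
rewrite [LHS]lie_cpxE uE vE m1 m2 !subr0 /=.
by case: (f p).
Qed.

Lemma complexify_mu_continuous : continuous (complexify mu).
Proof.
apply: (complexify_continuous cover (hm_lin H)); exists 0, 1 => f e fe.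
by rewrite mul1r; apply: (mu_norm H) => p; exact: (Cbd_sup cover p fe).
Qed.

Lemma closed_range_lie (p0 : M) : closed (range (lie X)).
Proof.
rewrite (range_lieE p0).
apply: (preimage_closed (f := complexify mu) (D := [set 0])).
  by move=> f _; exact: complexify_mu_continuous.
apply: compact_closed; first exact: norm_hausdorff.
exact: compact_set1.
Qed.

Lemma cohomology_free (p0 : M) : Cinf_cohomology_free X.
Proof.
move=> f; exists (complexify mu f).
have [u uE] := solve_mean (re f) p0; have [v vE] := solve_mean (im f) p0.
exists (cpx u v) => p; rewrite lie_cpxE uE vE /complexify /=.
by case: (f p).
Qed.

End Conclusion.

Theorem theorem3p9 (R : realType) (n : nat) (M : smoothManifold R n)
    (Mcompact : compact [set: M]) (Mconnected : connected [set: M])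
    (O : orientation M) (X : vectorField M) :
  globally_hypoelliptic X O -> Cinf_stable X /\ Cinf_cohomology_free X.
Proof.
move=> GH; have [[p0 _]|nM] := pselect (exists p : M, True).
  have [L [rad cover]] := finite_cover_ex Mcompact.
  have [mu H] := hypoelliptic_measure_ex Mcompact Mconnected GH cover p0.
  split; first exact: (closed_range_lie Mcompact Mconnected cover H p0).
  exact: (cohomology_free Mcompact Mconnected cover H p0).
(* The hypotheses allow an empty [M], on which all functions coincide. *)
have M0 (p : M) : False by apply: nM; exists p.
split; last by move=> f; exists 0, f => p; case: (M0 p).
rewrite /Cinf_stable (_ : range (lie X) = setT); first exact: closedT.
apply/seteqP; split=> // f _; exists f => //.
by apply/val_inj/funext => p; case: (M0 p).
Qed.
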